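(* Let $\mu$ be a positive Borel measure on the unit circle $\mathbb{T}$, singular with respect to Lebesgue measure, let $S_\mu$ be the associated singular inner function, and suppose that there is a constant $C>0$ such that $$\omega_\mu(t)\le C\,\frac{t}{\sqrt{\log\frac{e}{t}}}\qquad\text{for all } t\in(0,1).$$ Then for every $p>2$ the function $S_\mu$ is cyclic in $D^p_{p-1}$ (and hence also cyclic in $\ell^p_A$).
   Context: $\mathbb{D}$ is the open unit disc and $\mathbb{T}$ the unit circle; $|I|$ denotes the Lebesgue measure of an arc $I\subset\mathbb{T}$. For a positive Borel measure $\mu$ on $\mathbb{T}$ singular with respect to Lebesgue measure, the associated singular inner function is $$S_\mu(z)=\exp\left\{-\int_0^{2\pi}\frac{e^{i\theta}+z}{e^{i\theta}-z}\,d\mu(\theta)\right\},\qquad z\in\mathbb{D}.$$ The modulus of smoothness of a positive Borel measure $\nu$ on $\mathbb{T}$ is $$\omega_\nu(t)=\sup\{|\nu(I)-\nu(J)| : I,J \text{ adjacent intervals (arcs) of } \mathbb{T},\ |I|=|J|\le t\}.$$ For $0<p<\infty$, $D^p_{p-1}$ is the space of analytic functions $f$ on $\mathbb{D}$ with $$\|f\|_{D^p_{p-1}}=|f(0)|+\left(\int_{\mathbb{D}}(1-|z|)^{p-1}|f'(z)|^p\,dA(z)\right)^{1/p}<\infty,$$ where $dA$ is area measure. $\ell^p_A$ is the space of analytic functions $f(z)=\sum_{k\ge0}\hat f(k)z^k$ on $\mathbb{D}$ with $\|f\|_p^p=\sum_{k\ge0}|\hat f(k)|^p<\infty$. A function $f$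 is cyclic in such a space $X$ if $f\in X$ and there is a sequence of polynomials $(p_n)$ such that $\|p_nf-1\|_X\to0$. *)

(* Defs.v *)
From HB Require Import structures.
From mathcomp Require Import all_boot all_order all_algebra.
From mathcomp Require Import complex.
From mathcomp Require Import all_classical all_reals all_analysis.

Set Implicit Arguments.
Unset Strict Implicit.
Unset Printing Implicit Defensive.

Import Order.TTheory GRing.Theory Num.Theory.
Import numFieldNormedType.Exports.

Local Open Scope classical_set_scope.
Local Open Scope ring_scope.
Local Open Scope complex_scope.

(* R-valued modulus; `|z| on R[i] is R[i]-valued. *)
Definition cmod (R : realType) (z : R[i]) : R := ComplexField.Normc.normc z.

Definition cexp (R : realType) (z : R[i]) : R[i] :=
  (expR (complex.Re z) * cos (complex.Im z))
    +i* (expR (complex.Re z) * sin (complex.Im z)).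

Definition cis (R : realType) (theta : R) : R[i] := cos theta +i* sin theta.

Definition unit_disc (R : realType) : set R[i] := [set z | `|z| < 1].

(* The unit circle is parametrized by theta |-> cis theta on [0, 2 pi[. A
   positive (finite) Borel measure on it is a finite Borel measure on R carried
   by [0, 2 pi[, and its Lebesgue measure (arc length) is the restriction of
   lebesgue_measure to [0, 2 pi[. *)
Definition circle (R : realType) : set R := `[0, 2 * pi[.

Definition on_circle (R : realType)
    (mu : {finite_measure set (measurableTypeR R) -> \bar R}) : Prop :=
  mu (~` @circle R) = 0%E.

Definition circle_singular (R : realType)
    (mu : {finite_measure set (measurableTypeR R) -> \bar R}) : Prop :=
  exists N : set (measurableTypeR R),
    [/\ measurable N, N `<=` @circle R, lebesgue_measure N = 0%E
      & mu (@circle R `\` N) = 0%E].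

(* The points of the circle whose angle has a representative modulo 2 pi in
   the interval i. *)
Definition circle_arc (R : realType) (i : interval R) : set R :=
  [set theta | @circle R theta /\
    exists k : int, theta + 2 * pi * k%:~R \in i].

(* The booleans let each endpoint be included or not; the common endpoint b
   belongs to exactly one of the two intervals. *)
Definition adjacent_arcs (R : realType) (I J : set R) : Prop :=
  exists (a b c : R) (sa sb sc : bool),
    [/\ a < b, b < c, c <= a + 2 * pi,
        I = circle_arc (Interval (BSide sa a) (BSide sb b))
      & J = circle_arc (Interval (BSide sb b) (BSide sc c))].

Definition modulus_of_smoothness (R : realType)
    (nu : {finite_measure set (measurableTypeR R) -> \bar R}) (t : R) : \bar R :=
  ereal_sup [set x | exists I J : set (measurableTypeR R),
    [/\ adjacent_arcs I J, lebesgue_measure I = lebesgue_measure J,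
        (lebesgue_measure I <= t%:E)%E & x = `|nu I - nu J|%E]].

Definition circle_integral (R : realType)
    (mu : {finite_measure set (measurableTypeR R) -> \bar R}) (g : R -> R[i]) : R[i] :=
  (\int[mu]_(theta in @circle R) complex.Re (g theta))
    +i* (\int[mu]_(theta in @circle R) complex.Im (g theta)).

Definition singular_inner (R : realType)
    (mu : {finite_measure set (measurableTypeR R) -> \bar R}) (z : R[i]) : R[i] :=
  cexp (- circle_integral mu
            (fun theta => (cis theta + z) / (cis theta - z))).

Definition analytic_on_disc (R : realType) (f : R[i] -> R[i]) : Prop :=
  forall z : R[i], @unit_disc R z -> derivable (f : R[i]^o -> R[i]^o) z 1.

Definition cderive (R : realType) (f : R[i] -> R[i]) : R[i] -> R[i] :=
  derive1 (f : R[i] -> R[i]^o).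

Definition taylor_coef (R : realType) (f : R[i] -> R[i]) (k : nat) : R[i] :=
  derive1n k (f : R[i] -> R[i]^o) 0 / k`!%:R.

Definition xy_complex (R : realType) (w : R * R) : R[i] := w.1 +i* w.2.

Definition D_norm (R : realType) (p : R) (f : R[i] -> R[i]) : \bar R :=
  ((cmod (f 0))%:E +
   (\int[lebesgue_measure \x lebesgue_measure]_(w in
        @xy_complex R @^-1` @unit_disc R)
      ((1 - cmod (xy_complex w)) `^ (p - 1) *
       cmod (cderive f (xy_complex w)) `^ p)%:E) `^ p^-1)%E.

Definition lA_norm (R : realType) (p : R) (f : R[i] -> R[i]) : \bar R :=
  ((\sum_(0 <= k <oo) (cmod (taylor_coef f k) `^ p)%:E) `^ p^-1)%E.

(* Cyclicity in the space of analytic functions on the disc with finite nrm: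
   D^p_{p-1} for nrm := D_norm p, and l^p_A for nrm := lA_norm p. *)
Definition in_space (R : realType) (nrm : (R[i] -> R[i]) -> \bar R)
    (f : R[i] -> R[i]) : Prop :=
  analytic_on_disc f /\ (nrm f < +oo)%E.

Definition cyclic_in (R : realType) (nrm : (R[i] -> R[i]) -> \bar R)
    (f : R[i] -> R[i]) : Prop :=
  in_space nrm f /\
  exists P : nat -> {poly R[i]},
    nrm (fun z => (P n).[z] * f z - 1) @[n --> \oo] --> 0%E.

(* Main.v *)
Require Import Defs.
From HB Require Import structures.
From mathcomp Require Import all_boot all_order all_algebra.
From mathcomp Require Import complex.
From mathcomp Require Import all_classical all_reals all_analysis.
From mathcomp Require Import measurable_realfun.
From mathcomp Require Import ring lra zify.
Set Implicit Arguments.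
Unset Strict Implicit.
Unset Printing Implicit Defensive.
Import Order.TTheory GRing.Theory Num.Theory.
Import numFieldNormedType.Exports.
Local Open Scope classical_set_scope.
Local Open Scope ring_scope.

(** Write the singular inner function as S = exp(-F), where F is the Herglotz
    transform of mu, and let Lam(r) = 2 - log(1 - r) and
    beta(r) = 1 / ((1 - r) sqrt(Lam(r))).

    Two facts carry the proof. The first is |F'(z)| <= K beta(|z|)
    (herglotz_derivative_bound). The imaginary part of z F'(z) is the integral
    against mu of the angular derivative of the Poisson kernel, an odd function;
    Abel summation writes it as a combination of differences of indicators of
    adjacent arcs of equal length, whose mu-measures nearly agree by the
    hypothesis on the modulus of smoothness. The gradient estimate on discs of
    radius (1 - |z|) / 2 and an integration along rays recover F' from this
    imaginary part.

    The second is that an analytic k with k(0) = 1 and |k'| <= c beta |k| cannot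
    grow fast in mean: the mean of |k|^2 over the circle |z|^2 = x is at most
    Lam(x)^(8 c^2), by Parseval and a Gronwall argument (msq_growth). The weight
    (1 - r)^(p - 1) beta(r)^p equals 1 / ((1 - r) Lam(r)^(p / 2)), so that
    |k|^2 times this weight is integrable over the disc as soon as
    8 c^2 < p / 2 - 1. This is where p > 2 enters.

    Let s = exp(-F / N) with N large, and let s_r(z) = s(r z) for r < 1. Then
    |s / s_r|^p = |k|^2 with k = exp((p / 2 N) (F_r - F)), and c = K p / N is
    small: hence the part near the circle of the energy of s / s_r is small
    uniformly in r (dil_exp_energy, energy_small). Since s / s_r tends to 1
    locally uniformly as r tends to 1, it does so in D^p_{p-1}. The function
    1 / s_r is analytic across the circle, so its Taylor polynomials can replace
    it. The same argument makes G (s Q - 1) small for some polynomial Q, whenever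
    G is bounded and G' is O(beta) (approx_factor_inverse). Taking for G the
    product of a power of s and of the polynomials already found, N steps give a
    polynomial P with P S - 1 small in D^p_{p-1} (approx_inverse). The detour
    through the roots s is what makes c small.

    The space l^p_A contains D^p_{p-1}: the coefficients with indices in
    [2^j, 2^(j+1)[ are controlled by the energy in one dyadic annulus
    (block_le_annulus), so the same polynomials work.

    Analytic functions are handled as power series whose partial sums converge
    geometrically. Integrals over circles are replaced by averages over roots of
    unity, for which Parseval's identity is a finite computation; rotation
    invariance of planar Lebesgue measure carries them to integrals over
    annuli. *)

(** * The modulus and the exponential of complex numbers *)

Section ComplexModulus.
Local Open Scope complex_scope.
Context {R : realType}.
Implicit Types (x y : R) (z w : R[i]).

Lemma normc_cmod z : `|z| = (cmod z)%:C.
Proof. by []. Qed.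

Lemma cmod_ge0 z : 0 <= cmod z.
Proof. by case: z => a b; exact: sqrtr_ge0. Qed.

Lemma cmod0 : cmod (0 : R[i]) = 0.
Proof. exact: ComplexField.Normc.normc0. Qed.

Lemma cmod1 : cmod (1 : R[i]) = 1.
Proof. exact: ComplexField.Normc.normc1. Qed.

Lemma cmodM z w : cmod (z * w) = cmod z * cmod w.
Proof. exact: ComplexField.Normc.normcM. Qed.

Lemma cmodV z : cmod z^-1 = (cmod z)^-1.
Proof. exact: ComplexField.Normc.normcV. Qed.

Lemma cmodN z : cmod (- z) = cmod z.
Proof. by case: z => a b; rewrite /cmod /= !sqrrN. Qed.

Lemma cmodB z w : cmod (z - w) = cmod (w - z).
Proof. by rewrite -cmodN opprB. Qed.

Lemma cmod_eq0 z : cmod z = 0 -> z = 0.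
Proof. exact: ComplexField.Normc.eq0_normc. Qed.

Lemma cmod_gt0 z : z != 0 -> 0 < cmod z.
Proof.
move=> z0; rewrite lt_neqAle cmod_ge0 andbT eq_sym.
by apply: contra z0 => /eqP/cmod_eq0 ->.
Qed.

Lemma ler_cmodD z w : cmod (z + w) <= cmod z + cmod w.
Proof. by have := ler_normD z w; rewrite !normc_cmod -rmorphD /= lecR. Qed.

Lemma ler_cmodB z w : cmod (z - w) <= cmod z + cmod w.
Proof. by rewrite -(cmodN w) ler_cmodD. Qed.

Lemma ler_cmod_dist z u w : cmod (z - w) <= cmod (z - u) + cmod (u - w).
Proof. by rewrite (_ : z - w = (z - u) + (u - w)) ?ler_cmodD//; ring. Qed.

Lemma ler_cmod_sub z w : cmod z - cmod w <= cmod (z - w).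
Proof. by rewrite lerBlDr (le_trans _ (ler_cmodD _ _))// subrK. Qed.

Lemma cmodX z n : cmod (z ^+ n) = cmod z ^+ n.
Proof.
by elim: n => [|n IH]; rewrite ?expr0 ?cmod1// !exprS cmodM IH.
Qed.

Lemma cmod_real x : cmod (x%:C) = `|x|.
Proof. by rewrite /cmod /= expr0n addr0 sqrtr_sqr. Qed.

Lemma cmod_nat n : cmod (n%:R : R[i]) = n%:R.
Proof.
by rewrite -[n%:R](rmorph_nat (real_complex R)) cmod_real ger0_norm.
Qed.

Lemma cmod_sqr z : cmod z ^+ 2 = complex.Re z ^+ 2 + complex.Im z ^+ 2.
Proof. by case: z => a b; rewrite /cmod /= sqr_sqrtr// addr_ge0// sqr_ge0. Qed.

Lemma Re_le_cmod z : `|complex.Re z| <= cmod z.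
Proof.
by rewrite -ler_sqr ?nnegrE ?cmod_ge0// cmod_sqr real_normK ?num_real// lerDl sqr_ge0.
Qed.

Lemma Im_le_cmod z : `|complex.Im z| <= cmod z.
Proof.
by rewrite -ler_sqr ?nnegrE ?cmod_ge0// cmod_sqr real_normK ?num_real// lerDr sqr_ge0.
Qed.

Lemma cmod_le_ReIm z : cmod z <= `|complex.Re z| + `|complex.Im z|.
Proof.
rewrite -ler_sqr ?nnegrE ?cmod_ge0 ?addr_ge0// cmod_sqr sqrrD !real_normK ?num_real//.
by rewrite addrAC lerDl mulrn_wge0// mulr_ge0.
Qed.

Lemma cmod_conj z : cmod (z^*) = cmod z.
Proof. by case: z => a b; rewrite /cmod /= sqrrN. Qed.

Lemma ler_cmod_sum (I : Type) (r : seq I) (P : pred I) (F : I -> R[i]) :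
  cmod (\sum_(i <- r | P i) F i) <= \sum_(i <- r | P i) cmod (F i).
Proof.
elim/big_ind2 : _ => [|u1 v1 u2 v2 h1 h2|//]; first by rewrite cmod0.
by rewrite (le_trans (ler_cmodD _ _))// lerD.
Qed.

Lemma cmod_cis x : cmod (cis x) = 1.
Proof. by rewrite /cmod /= cos2Dsin2 sqrtr1. Qed.

Lemma cisD x y : cis (x + y) = cis x * cis y.
Proof.
rewrite /cis cosD sinD; apply/eqP; rewrite eq_complex /=.
by apply/andP; split; apply/eqP; ring.
Qed.

Lemma cis0 : cis 0 = 1 :> R[i].
Proof. by rewrite /cis cos0 sin0. Qed.

Lemma cisMn x n : cis (x *+ n) = cis x ^+ n.
Proof.
by elim: n => [|n IH]; rewrite ?mulr0n ?cis0// mulrS exprS cisD IH.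
Qed.

Lemma cRe1 : complex.Re (1 : R[i]) = 1.
Proof. by []. Qed.
Lemma cIm1 : complex.Im (1 : R[i]) = 0.
Proof. by []. Qed.
Lemma cReD z w : complex.Re (z + w) = complex.Re z + complex.Re w.
Proof. by case: z w => a b [c d]. Qed.
Lemma cImD z w : complex.Im (z + w) = complex.Im z + complex.Im w.
Proof. by case: z w => a b [c d]. Qed.
Lemma cReN z : complex.Re (- z) = - complex.Re z.
Proof. by case: z. Qed.
Lemma cImN z : complex.Im (- z) = - complex.Im z.
Proof. by case: z. Qed.
Lemma cReM z w : complex.Re (z * w) =
  complex.Re z * complex.Re w - complex.Im z * complex.Im w.
Proof. by case: z w => a b [c d]. Qed.
Lemma cImM z w : complex.Im (z * w) =
  complex.Re z * complex.Im w + complex.Im z * complex.Re w.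
Proof. by case: z w => a b [c d]. Qed.

Lemma cReZ x z : complex.Re (x%:C * z) = x * complex.Re z.
Proof. by rewrite cReM /= mul0r subr0. Qed.
Lemma cImZ x z : complex.Im (x%:C * z) = x * complex.Im z.
Proof. by rewrite cImM /= mul0r addr0. Qed.

End ComplexModulus.

Section ComplexExponential.
Local Open Scope complex_scope.
Context {R : realType}.
Implicit Types (x y : R) (z w h : R[i]).

Lemma cexpD z w : cexp (z + w) = cexp z * cexp w.
Proof.
case: z w => a b [c d]; rewrite /cexp /= expRD cosD sinD.
by apply/eqP; rewrite eq_complex /=; apply/andP; split; apply/eqP; ring.
Qed.

Lemma cexp0 : cexp 0 = 1 :> R[i].
Proof. by rewrite /cexp /= expR0 cos0 sin0 !mul1r. Qed.

Lemma cmod_cexp z : cmod (cexp z) = expR (complex.Re z).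
Proof.
rewrite /cmod /cexp /= !exprMn -mulrDr cos2Dsin2 mulr1 sqrtr_sqr.
by rewrite ger0_norm// expR_ge0.
Qed.

Lemma cexpN z : cexp (- z) * cexp z = 1.
Proof. by rewrite -cexpD addNr cexp0. Qed.

Lemma sin_ge0_le x : 0 <= x -> `|sin x| <= x.
Proof.
rewrite le_eqVlt => /predU1P[<-|x0]; first by rewrite sin0 normr0.
have [|c _] := @MVT R sin cos 0 x x0.
  by apply: continuous_subspaceT => y; exact: continuous_sin.
rewrite sin0 !subr0 => ->; rewrite normrM (gtr0_norm x0).
by rewrite ler_piMl ?(ltW x0)// cos_max.
Qed.

Lemma ler_norm_sin x : `|sin x| <= `|x|.
Proof.
have [x0|x0] := leP 0 x; first by rewrite (ger0_norm x0) sin_ge0_le.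
by rewrite -(normrN x) -(normrN (sin x)) -sinN (gtr0_norm (x := - x)) ?sin_ge0_le// ?oppr_ge0 ?oppr_gt0// ltW.
Qed.

Lemma ler_norm_cosB1 x : `|cos x - 1| <= x ^+ 2.
Proof.
have -> : cos x - 1 = - (sin (x / 2) ^+ 2 *+ 2).
  rewrite {1}(_ : x = x / 2 + x / 2); last by field.
  rewrite cosD -!expr2 cos2sin2; ring.
rewrite normrN ger0_norm ?mulrn_wge0 ?sqr_ge0//.
have : sin (x / 2) ^+ 2 <= (x / 2) ^+ 2.
  by rewrite -[leLHS]real_normK ?num_real// -[leRHS]real_normK ?num_real// ler_sqr ?nnegrE// ler_norm_sin.
rewrite (_ : (x / 2) ^+ 2 = x ^+ 2 / 4); last by field.
move: (sin _ ^+ 2) (x ^+ 2) (sqr_ge0 x) => u v v0 uv; rewrite mulr2n; lra.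
Qed.

Lemma ler_norm_sinB x : `|sin x - x| <= `|x| ^+ 3.
Proof.
wlog x0 : x / 0 < x => [H|].
  have [x0|x0|<-] := ltgtP 0 x; first exact: H.
    have := H (- x); rewrite oppr_gt0 => /(_ x0).
    by rewrite sinN -opprD !normrN.
  by rewrite sin0 subr0 normr0 expr0n.
have [|c] := @MVT R sin cos 0 x x0.
  by apply: continuous_subspaceT => y; exact: continuous_sin.
rewrite in_itv/= => /andP[c0 cx].
rewrite sin0 !subr0 => ->.
rewrite (_ : cos c * x - x = (cos c - 1) * x); last by ring.
rewrite normrM (gtr0_norm x0) exprSr; apply: ler_wpM2r; first exact: ltW.
by rewrite (le_trans (ler_norm_cosB1 c))// ler_sqr ?nnegrE ?ltW.
Qed.

Lemma expR_sandwich x : x < 1 -> expR x <= (1 - x)^-1.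
Proof.
move=> x1; rewrite -[expR x]invrK -expRN lef_pV2 ?posrE ?expR_gt0 ?subr_gt0//.
exact: expR_ge1Dx.
Qed.

Lemma expR_taylor1 x : `|x| <= 2^-1 -> `|expR x - 1 - x| <= 2 * x ^+ 2.
Proof.
move=> xh; have /andP[h1 h2] : -2^-1 <= x <= 2^-1 by rewrite -ler_norml.
rewrite ger0_norm; last by rewrite -addrA -opprD subr_ge0 expR_ge1Dx.
have x1 : 0 < 1 - x by lra.
have h : (1 - x)^-1 <= 1 + x + 2 * x ^+ 2.
  rewrite -[leLHS]mul1r ler_pdivrMr//.
  have := mulr_ge0 (sqr_ge0 x) (_ : 0 <= 1 - 2 * x).
  rewrite subr_ge0 => /(_ ltac:(lra)); lra.
have := expR_sandwich (x := x) ltac:(lra).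
by move: h; lra.
Qed.

Lemma cexp_taylor1 h : cmod h <= 2^-1 -> cmod (cexp h - 1 - h) <= 10 * cmod h ^+ 2.
Proof.
move=> hh; set m := cmod h.
have hx : `|complex.Re h| <= m := Re_le_cmod h.
have hy : `|complex.Im h| <= m := Im_le_cmod h.
have m0 : 0 <= m := cmod_ge0 h.
apply: (le_trans (cmod_le_ReIm _)).
rewrite !(cReD, cImD, cReN, cImN) cRe1 cIm1 /=.
set x := complex.Re h in hx *; set y := complex.Im h in hy *.
have e1 : `|expR x - 1 - x| <= 2 * x ^+ 2 by apply: expR_taylor1; exact: le_trans hx hh.
have c1 := ler_norm_cosB1 y.
have s1 := ler_norm_sinB y.
have sq u : `|u| <= m -> u ^+ 2 <= m ^+ 2.
  by move=> um; rewrite -[leLHS]real_normK ?num_real// ler_sqr ?nnegrE.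
have x2 := sq _ hx; have y2 := sq _ hy.
have E2 : expR x <= 2.
  have : x <= 2^-1 by rewrite (le_trans (ler_norm _))// (le_trans hx).
  move=> x12; rewrite (le_trans (expR_sandwich _))//; first lra.
  by rewrite -[leLHS]mul1r ler_pdivrMr; lra.
have E0 := expR_ge0 x.
have y3 : `|y| ^+ 3 <= 2^-1 * m ^+ 2.
  by rewrite exprS ler_pM ?exprn_ge0// ?(le_trans hy)// ler_sqr ?nnegrE.
have -> : expR x * cos y - 1 - x = (expR x - 1 - x) + expR x * (cos y - 1) by ring.
have -> : expR x * sin y - 0 - y = expR x * (sin y - y) + (expR x - 1 - x) * y + x * y by ring.
have A : `|expR x * (cos y - 1)| <= 2 * m ^+ 2.
  by rewrite normrM (ger0_norm E0) ler_pM// (le_trans c1).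
have B : `|expR x * (sin y - y)| <= m ^+ 2.
  rewrite normrM (ger0_norm E0) (_ : m ^+ 2 = 2 * (2^-1 * m ^+ 2)); last by field.
  by rewrite ler_pM// (le_trans s1).
have D : `|(expR x - 1 - x) * y| <= m ^+ 2.
  rewrite normrM (_ : m ^+ 2 = (2 * m ^+ 2) * 2^-1); last by field.
  by rewrite ler_pM// ?(le_trans hy)// (le_trans e1)// ler_wpM2l.
have F : `|x * y| <= m ^+ 2 by rewrite normrM expr2 ler_pM.
have := ler_normD (expR x - 1 - x) (expR x * (cos y - 1)).
have := ler_normD (expR x * (sin y - y) + (expR x - 1 - x) * y) (x * y).
have := ler_normD (expR x * (sin y - y)) ((expR x - 1 - x) * y).
by have := sqr_ge0 m; lra.
Qed.

End ComplexExponential.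

(** * Complex derivatives with a quadratic remainder *)

(** Over a numFieldType, so as to serve for real and complex derivatives. *)
Lemma is_derive_quadratic (K : numFieldType) (f : K -> K^o) (x d M eta : K) :
  0 < eta ->
  (forall h, `|h| <= eta -> `|f (x + h) - f x - h * d| <= M * `|h| ^+ 2) ->
  is_derive (x : K^o) 1 (f : K^o -> K^o) d.
Proof.
move=> eta0 H.
have cv : h^-1 *: ((f \o shift x) (h *: 1) - f x) @[h --> 0^'] --> (d : K^o).
  apply/cvgrPdist_le => /= e e0.
  have M0 : 0 <= M.
    have := H eta; rewrite (gtr0_norm eta0) lexx => /(_ isT) /(le_trans (normr_ge0 _)).
    by rewrite pmulr_lge0// exprn_gt0.
  have M1 : 0 < M + 1 by rewrite ltr_wpDl.
  have k0 : 0 < e / (M + 1) by rewrite divr_gt0.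
  near=> h.
  have h0 : h != 0 by near: h; exact: nbhs_dnbhs_neq.
  have n0 : 0 < `|h| by rewrite normr_gt0.
  have he : `|h| <= eta.
    near: h; apply: (@dnbhs0_le K K^o); exact: eta0.
  have hM : `|h| <= e / (M + 1).
    near: h; apply: (@dnbhs0_le K K^o); exact: k0.
  have -> : d - h^-1 *: (f (h *: 1 + x) - f x) =
    - (h^-1 * (f (x + h) - f x - h * d)).
    rewrite /GRing.scale /= mulr1 (addrC h x); field; exact: h0.
  rewrite normrN normrM normfV ler_pdivrMl//.
  apply: (le_trans (H _ he)).
  rewrite expr2 mulrCA ler_wpM2l//.
  move: hM; rewrite ler_pdivlMr// => hM; rewrite mulrC.
  by rewrite (le_trans _ hM)// ler_wpM2l// lerDl.
split; last exact: cvg_lim.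
by apply/cvg_ex; exists d.
Unshelve. all: by end_near. Qed.

Section ComplexDerivative.
Local Open Scope complex_scope.
Context {R : realType}.
Implicit Types (f g : R[i] -> R[i]) (z h d : R[i]).

(** Complex differentiability with a quadratic remainder: every function
    below is locally analytic, and a quadratic remainder makes the product and
    chain rules purely algebraic. *)
Definition cdiff f z d := exists M eta : R,
  [/\ 0 <= M, 0 < eta &
    forall h, cmod h <= eta -> cmod (f (z + h) - f z - h * d) <= M * cmod h ^+ 2].

Lemma cdiff_is_derive f z d :
  cdiff f z d -> is_derive (z : R[i]^o) 1 (f : R[i]^o -> R[i]^o) d.
Proof.
move=> [M [eta [M0 eta0 H]]].
apply: (@is_derive_quadratic R[i] f z d M%:C eta%:C); first by rewrite ltcR.
move=> h; rewrite normc_cmod lecR => /H.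
by rewrite !normc_cmod -rmorphXn -rmorphM /= lecR.
Qed.

Lemma cdiff_derivable f z d :
  cdiff f z d -> derivable (f : R[i]^o -> R[i]^o) z 1.
Proof. by move=> /cdiff_is_derive []. Qed.

Lemma cdiff_cderive f z d : cdiff f z d -> cderive f z = d.
Proof.
move=> /cdiff_is_derive H; rewrite /cderive derive1E.
exact: (@derive_val _ _ _ _ _ _ _ H).
Qed.

(** Reduces estimates on f to one-variable calculus along a segment. *)
Lemma cdiff_ray f z (v : R[i]) (t : R) d : cdiff f (z + t%:C * v) d ->
  is_derive t 1 (fun t : R => complex.Re (f (z + t%:C * v))) (complex.Re (v * d)).
Proof.
move=> [M [eta [M0 eta0 H]]].
pose B := cmod v + 1.
have B0 : 0 < B by rewrite ltr_wpDl// cmod_ge0.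
apply: (@is_derive_quadratic R _ _ _ (M * B ^+ 2) (eta / B)).
  by rewrite divr_gt0.
move=> h hh.
have hv : cmod (h%:C * v) <= `|h| * B by rewrite cmodM cmod_real ler_wpM2l// lerDl.
have := H (h%:C * v); rewrite (le_trans hv) ?ler_pdivlMr// => [/(_ isT)|]; last by rewrite -ler_pdivlMr.
rewrite -(addrA z) -mulrDl -rmorphD /= => K.
set A := f _ - _ - _ in K.
have <- : complex.Re A = complex.Re (f (z + (t + h)%:C * v)) -
    complex.Re (f (z + t%:C * v)) - h * complex.Re (v * d).
  by rewrite /A !(cReD, cReN) -mulrA cReZ.
apply: (le_trans (Re_le_cmod _)); apply: (le_trans K).
rewrite -mulrA ler_wpM2l// (mulrC (B ^+ 2)) -exprMn ler_sqr ?nnegrE ?cmod_ge0//.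
by rewrite mulr_ge0// ltW.
Qed.

Lemma cdiff_ext f g z d : cmod z < 1 ->
  (forall w, cmod w < 1 -> f w = g w) -> cdiff f z d -> cdiff g z d.
Proof.
move=> z1 fg [M [eta [M0 eta0 H]]].
exists M, (Num.min eta ((1 - cmod z) / 2)); split => //.
  by rewrite lt_min eta0 divr_gt0// subr_gt0.
move=> h; rewrite le_min => /andP[h1 h2].
rewrite -!fg//; first exact: H.
by rewrite (le_lt_trans (ler_cmodD _ _))//; lra.
Qed.

Lemma cdiff_cst (c : R[i]) z : cdiff (fun=> c) z 0.
Proof.
exists 0, 1; split => // h _; rewrite mulr0 !subrr cmod0 mul0r//.
Qed.

Lemma cdiffD f g z d e : cdiff f z d -> cdiff g z e ->
  cdiff (fun z => f z + g z) z (d + e).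
Proof.
move=> [M [eta [M0 eta0 H]]] [N [eta' [N0 eta'0 H']]].
exists (M + N), (Num.min eta eta'); split; rewrite ?addr_ge0 ?lt_min ?eta0//.
move=> h; rewrite le_min => /andP[/H h1 /H' h2].
set A := cmod _; rewrite mulrDl; apply: le_trans (lerD h1 h2).
apply: le_trans (ler_cmodD _ _); rewrite /A le_eqVlt; apply/orP; left; apply/eqP.
by congr cmod; ring.
Qed.

Lemma cdiff_bounded f z d : cdiff f z d ->
  exists M eta : R, [/\ 0 <= M, 0 < eta & forall h, cmod h <= eta ->
    cmod (f (z + h) - f z) <= M * cmod h].
Proof.
move=> [M [eta [M0 eta0 H]]].
exists (M + cmod d), (Num.min eta 1); split; rewrite ?addr_ge0 ?cmod_ge0 ?lt_min ?eta0//=.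
move=> h; rewrite le_min => /andP[/H h1 h2].
have -> : f (z + h) - f z = (f (z + h) - f z - h * d) + h * d by ring.
apply: (le_trans (ler_cmodD _ _)); rewrite cmodM mulrDl (mulrC (cmod d)) lerD2r.
rewrite (le_trans h1)// ler_wpM2l// expr2 ler_piMl ?cmod_ge0//.
Qed.

Lemma cdiffM f g z d e : cdiff f z d -> cdiff g z e ->
  cdiff (fun z => f z * g z) z (d * g z + f z * e).
Proof.
move=> Hf Hg.
have [A [r [A0 r0 HA]]] := cdiff_bounded Hf.
have [B [s [B0 s0 HB]]] := cdiff_bounded Hg.
move: Hf Hg => [M [eta [M0 eta0 H]]] [N [eta' [N0 eta'0 H']]].
exists (A * B + M * cmod (g z) + cmod (f z) * N), (Num.min (Num.min eta eta') (Num.min r s)).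
split; first by rewrite !addr_ge0 ?mulr_ge0 ?cmod_ge0.
  by rewrite !lt_min eta0 eta'0 r0 s0.
move=> h; rewrite !le_min => /andP[/andP[/H h1 /H' h2] /andP[/HA h3 /HB h4]].
have -> : f (z + h) * g (z + h) - f z * g z - h * (d * g z + f z * e) =
  (f (z + h) - f z) * (g (z + h) - g z) + (f (z + h) - f z - h * d) * g z +
  f z * (g (z + h) - g z - h * e) by ring.
apply: (le_trans (ler_cmodD _ _)); rewrite [leRHS]mulrDl lerD//; last first.
  by rewrite cmodM -mulrA ler_wpM2l ?cmod_ge0.
apply: (le_trans (ler_cmodD _ _)); rewrite [leRHS]mulrDl lerD//; last first.
  by rewrite cmodM mulrAC ler_wpM2r ?cmod_ge0.
by rewrite cmodM expr2 mulrACA ler_pM ?cmod_ge0.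
Qed.

Lemma cdiffZ f z d (c : R[i]) : cdiff f z d -> cdiff (fun z => c * f z) z (c * d).
Proof.
move=> H; have := cdiffM (cdiff_cst c z) H.
by rewrite mul0r add0r.
Qed.

Lemma cdiffB f g z d e : cdiff f z d -> cdiff g z e ->
  cdiff (fun z => f z - g z) z (d - e).
Proof.
move=> Hf /(cdiffZ (-1)) /(cdiffD Hf); rewrite mulN1r.
by under eq_fun do rewrite mulN1r.
Qed.

Lemma cdiff_dilate f z d (c : R[i]) : cdiff f (c * z) d ->
  cdiff (fun z => f (c * z)) z (c * d).
Proof.
move=> [M [eta [M0 eta0 H]]].
pose B := cmod c + 1.
have B0 : 0 < B by rewrite ltr_wpDl// cmod_ge0.
exists (M * B ^+ 2), (eta / B); split; [by rewrite mulr_ge0 ?sqr_ge0 | by rewrite divr_gt0 |].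
move=> h hh.
have hv : cmod (c * h) <= B * cmod h by rewrite cmodM ler_wpM2r ?cmod_ge0// lerDl.
rewrite mulrDr.
have := H (c * h); rewrite (le_trans hv) => [/(_ isT)|]; last first.
  by rewrite mulrC -ler_pdivlMr.
rewrite -mulrA mulrCA => K; rewrite (le_trans K)//.
rewrite -mulrA ler_wpM2l// -exprMn ler_sqr ?nnegrE ?cmod_ge0//.
by rewrite mulr_ge0 ?cmod_ge0// ltW.
Qed.

Lemma cdiff_cexp f z d : cdiff f z d ->
  cdiff (fun z => cexp (f z)) z (d * cexp (f z)).
Proof.
move=> Hf; have [A [r [A0 r0 HA]]] := cdiff_bounded Hf.
move: Hf => [M [eta [M0 eta0 H]]].
have A1 : 0 < A + 1 by rewrite ltr_wpDl.
exists (cmod (cexp (f z)) * (10 * A ^+ 2 + M)), (Num.min (Num.min eta r) (2^-1 / (A + 1))).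
split; rewrite ?mulr_ge0 ?addr_ge0 ?cmod_ge0 ?mulr_ge0 ?sqr_ge0//.
  by rewrite !lt_min eta0 r0 divr_gt0.
move=> h; rewrite !le_min => /andP[/andP[/H h1 /HA h2]].
rewrite ler_pdivlMr// => h3.
set u := f (z + h) - f z in h2.
have -> : f (z + h) = f z + u by rewrite /u; ring.
rewrite cexpD.
have -> : cexp (f z) * cexp u - cexp (f z) - h * (d * cexp (f z)) =
  cexp (f z) * ((cexp u - 1 - u) + (u - h * d)) by ring.
rewrite cmodM -mulrA ler_wpM2l ?cmod_ge0// (le_trans (ler_cmodD _ _))// mulrDl lerD//.
rewrite (le_trans (cexp_taylor1 _))//.
  by rewrite (le_trans h2)// (le_trans _ h3)// mulrC ler_wpM2l ?cmod_ge0// lerDl.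
by rewrite -mulrA ler_wpM2l// -exprMn ler_sqr ?nnegrE ?cmod_ge0// mulr_ge0 ?cmod_ge0.
Qed.

(** Constancy is reduced to real calculus on the segment from 0 to z; a
    rotation by 1 and -i recovers the real and imaginary parts. *)
Lemma cdiff0_constant f : (forall z, cmod z < 1 -> cdiff f z 0) ->
  forall z, cmod z < 1 -> f z = f 0.
Proof.
move=> H z z1.
have K (c : R[i]) : complex.Re (c * f z) = complex.Re (c * f 0).
  pose F (t : R) := complex.Re (c * f (0 + t%:C * z)).
  have dF (t : R) : `|t| <= 1 -> is_derive t 1 F (0 : R).
    move=> t1.
    have Ht : cdiff f (0 + t%:C * z) 0.
      apply: H; rewrite add0r cmodM cmod_real (le_lt_trans _ z1)//.
      by rewrite ler_piMl ?cmod_ge0.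
    have := cdiff_ray (cdiffZ c Ht).
    by rewrite !mulr0.
  have [| |t _] := @MVT R F (fun=> 0) 0 1 ltr01.
  - by move=> t; rewrite in_itv/= => /andP[t0 t1]; apply: dF; rewrite ger0_norm ltW.
  - apply: derivable_within_continuous => t; rewrite in_itv/= => /andP[t0 t1].
    by have [] := dF t ltac:(by rewrite ger0_norm).
  by rewrite /F mul0r mul1r mul0r !add0r => /eqP; rewrite subr_eq0 => /eqP.
have := K 1; have := K 'i%C; rewrite !mul1r !cReM /= !mul0r !mul1r !sub0r => /oppr_inj h1 h2.
by apply/eqP; rewrite eq_complex h1 h2 !eqxx.
Qed.

End ComplexDerivative.

(** * Power series on the unit disc *)

Section GeometricSequences.
Local Open Scope complex_scope.
Context {R : realType}.
Implicit Types (q t M : R).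

Lemma nat_geometric_bound t n : 0 <= t -> t < 1 -> n%:R * t ^+ n <= (1 - t)^-1.
Proof.
move=> t0 t1; have t1' : 0 < 1 - t by rewrite subr_gt0.
rewrite -[leRHS]mul1r ler_pdivlMr//.
have H : forall m, (m%:R * t ^+ m) * (1 - t) <= 1 - t ^+ m.
  elim=> [|m IH]; first by rewrite !mul0r expr0 subrr.
  have tm := exprn_ge0 m t0; have tm1 : t ^+ m <= 1 by rewrite exprn_ile1// ltW.
  rewrite exprS -natr1.
  have := ler_wpM2l t0 IH; have : 0 <= (1 - t) * (1 - t * t ^+ m).
    by rewrite mulr_ge0// ?ltW// subr_gt0 -exprS exprn_ilt1.
  have : 0 <= (1 - t) * (t ^+ m * (1 - t)) by rewrite !mulr_ge0// ltW.
  lra.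
by rewrite (le_trans (H n))// gerBl exprn_ge0.
Qed.

Lemma sum_geometric_le t n : 0 <= t -> t < 1 ->
  \sum_(i < n) t ^+ i <= (1 - t)^-1.
Proof.
move=> t0 t1; have t1' : 0 < 1 - t by rewrite subr_gt0.
rewrite -[leRHS]mul1r ler_pdivlMr// mulrC -opprB mulNr -subrX1 opprB.
by rewrite gerBl exprn_ge0.
Qed.

Lemma geometric_weaken M t s n : 0 <= t -> t <= s -> M * t ^+ n <= `|M| * s ^+ n.
Proof.
move=> t0 ts; rewrite (le_trans (ler_wpM2r _ (ler_norm M))) ?exprn_ge0//.
by rewrite ler_wpM2l// lerXn2r// nnegrE// (le_trans t0).
Qed.

Lemma geometric_small M t e : 0 <= t -> t < 1 -> 0 < e ->
  exists N, forall n, (N <= n)%N -> M * t ^+ n <= e.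
Proof.
move=> t0 t1 e0; have t1' : 0 < 1 - t by rewrite subr_gt0.
pose x := `|M| / (1 - t) / e.
have x0 : 0 <= x by rewrite !divr_ge0 // ltW.
exists (Num.bound x).+1 => n Nn.
have n0 : (0 : R) < n%:R by rewrite ltr0n (leq_trans _ Nn).
rewrite (le_trans (ler_wpM2r _ (ler_norm M))) ?exprn_ge0//.
have h := nat_geometric_bound n t0 t1.
have : x <= n%:R.
  by rewrite (le_trans (ltW (archi_boundP x0)))// ler_nat ltnW.
rewrite /x ler_pdivrMr// => hx.
rewrite -(ler_pM2l n0) mulrCA (le_trans _ hx)// ler_wpM2l//.
Qed.

(** The intervals of center x n and radius proportional to t^n are nested; the
    limit is the supremum of their left ends. *)
Lemma real_geometric_cauchy (x : nat -> R) M t : 0 <= t -> t < 1 -> 0 <= M ->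
  (forall n, `|x n.+1 - x n| <= M * t ^+ n) ->
  exists l, forall n, `|l - x n| <= M / (1 - t) * t ^+ n.
Proof.
move=> t0 t1 M0 H; have t1' : 0 < 1 - t by rewrite subr_gt0.
pose K := M / (1 - t).
have Kt : K * (1 - t) = M by rewrite /K divfK// gt_eqF.
have lo n : x n - K * t ^+ n <= x n.+1 - K * t ^+ n.+1.
  have := H n; rewrite ler_norml => /andP[h _].
  have e : K * t ^+ n - K * t ^+ n.+1 = M * t ^+ n by rewrite -Kt exprS; ring.
  lra.
have hi n : x n.+1 + K * t ^+ n.+1 <= x n + K * t ^+ n.
  have := H n; rewrite ler_norml => /andP[_ h].
  have e : K * t ^+ n - K * t ^+ n.+1 = M * t ^+ n by rewrite -Kt exprS; ring.
  lra.
have lo' n k : x n - K * t ^+ n <= x (n + k)%N - K * t ^+ (n + k).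
  by elim: k => [|k IH]; rewrite ?addn0// addnS (le_trans IH).
have hi' n k : x (n + k)%N + K * t ^+ (n + k) <= x n + K * t ^+ n.
  by elim: k => [|k IH]; rewrite ?addn0// addnS (le_trans _ IH).
have K0 : 0 <= K by rewrite divr_ge0// ltW.
have lohi n m : x n - K * t ^+ n <= x m + K * t ^+ m.
  rewrite (le_trans (lo' n m))// (le_trans _ (hi' m n))// addnC.
  by rewrite lerD2l ge0_cp// mulr_ge0// exprn_ge0.
pose E := range (fun n => x n - K * t ^+ n).
exists (sup E) => n; rewrite ler_norml; apply/andP; split.
  rewrite lerBrDr addrC; apply: ub_le_sup; last by exists n.
  by exists (x 0%N + K * t ^+ 0) => _ [m _ <-].
rewrite lerBlDr addrC; apply: ge_sup; first by exists (x 0%N - K * t ^+ 0); exists 0%N.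
by move=> _ [m _ <-].
Qed.

End GeometricSequences.

Section GeometricLimits.
Local Open Scope complex_scope.
Context {R : realType}.
Implicit Types (u v : nat -> R[i]) (l : R[i]).

(** Convergence at a geometric rate is the only kind of limit met in the
    open disc, and it is stable under algebra without any epsilon. *)
Definition geo_lim u l := exists M t : R,
  [/\ 0 <= t, t < 1 & forall n, cmod (l - u n) <= M * t ^+ n].

Lemma geo_limW u l (M t : R) : 0 <= t -> t < 1 ->
  (forall n, cmod (l - u n) <= M * t ^+ n) -> geo_lim u l.
Proof. by move=> *; exists M, t. Qed.

Lemma geo_lim_ext u v l : u =1 v -> geo_lim u l -> geo_lim v l.
Proof. by move=> /funext ->. Qed.

Lemma geo_lim_near u l : geo_lim u l -> forall e, 0 < e ->
  exists N, forall n, (N <= n)%N -> cmod (l - u n) <= e.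
Proof.
move=> [M [t [t0 t1 H]]] e e0.
have [N HN] := geometric_small M t0 t1 e0.
by exists N => n /HN; apply: le_trans.
Qed.

Lemma geo_lim_unique u l1 l2 : geo_lim u l1 -> geo_lim u l2 -> l1 = l2.
Proof.
move=> /geo_lim_near H1 /geo_lim_near H2; apply/eqP; rewrite -subr_eq0.
apply/eqP/cmod_eq0/le_anti; rewrite cmod_ge0 andbT.
apply/ler_addgt0Pl => e e0; rewrite addr0.
have e2 : 0 < e / 2 by rewrite divr_gt0.
have [N1 h1] := H1 _ e2; have [N2 h2] := H2 _ e2.
have := h1 (maxn N1 N2); have := h2 (maxn N1 N2).
rewrite leq_maxl leq_maxr => /(_ isT) a /(_ isT) b.
rewrite (le_trans (ler_cmod_dist _ (u (maxn N1 N2)) _))//.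
by rewrite (cmodB (u _)); lra.
Qed.

Lemma geo_lim_le u l (B : R) : geo_lim u l -> (exists N, forall n, (N <= n)%N -> cmod (u n) <= B) ->
  cmod l <= B.
Proof.
move=> /geo_lim_near H [N HB]; apply/ler_addgt0Pl => e e0.
have [N' HN] := H _ e0; have := HN _ (leq_maxr N N'); have := HB _ (leq_maxl N N').
set v := u _ => h1 h2.
rewrite (_ : l = (l - v) + v); last by ring.
by rewrite (le_trans (ler_cmodD _ _))// lerD.
Qed.

Lemma geo_limD u v l m : geo_lim u l -> geo_lim v m ->
  geo_lim (fun n => u n + v n) (l + m).
Proof.
move=> [M [t [t0 t1 H]]] [N [s [s0 s1 K]]].
exists (`|M| + `|N|), (Num.max t s); split; rewrite ?le_max ?t0 ?gt_max ?t1//.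
move=> n; rewrite opprD addrACA (le_trans (ler_cmodD _ _))// mulrDl lerD//.
  by rewrite (le_trans (H n))// geometric_weaken// le_max lexx.
by rewrite (le_trans (K n))// geometric_weaken// le_max lexx orbT.
Qed.

Lemma geo_limZ u l (c : R[i]) : geo_lim u l -> geo_lim (fun n => c * u n) (c * l).
Proof.
move=> [M [t [t0 t1 H]]]; exists (cmod c * M), t; split => // n.
by rewrite -mulrBr cmodM -mulrA ler_wpM2l ?cmod_ge0.
Qed.

Lemma geo_lim_bounded u l : geo_lim u l -> exists B, forall n, cmod (u n) <= B.
Proof.
move=> [M [t [t0 t1 H]]]; exists (cmod l + `|M|) => n.
rewrite (_ : u n = l - (l - u n)); last by ring.
rewrite (le_trans (ler_cmodB _ _))// lerD2l (le_trans (H n))//.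
rewrite (le_trans (geometric_weaken _ _ t0 (ltW t1)))// expr1n mulr1//.
Qed.

Lemma geo_limM u v l m : geo_lim u l -> geo_lim v m ->
  geo_lim (fun n => u n * v n) (l * m).
Proof.
move=> Hu [N [s [s0 s1 K]]].
have [B HB] := geo_lim_bounded Hu; move: Hu => [M [t [t0 t1 H]]].
exists (`|M| * cmod m + B * `|N|), (Num.max t s); split; rewrite ?le_max ?t0 ?gt_max ?t1//.
move=> n; have -> : l * m - u n * v n = (l - u n) * m + u n * (m - v n) by ring.
rewrite (le_trans (ler_cmodD _ _))// [leRHS]mulrDl lerD// cmodM.
  rewrite mulrAC ler_wpM2r ?cmod_ge0// (le_trans (H n))// geometric_weaken//.
  by rewrite le_max lexx.
rewrite -mulrA ler_pM ?cmod_ge0//.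
by rewrite (le_trans (K n))// geometric_weaken// le_max lexx orbT.
Qed.

Lemma geo_limS u l : geo_lim u l -> geo_lim (fun n => u n.+1) l.
Proof.
move=> [M [t [t0 t1 H]]]; exists `|M|, t; split => // n.
rewrite (le_trans (H n.+1))// (le_trans (geometric_weaken M n.+1 t0 (lexx t)))//.
by rewrite exprS mulrCA ler_piMl ?mulr_ge0 ?exprn_ge0// ltW.
Qed.

Lemma geo_lim_perturb u v l : geo_lim u l -> geo_lim (fun n => u n - v n) 0 ->
  geo_lim v l.
Proof.
move=> Hu /(geo_limZ (-1)) /(geo_limD Hu); rewrite mulr0 addr0.
by under eq_fun do rewrite mulN1r opprB addrC subrK.
Qed.

Lemma geo_cauchy u (M t : R) : 0 <= t -> t < 1 -> 0 <= M ->
  (forall n, cmod (u n.+1 - u n) <= M * t ^+ n) ->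
  exists l, forall n, cmod (l - u n) <= 2 * M / (1 - t) * t ^+ n.
Proof.
move=> t0 t1 M0 H.
have [n|a Ha] := real_geometric_cauchy (x := fun n => complex.Re (u n)) t0 t1 M0.
  by rewrite (le_trans _ (H n))// -cReN -cReD Re_le_cmod.
have [n|b Hb] := real_geometric_cauchy (x := fun n => complex.Im (u n)) t0 t1 M0.
  by rewrite (le_trans _ (H n))// -cImN -cImD Im_le_cmod.
exists (a +i* b) => n; rewrite (le_trans (cmod_le_ReIm _))//.
rewrite !(cReD, cImD, cReN, cImN) /=.
have -> : 2 * M / (1 - t) * t ^+ n = M / (1 - t) * t ^+ n + M / (1 - t) * t ^+ n by ring.
by rewrite lerD.
Qed.

End GeometricLimits.

Section PowerSeries.
Local Open Scope complex_scope.
Context {R : realType}.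
Implicit Types (a b : nat -> R[i]) (z w h : R[i]).

Definition psum a n z := \sum_(i < n) a i * z ^+ i.

(** The radius of convergence is at least 1. *)
Definition rad1 a := forall rho : R, 0 <= rho -> rho < 1 ->
  exists M, forall n, cmod (a n) * rho ^+ n <= M.

(** The sum where the partial sums converge geometrically, 0 elsewhere. *)
Definition pval a z : R[i] := xget 0 [set l | geo_lim (fun n => psum a n z) l].

Lemma psumS a n z : psum a n.+1 z = psum a n z + a n * z ^+ n.
Proof. by rewrite /psum big_ord_recr. Qed.

Lemma pval_unique a z l : geo_lim (fun n => psum a n z) l -> pval a z = l.
Proof.
by move=> H; apply: xget_unique => // l' /geo_lim_unique; exact.
Qed.

(** A larger radius buys geometric decay. *)
Lemma rad1_geometric a (q : R) : rad1 a -> 0 <= q -> q < 1 ->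
  exists M t : R, [/\ 0 <= M, 0 <= t, t < 1 &
    forall n, cmod (a n) * q ^+ n <= M * t ^+ n].
Proof.
move=> Ha q0 q1; pose rho := (1 + q) / 2.
have r0 : 0 < rho by rewrite /rho; lra.
have r1 : rho < 1 by rewrite /rho; lra.
have qr : q < rho by rewrite /rho; lra.
have [M HM] := Ha rho (ltW r0) r1.
exists M, (q / rho); split.
- by rewrite (le_trans _ (HM 0%N))// mulr_ge0 ?cmod_ge0// exprn_ge0// ltW.
- by rewrite divr_ge0// ltW.
- by rewrite ltr_pdivrMr// mul1r.
by move=> n; rewrite expr_div_n mulrA ler_pdivlMr ?exprn_gt0// mulrAC ler_wpM2r ?exprn_ge0.
Qed.

Lemma pvalP a (q : R) : rad1 a -> 0 <= q -> q < 1 ->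
  exists M t : R, [/\ 0 <= M, 0 <= t, t < 1 &
    forall z n, cmod z <= q -> cmod (pval a z - psum a n z) <= M * t ^+ n].
Proof.
move=> Ha q0 q1; have [M [t [M0 t0 t1 H]]] := rad1_geometric Ha q0 q1.
exists (2 * M / (1 - t)), t; split => //.
  by rewrite divr_ge0 ?mulr_ge0// subr_ge0 ltW.
move=> z n zq.
have [k|l Hl] := @geo_cauchy _ (fun n => psum a n z) M t t0 t1 M0.
  rewrite psumS addrAC subrr add0r cmodM cmodX (le_trans _ (H k))//.
  by rewrite ler_wpM2l ?cmod_ge0// lerXn2r// nnegrE cmod_ge0.
rewrite (_ : pval a z = l)//; apply: pval_unique.
exact: geo_limW Hl.
Qed.

Lemma pval_geo_lim a z : rad1 a -> cmod z < 1 ->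
  geo_lim (fun n => psum a n z) (pval a z).
Proof.
move=> Ha z1; have [M [t [M0 t0 t1 H]]] := pvalP Ha (cmod_ge0 z) z1.
by apply: (geo_limW t0 t1) => n; exact: H.
Qed.

Lemma pval_bounded a (q : R) : rad1 a -> 0 <= q -> q < 1 ->
  exists B, 0 <= B /\ forall z, cmod z <= q -> cmod (pval a z) <= B.
Proof.
move=> Ha q0 q1; have [M [t [M0 t0 t1 H]]] := pvalP Ha q0 q1.
exists M; split => // z zq; have := H z 0%N zq.
by rewrite /psum big_ord0 subr0 expr0 mulr1.
Qed.

Lemma pval0 a : pval a 0 = a 0%N.
Proof.
apply: pval_unique; exists (cmod (a 0%N)), 0; split => // -[|n].
  by rewrite /psum big_ord0 subr0 expr0 mulr1.
rewrite /psum big_ord_recl expr0 mulr1 big1 ?addr0 ?subrr ?cmod0 ?expr0n ?mulr0//.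
by move=> i _; rewrite expr0n mulr0.
Qed.

Lemma rad1_bounded a (B : R) : (forall n, cmod (a n) <= B) -> rad1 a.
Proof.
move=> H rho r0 r1; exists B => n.
rewrite (le_trans (ler_wpM2r _ (H n))) ?exprn_ge0// ler_piMr//.
  by rewrite (le_trans (cmod_ge0 _) (H 0%N)).
by rewrite exprn_ile1// ltW.
Qed.

Lemma rad1D a b : rad1 a -> rad1 b -> rad1 (fun n => a n + b n).
Proof.
move=> Ha Hb rho r0 r1; have [M H] := Ha rho r0 r1; have [N K] := Hb rho r0 r1.
exists (M + N) => n; rewrite (le_trans _ (lerD (H n) (K n)))// -mulrDl.
by rewrite ler_wpM2r ?exprn_ge0// ler_cmodD.
Qed.

Lemma rad1Z a (c : R[i]) : rad1 a -> rad1 (fun n => c * a n).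
Proof.
move=> Ha rho r0 r1; have [M H] := Ha rho r0 r1.
by exists (cmod c * M) => n; rewrite cmodM -mulrA ler_wpM2l ?cmod_ge0.
Qed.

Lemma pvalD a b z : rad1 a -> rad1 b -> cmod z < 1 ->
  pval (fun n => a n + b n) z = pval a z + pval b z.
Proof.
move=> Ha Hb z1; apply: pval_unique.
apply: geo_lim_ext (geo_limD (pval_geo_lim Ha z1) (pval_geo_lim Hb z1)) => n.
by rewrite /psum -big_split; apply: eq_bigr => i _; rewrite mulrDl.
Qed.

Lemma pvalZ a (c : R[i]) z : rad1 a -> cmod z < 1 ->
  pval (fun n => c * a n) z = c * pval a z.
Proof.
move=> Ha z1; apply: pval_unique.
apply: geo_lim_ext (geo_limZ c (pval_geo_lim Ha z1)) => n.
by rewrite /psum big_distrr; apply: eq_bigr => i _ /=; rewrite mulrA.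
Qed.

Lemma rad1_nat a : rad1 a -> rad1 (fun n => n%:R * a n).
Proof.
move=> Ha rho r0 r1; have [M [t [M0 t0 t1 H]]] := rad1_geometric Ha r0 r1.
exists (M / (1 - t)) => n; rewrite cmodM cmod_nat -mulrA.
rewrite (le_trans (ler_wpM2l _ (H n)))// mulrCA ler_wpM2l//.
exact: nat_geometric_bound.
Qed.

Lemma rad1_dilate a (c : R[i]) : rad1 a -> cmod c <= 1 ->
  rad1 (fun n => c ^+ n * a n).
Proof.
move=> Ha c1 rho r0 r1; have [M H] := Ha rho r0 r1; exists M => n.
rewrite (le_trans _ (H n))// ler_wpM2r ?exprn_ge0// cmodM cmodX.
by rewrite ler_piMl ?cmod_ge0// exprn_ile1 ?cmod_ge0.
Qed.

Lemma pval_dilate a (c : R[i]) z : rad1 a -> cmod c <= 1 -> cmod z < 1 ->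
  pval (fun n => c ^+ n * a n) z = pval a (c * z).
Proof.
move=> Ha c1 z1; apply: pval_unique.
have cz1 : cmod (c * z) < 1.
  by rewrite cmodM (le_lt_trans _ z1) ?ler_piMl ?cmod_ge0.
apply: geo_lim_ext (pval_geo_lim Ha cz1) => n.
by apply: eq_bigr => i _; rewrite exprMn; ring.
Qed.

Definition pder a (n : nat) : R[i] := n.+1%:R * a n.+1.

Lemma rad1_shift a : rad1 a -> rad1 (fun n => a n.+1).
Proof.
move=> Ha rho; rewrite le_eqVlt => /predU1P[<- _|r0 r1].
  exists (cmod (a 1%N)) => -[|n]; first by rewrite expr0 mulr1.
  by rewrite expr0n mulr0 cmod_ge0.
have [M H] := Ha rho (ltW r0) r1; exists (M / rho) => n.
by rewrite ler_pdivlMr// -mulrA -exprSr.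
Qed.

Lemma rad1_pder a : rad1 a -> rad1 (pder a).
Proof. by move=> /rad1_nat /rad1_shift. Qed.

(** The factor rho^2 on the left clears the exponent n - 2 of the natural bound. *)
Lemma monomial_taylor z h (rho : R) n : cmod z <= rho -> cmod (z + h) <= rho ->
  rho ^+ 2 * cmod ((z + h) ^+ n - z ^+ n - n%:R * h * z ^+ n.-1) <=
  cmod h ^+ 2 * (n%:R ^+ 2 * rho ^+ n).
Proof.
move=> zr zhr; have r0 : 0 <= rho := le_trans (cmod_ge0 z) zr.
elim: n => [|n IH].
  by rewrite !expr0 subrr !mul0r subr0 cmod0 expr0n /= mul0r !mulr0.
have -> : (z + h) ^+ n.+1 - z ^+ n.+1 - n.+1%:R * h * z ^+ n =
  (z + h) * ((z + h) ^+ n - z ^+ n - n%:R * h * z ^+ n.-1) +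
  n%:R * h ^+ 2 * z ^+ n.-1.
  case: n {IH} => [|n]; first by rewrite !expr0 !expr1; ring.
  by rewrite /= -!natr1 !exprS; ring.
rewrite (le_trans (ler_wpM2l _ (ler_cmodD _ _))) ?sqr_ge0// mulrDr.
have h1 : rho ^+ 2 * cmod ((z + h) * ((z + h) ^+ n - z ^+ n - n%:R * h * z ^+ n.-1)) <=
    cmod h ^+ 2 * (n%:R ^+ 2 * rho ^+ n.+1).
  rewrite cmodM mulrCA [rho ^+ n.+1]exprS.
  rewrite (_ : cmod h ^+ 2 * _ = rho * (cmod h ^+ 2 * (n%:R ^+ 2 * rho ^+ n))); last by ring.
  by rewrite ler_pM// ?cmod_ge0// mulr_ge0 ?sqr_ge0 ?cmod_ge0.
have h2 : rho ^+ 2 * cmod (n%:R * h ^+ 2 * z ^+ n.-1) <=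
    cmod h ^+ 2 * (n%:R * rho ^+ n.+1).
  rewrite !cmodM cmod_nat !cmodX.
  case: n {IH h1} => [|n] /=; first by rewrite !mul0r !mulr0.
  rewrite (_ : rho ^+ 2 * _ = (cmod h ^+ 2 * n.+1%:R * rho ^+ 2) * cmod z ^+ n); last by ring.
  rewrite [leRHS](_ : _ = (cmod h ^+ 2 * n.+1%:R * rho ^+ 2) * rho ^+ n); last by rewrite -[n.+2]addn2 (exprD rho n 2); ring.
  by apply: ler_wpM2l; rewrite ?lerXn2r ?nnegrE ?cmod_ge0// !mulr_ge0 ?sqr_ge0 ?cmod_ge0.
rewrite (le_trans (lerD h1 h2))// -mulrDr ler_wpM2l ?sqr_ge0// -mulrDl ler_wpM2r ?exprn_ge0//.
by rewrite -natr1 sqrrD1; have : (0 : R) <= n%:R by []; rewrite mulr2n; lra.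
Qed.

Lemma psum_pder a n z : psum (pder a) n z = \sum_(i < n.+1) a i * (i%:R * z ^+ i.-1).
Proof.
rewrite /psum big_ord_recl mul0r mulr0 add0r; apply: eq_bigr => i _.
by rewrite /pder lift0 /= mulrA (mulrC (a _)).
Qed.

(** The remainders of the monomials, of size n^2 |a n| rho^(n-2) |h|^2, are
    summable on a disc of intermediate radius rho. *)
Lemma cdiff_pval a z : rad1 a -> cmod z < 1 -> cdiff (pval a) z (pval (pder a) z).
Proof.
move=> Ha z1; pose rho := (1 + cmod z) / 2.
have z0 := cmod_ge0 z.
have r0 : 0 < rho by rewrite /rho; lra.
have r1 : rho < 1 by rewrite /rho; lra.
have zr : cmod z < rho by rewrite /rho; lra.
have [M [t [M0 t0 t1 H]]] := rad1_geometric (rad1_nat (rad1_nat Ha)) (ltW r0) r1.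
exists (rho ^- 2 * (M / (1 - t))), (rho - cmod z); split.
- by rewrite !mulr_ge0 ?invr_ge0 ?sqr_ge0// subr_ge0 ltW.
- by rewrite subr_gt0.
move=> h hh.
have zhr : cmod (z + h) <= rho by rewrite (le_trans (ler_cmodD _ _))//; lra.
have L1 := geo_limS (pval_geo_lim Ha (le_lt_trans zhr r1)).
have L2 := geo_limZ (-1) (geo_limS (pval_geo_lim Ha z1)).
have L3 := geo_limZ (- h) (pval_geo_lim (rad1_pder Ha) z1).
have := geo_limD (geo_limD L1 L2) L3; rewrite mulN1r mulNr => L.
apply: (geo_lim_le L); exists 0%N => n _.
rewrite psum_pder /psum mulN1r mulNr -!sumrB mulr_sumr -sumrB.
apply: (le_trans (ler_cmod_sum _ _ _)).
rewrite -mulrA ler_pdivlMl ?exprn_gt0// mulr_sumr.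
apply: (le_trans (y := \sum_(i < n.+1) (M * t ^+ i) * cmod h ^+ 2)).
  apply: ler_sum => i _.
  have -> : a i * (z + h) ^+ i - a i * z ^+ i - h * (a i * (i%:R * z ^+ i.-1)) =
    a i * ((z + h) ^+ i - z ^+ i - i%:R * h * z ^+ i.-1) by ring.
  rewrite cmodM mulrCA (le_trans (ler_wpM2l (cmod_ge0 _) (monomial_taylor i (ltW zr) zhr)))//.
  rewrite mulrCA (mulrC (_ * t ^+ _)) ler_wpM2l ?sqr_ge0// (le_trans _ (H i))//.
  by rewrite !cmodM cmod_nat; lra.
rewrite -mulr_suml ler_wpM2r ?sqr_ge0// -mulr_sumr ler_wpM2l//.
exact: sum_geometric_le.
Qed.

End PowerSeries.

(** * Products and exponentials of power series *)

Section CauchyProduct.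
Local Open Scope complex_scope.
Context {R : realType}.
Implicit Types (a b g : nat -> R[i]) (z w h : R[i]).

Lemma nat_geometric_absorb (t : R) : 0 <= t -> t < 1 ->
  exists K s : R, [/\ 0 <= K, 0 <= s, s < 1 & forall n, n.+1%:R * t ^+ n <= K * s ^+ n].
Proof.
move=> t0 t1; pose s := (1 + t) / 2.
have s0 : 0 < s by rewrite /s; lra.
have ts : t < s by rewrite /s; lra.
have ts0 : 0 <= t / s by rewrite divr_ge0// ltW.
have ts1 : t / s < 1 by rewrite ltr_pdivrMr// mul1r.
exists ((1 - t / s)^-1 + 1), s; split.
- by rewrite addr_ge0// invr_ge0 subr_ge0 ltW.
- exact: ltW.
- by rewrite /s; lra.
move=> n; have := nat_geometric_bound n ts0 ts1.
rewrite expr_div_n mulrA ler_pdivrMr ?exprn_gt0// => H.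
rewrite -natr1 !mulrDl !mul1r lerD// lerXn2r// ?nnegrE// ltW//.
Qed.

Definition conv a b n := \sum_(i < n.+1) a i * b (n - i)%N.

Lemma conv_bound a b (q A B t : R) : 0 <= q -> 0 <= A -> 0 <= B -> 0 <= t ->
  (forall n, cmod (a n) * q ^+ n <= A * t ^+ n) ->
  (forall n, cmod (b n) * q ^+ n <= B * t ^+ n) ->
  forall n, cmod (conv a b n) * q ^+ n <= A * B * (n.+1%:R * t ^+ n).
Proof.
move=> q0 A0 B0 t0 Ha Hb n.
rewrite (le_trans (ler_wpM2r _ (ler_cmod_sum _ _ _))) ?exprn_ge0// mulr_suml.
apply: (@le_trans _ _ (\sum_(i < n.+1) A * B * t ^+ n)); last first.
  by rewrite sumr_const card_ord -[leLHS]mulr_natl; lra.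
apply: ler_sum => i _.
have e (x : R) : x ^+ n = x ^+ i * x ^+ (n - i) by rewrite -exprD subnKC// -ltnS.
rewrite cmodM !e [leLHS](_ : _ = (cmod (a i) * q ^+ i) * (cmod (b (n - i)%N) * q ^+ (n - i))); last by ring.
rewrite [leRHS](_ : _ = (A * t ^+ i) * (B * t ^+ (n - i))); last by ring.
by rewrite ler_pM ?mulr_ge0 ?cmod_ge0 ?exprn_ge0.
Qed.

Lemma rad1_geometric2 a b (q : R) : rad1 a -> rad1 b -> 0 <= q -> q < 1 ->
  exists A B t : R, [/\ 0 <= A, 0 <= B, 0 <= t, t < 1 &
    forall n, cmod (a n) * q ^+ n <= A * t ^+ n /\ cmod (b n) * q ^+ n <= B * t ^+ n].
Proof.
move=> Ha Hb q0 q1.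
have [A [t [A0 t0 t1 HA]]] := rad1_geometric Ha q0 q1.
have [B [s [B0 s0 s1 HB]]] := rad1_geometric Hb q0 q1.
exists A, B, (Num.max t s); split; rewrite ?le_max ?t0 ?gt_max ?t1//.
move=> n; split.
  rewrite (le_trans (HA n))// ler_wpM2l// lerXn2r// ?nnegrE ?le_max ?t0 ?lexx//.
rewrite (le_trans (HB n))// ler_wpM2l// lerXn2r// ?nnegrE ?le_max ?s0 ?lexx ?orbT//.
Qed.

Lemma rad1_conv a b : rad1 a -> rad1 b -> rad1 (conv a b).
Proof.
move=> Ha Hb q q0 q1.
have [A [B [t [A0 B0 t0 t1 H]]]] := rad1_geometric2 Ha Hb q0 q1.
have [K [s [K0 s0 s1 HK]]] := nat_geometric_absorb t0 t1.
exists (A * B * K) => n.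
rewrite (le_trans (conv_bound q0 A0 B0 t0 (fun n => (H n).1) (fun n => (H n).2) n))//.
rewrite ler_wpM2l ?mulr_ge0// (le_trans (HK n))// ler_piMr// exprn_ile1// ltW//.
Qed.

Lemma psum_horner a n z : psum a n z = (\poly_(i < n) a i).[z].
Proof. by rewrite horner_poly. Qed.

(** The partial sums of the product agree with the product of the partial
    sums up to degree n; the excess terms are geometrically small. *)
Lemma pvalM a b z : rad1 a -> rad1 b -> cmod z < 1 ->
  pval (conv a b) z = pval a z * pval b z.
Proof.
move=> Ha Hb z1; apply: pval_unique.
apply: geo_lim_perturb (geo_limM (pval_geo_lim Ha z1) (pval_geo_lim Hb z1)) _.
have q0 := cmod_ge0 z.
have [A [B [t [A0 B0 t0 t1 H]]]] := rad1_geometric2 Ha Hb q0 z1.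
have [K [s [K0 s0 s1 HK]]] := nat_geometric_absorb t0 t1.
have [L [r [L0 r0 r1 HL]]] := nat_geometric_absorb s0 s1.
exists (A * B * K * L), r; split => // n.
rewrite sub0r cmodN !psum_horner -hornerM.
set P := \poly_(i < n) a i; set Q := \poly_(i < n) b i.
have sPQ : (size (P * Q)%R <= n + n)%N.
  rewrite (leq_trans (size_polyMleq P Q))//.
  have := size_poly n a; have := size_poly n b; rewrite -/P -/Q; lia.
rewrite (horner_coef_wide _ sPQ) big_split_ord /= horner_poly.
have -> : \sum_(i < n) (P * Q)`_i * z ^+ i = \sum_(i < n) conv a b i * z ^+ i.
  apply: eq_bigr => i _; congr (_ * _); rewrite coefM; apply: eq_bigr => j _.
  have ji : (j <= i)%N by rewrite -ltnS.
  by rewrite !coef_poly (leq_ltn_trans ji)// (leq_ltn_trans (leq_subr j i)).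
rewrite addrAC subrr add0r.
have P' j : cmod P`_j * cmod z ^+ j <= A * t ^+ j.
  rewrite coef_poly; case: ifP => _; first by have [] := H j.
  by rewrite cmod0 mul0r mulr_ge0// exprn_ge0.
have Q' j : cmod Q`_j * cmod z ^+ j <= B * t ^+ j.
  rewrite coef_poly; case: ifP => _; first by have [] := H j.
  by rewrite cmod0 mul0r mulr_ge0// exprn_ge0.
rewrite (le_trans (ler_cmod_sum _ _ _))//.
apply: (@le_trans _ _ (\sum_(i < n) A * B * K * s ^+ n)).
  apply: ler_sum => i _; rewrite cmodM cmodX coefM.
  have := conv_bound q0 A0 B0 t0 P' Q' (n + i)%N; rewrite /conv => h.
  rewrite (le_trans h)// -[leRHS]mulrA ler_wpM2l ?mulr_ge0// (le_trans (HK _))// ler_wpM2l//.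
  by rewrite exprD ler_piMr ?exprn_ge0// exprn_ile1// ltW.
rewrite sumr_const card_ord -[leLHS]mulr_natl mulrCA -[leRHS]mulrA ler_wpM2l ?mulr_ge0//.
by rewrite (le_trans _ (HL n))// ler_wpM2r ?exprn_ge0// ler_nat.
Qed.

End CauchyProduct.

Section Polynomials.
Local Open Scope complex_scope.
Context {R : realType}.
Implicit Types (P : {poly R[i]}) (z : R[i]).

Lemma rad1_poly P : rad1 (fun i => P`_i).
Proof.
apply: (@rad1_bounded _ _ (\sum_(i < size P) cmod P`_i)) => n.
have [nP|nP] := ltnP n (size P); last first.
  by rewrite nth_default// cmod0 sumr_ge0// => i _; exact: cmod_ge0.
rewrite (bigD1 (Ordinal nP))//= lerDl sumr_ge0// => i _; exact: cmod_ge0.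
Qed.

Lemma pval_poly P z : cmod z < 1 -> pval (fun i => P`_i) z = P.[z].
Proof.
move=> z1; have H := pval_geo_lim (rad1_poly P) z1.
apply/eqP; rewrite -subr_eq0; apply/eqP/cmod_eq0/le_anti; rewrite cmod_ge0 andbT.
apply/ler_addgt0Pl => e e0; rewrite addr0.
have [N HN] := geo_lim_near H e0.
have := HN _ (leq_maxl N (size P)).
by rewrite /psum -horner_coef_wide// leq_maxr.
Qed.

End Polynomials.

Section Exponential.
Local Open Scope complex_scope.
Context {R : realType}.
Implicit Types (a g : nat -> R[i]) (z : R[i]).

(** The coefficients of exp G are determined by the equation A' = G' A, which
    involves all the earlier ones: hence the accumulated list. *)
Fixpoint pexp_seq g n : seq R[i] :=
  if n is m.+1 then
    let s := pexp_seq g m in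
    rcons s (m.+1%:R^-1 * \sum_(i < m.+1) pder g i * s`_(m - i))
  else [:: cexp (g 0%N)].

Definition pexp g n := (pexp_seq g n)`_n.

Lemma size_pexp_seq g n : size (pexp_seq g n) = n.+1.
Proof. by elim: n => //= n IH; rewrite size_rcons IH. Qed.

Lemma nth_pexp_seq g n i : (i <= n)%N -> (pexp_seq g n)`_i = pexp g i.
Proof.
elim: n => [|n IH]; first by rewrite leqn0 => /eqP ->.
rewrite leq_eqVlt ltnS => /predU1P[->//|iN] /=.
by rewrite nth_rcons size_pexp_seq ltnS iN IH.
Qed.

Lemma pexp0 g : pexp g 0 = cexp (g 0%N).
Proof. by []. Qed.

Lemma pder_pexp g n : pder (pexp g) n = conv (pder g) (pexp g) n.
Proof.
rewrite /pder /pexp /= nth_rcons size_pexp_seq ltnn eqxx mulrA mulfV ?mul1r ?pnatr_eq0//.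
by apply: eq_bigr => i _; rewrite nth_pexp_seq// leq_subr.
Qed.

(** The recurrence makes the partial sums S n of |a n| rho^n grow at most like
    a product of factors 1 + B/(n+1), that is, slower than any exponential. *)
Lemma rad1_pexp g : rad1 g -> rad1 (pexp g).
Proof.
move=> /rad1_pder Hg q; rewrite le_eqVlt => /predU1P[<- _|q0 q1].
  exists (cmod (pexp g 0)) => -[|n]; first by rewrite expr0 mulr1.
  by rewrite expr0n mulr0 cmod_ge0.
pose rho := (1 + q) / 2.
have r0 : 0 < rho by rewrite /rho; lra.
have r1 : rho < 1 by rewrite /rho; lra.
have qr : q < rho by rewrite /rho; lra.
have [B HB] := Hg rho (ltW r0) r1.
have B0 : 0 <= B by rewrite (le_trans _ (HB 0%N))// mulr_ge0 ?cmod_ge0// exprn_ge0// ltW.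
pose al n := cmod (pexp g n) * rho ^+ n.
have al0 n : 0 <= al n by rewrite mulr_ge0 ?cmod_ge0// exprn_ge0// ltW.
pose S n := \sum_(i < n.+1) al i.
have S0 n : 0 <= S n by apply: sumr_ge0.
have SS n : S n.+1 = S n + al n.+1 by rewrite /S big_ord_recr.
have rec n : n.+1%:R * al n.+1 <= B * S n.
  have -> : n.+1%:R * al n.+1 = cmod (conv (pder g) (pexp g) n) * rho ^+ n * rho.
    by rewrite -pder_pexp /pder cmodM cmod_nat /al exprSr; ring.
  rewrite (le_trans (ler_piMr _ (ltW r1)))//.
    by rewrite mulr_ge0 ?cmod_ge0// exprn_ge0// ltW.
  rewrite (le_trans (ler_wpM2r _ (ler_cmod_sum _ _ _))) ?exprn_ge0 ?(ltW r0)// mulr_suml.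
  rewrite /S (reindex_inj rev_ord_inj) mulr_sumr /=; apply: ler_sum => i _.
  have in' : (i <= n)%N by rewrite -ltnS.
  rewrite subSS subKn// cmodM.
  have e : rho ^+ n = rho ^+ (n - i) * rho ^+ i by rewrite -exprD subnK.
  rewrite e [leLHS](_ : _ = (cmod (pder g (n - i)%N) * rho ^+ (n - i)) * al i); last by rewrite /al; ring.
  by rewrite ler_wpM2r.
pose th := rho / q.
have th1 : 1 < th by rewrite /th ltr_pdivlMr// mul1r.
pose x := B / (th - 1).
have x0 : 0 <= x by rewrite divr_ge0// subr_ge0 ltW.
pose N := Num.bound x.
have Sm n k : S n <= S (n + k)%N.
  by elim: k => [|k IH]; rewrite ?addn0// addnS SS (le_trans IH)// lerDl.
have grow n : (N <= n)%N -> S n.+1 <= th * S n.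
  move=> Nn; rewrite SS -lerBrDl (_ : th * S n - S n = (th - 1) * S n); last by ring.
  have n0 : (0 : R) < n.+1%:R by [].
  rewrite -(ler_pM2l n0) (le_trans (rec n))// mulrA ler_wpM2r// -ler_pdivrMr ?subr_gt0//.
  by rewrite (le_trans (ltW (archi_boundP x0)))// ler_nat ltnW.
have bound n : S n <= S N * th ^+ n.
  have [nN|Nn] := leqP n N.
    rewrite (le_trans (Sm n (N - n)%N))// subnKC// ler_peMr// exprn_ege1// ltW//.
  have -> : n = (N + (n - N))%N by rewrite subnKC// ltnW.
  elim: (n - N)%N => [|k IH]; first by rewrite addn0 ler_peMr// exprn_ege1// ltW.
  rewrite addnS (le_trans (grow _ _)) ?leq_addr// exprS mulrCA ler_wpM2l//.
  by rewrite (le_trans _ (ltW th1)).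
exists (S N) => n.
have : al n <= S N * th ^+ n.
  by rewrite (le_trans _ (bound n))// /S big_ord_recr lerDr sumr_ge0.
rewrite /al /th [(rho / q) ^+ n]expr_div_n [leRHS]mulrA ler_pdivlMr ?exprn_gt0// mulrAC.
by rewrite ler_pM2r// exprn_gt0.
Qed.

(** The product of the series and of exp(-G) has derivative 0, so it keeps the
    value 1 that it takes at the origin. *)
Lemma pval_pexp g z : rad1 g -> cmod z < 1 -> pval (pexp g) z = cexp (pval g z).
Proof.
move=> Hg z1; have Ha := rad1_pexp Hg.
pose f z := pval (pexp g) z * cexp (- pval g z).
have df w : cmod w < 1 -> cdiff f w 0.
  move=> w1; have d1 := cdiff_pval Ha w1.
  have d2 := cdiff_cexp (cdiffZ (-1) (cdiff_pval Hg w1)).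
  have := cdiffM d1 d2.
  have -> : pder (pexp g) = conv (pder g) (pexp g) by apply/funext => n; exact: pder_pexp.
  rewrite (pvalM (rad1_pder Hg) Ha w1).
  have -> : (fun z => pval (pexp g) z * cexp (-1 * pval g z)) = f.
    by apply/funext => u; rewrite mulN1r.
  by set D := (X in cdiff _ _ X -> _); have -> : D = 0 by rewrite /D; ring.
have := cdiff0_constant df z1.
rewrite /f !pval0 pexp0 (mulrC (cexp (g _))) cexpN => e.
by rewrite -[RHS]mul1r -e -mulrA cexpN mulr1.
Qed.

End Exponential.

Section TaylorCoefficients.
Local Open Scope complex_scope.
Context {R : realType}.
Implicit Types (a : nat -> R[i]) (f : R[i] -> R[i]) (z : R[i]).

Lemma cderive_pval f a z : rad1 a -> (forall w, cmod w < 1 -> f w = pval a w) ->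
  cmod z < 1 -> cderive f z = pval (pder a) z.
Proof.
move=> Ha fa z1; apply: cdiff_cderive; apply: cdiff_ext (cdiff_pval Ha z1) => //.
by move=> w w1; rewrite fa.
Qed.

Lemma rad1_iter_pder a k : rad1 a -> rad1 (iter k pder a).
Proof. by move=> Ha; elim: k => //= k; exact: rad1_pder. Qed.

Lemma derive1n_pval f a k : rad1 a -> (forall w, cmod w < 1 -> f w = pval a w) ->
  forall z, cmod z < 1 -> derive1n k (f : R[i] -> R[i]^o) z = pval (iter k pder a) z.
Proof.
move=> Ha fa; elim: k => [|k IH] z z1; first by rewrite derive1n0 /= fa.
rewrite derive1nS; exact: (cderive_pval (rad1_iter_pder k Ha)).
Qed.

Lemma iter_pder0 a k n : iter k pder a n * n`!%:R = (n + k)`!%:R * a (n + k)%N.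
Proof.
elim: k n => [|k IH] n; first by rewrite addn0 mulrC.
rewrite iterS /pder mulrAC -natrM -factS mulrC IH addSnnS//.
Qed.

Lemma taylor_coef_pval f a k : rad1 a ->
  (forall w, cmod w < 1 -> f w = pval a w) -> taylor_coef f k = a k.
Proof.
move=> Ha fa; rewrite /taylor_coef (derive1n_pval k Ha fa) ?cmod0// pval0.
have := iter_pder0 a k 0; rewrite fact0 mulr1 add0n => ->.
by rewrite mulrAC mulfV ?mul1r// pnatr_eq0 -lt0n fact_gt0.
Qed.

End TaylorCoefficients.

(** * Averages over roots of unity *)

Section RootsOfUnity.
Local Open Scope complex_scope.
Context {R : realType}.
Implicit Types (a b : nat -> R[i]) (z w x : R[i]).

Definition uroot (N : nat) : R[i] := cis (2 * pi / N%:R).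

Lemma cmod_uroot N j : cmod (uroot N ^+ j) = 1.
Proof. by rewrite cmodX cmod_cis expr1n. Qed.

Lemma cis2pi : cis (2 * pi) = 1 :> R[i].
Proof.
rewrite mulrC mulr_natr /cis cos2pi sin_mulr2n sinpi mulr0 mul0rn //.
Qed.

Lemma uroot_exp N : (0 < N)%N -> uroot N ^+ N = 1.
Proof.
move=> N0; rewrite /uroot -cisMn -(mulr_natr (_ / _)) divfK ?cis2pi// pnatr_eq0 -lt0n//.
Qed.

Lemma cos_eq1 (x : R) : 0 < x -> x < 2 * pi -> cos x != 1.
Proof.
move=> x0 x1; apply/eqP => e.
have s0 : 0 < sin (x / 2) by apply: sin_gt0_pi; apply/andP; split; lra.
have : cos x = 1 - sin (x / 2) ^+ 2 *+ 2.
  rewrite [in LHS](_ : x = x / 2 + x / 2); last by field.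
  by rewrite cosD -!expr2 cos2sin2; ring.
rewrite e => /eqP; rewrite eq_sym subr_eq addrC -subr_eq subrr eq_sym mulrn_eq0 /=.
by rewrite sqrf_eq0 gt_eqF.
Qed.

Lemma uroot_neq1 N m : (0 < m)%N -> (m < N)%N -> uroot N ^+ m != 1.
Proof.
move=> m0 mN; apply/eqP => /(congr1 (@complex.Re R)); rewrite /uroot -cisMn /=.
apply/eqP/cos_eq1.
  rewrite pmulrn_lgt0// divr_gt0 ?mulr_gt0 ?pi_gt0// ltr0n (leq_trans _ mN)//.
rewrite -(mulr_natr (_ / _)) mulrAC ltr_pdivrMr ?ltr0n ?(leq_trans _ mN)//.
by rewrite ltr_pM2l ?mulr_gt0 ?pi_gt0// ltr_nat.
Qed.

Lemma uroot_conjX N m : uroot N ^+ m * ((uroot N)^*) ^+ m = 1.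
Proof.
rewrite -exprMn -sqr_normc normc_cmod cmod_cis expr1n expr1n//.
Qed.

(** A geometric sum whose ratio is an N-th root of unity other than 1 vanishes. *)
Lemma sum_uroot N k m : (k < N)%N -> (m < N)%N ->
  \sum_(j < N) (uroot N ^+ k * (uroot N)^* ^+ m) ^+ j = (N * (k == m))%:R.
Proof.
move=> kN mN; have N0 : (0 < N)%N := leq_ltn_trans (leq0n _) kN.
have [->|km] := eqVneq k m.
  rewrite muln1 (eq_bigr (fun=> 1)) ?sumr_const ?card_ord//.
  by move=> j _; rewrite uroot_conjX expr1n.
rewrite muln0; set x := _ * _.
have xN : x ^+ N = 1.
  have u1 := uroot_exp N0.
  have u2 : (uroot N)^* ^+ N = 1 by rewrite -rmorphXn u1 rmorph1.
  by rewrite /x exprMn -!exprM (mulnC k) (mulnC m) !exprM u1 u2 !expr1n mulr1.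
have x1 : x - 1 != 0.
  rewrite subr_eq0; apply/eqP => xe.
  have kme : uroot N ^+ k = uroot N ^+ m.
    rewrite -[LHS]mulr1 -(uroot_conjX N m) mulrC -mulrA (mulrC _ (_ ^+ k)) -/x xe mulr1//.
  wlog {km} km : k m kN mN kme {x xN xe} / (k < m)%N => [H|].
    move: km; rewrite neq_ltn => /orP[/(H k m)|/(H m k)]; exact.
  have : uroot N ^+ (m - k) = 1.
    have u0 : uroot N ^+ k != 0.
      by apply/eqP => /(congr1 (@cmod R)); rewrite cmod_uroot cmod0 => /eqP; rewrite oner_eq0.
    apply: (mulfI u0); rewrite -exprD subnKC 1?ltnW// mulr1//.
  apply/eqP/uroot_neq1; first by rewrite subn_gt0.
  by rewrite (leq_ltn_trans (leq_subr _ _)).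
apply: (mulfI x1); rewrite -subrX1 xN subrr mulr0//.
Qed.

(** Finite averages replace integrals over circles: on polynomials of degree less
    than N they have the same Fourier coefficients. *)
Definition uavg N (f : R[i] -> R[i]) : R[i] := N%:R^-1 * \sum_(j < N) f (uroot N ^+ j).
Definition ravg N (f : R[i] -> R) : R := N%:R^-1 * \sum_(j < N) f (uroot N ^+ j).

Lemma ler_cmod_uavg N f (B : R) : (0 < N)%N ->
  (forall u, cmod u = 1 -> cmod (f u) <= B) -> cmod (uavg N f) <= B.
Proof.
move=> N0 H; rewrite /uavg cmodM cmodV cmod_nat ler_pdivrMl ?ltr0n//.
rewrite (le_trans (ler_cmod_sum _ _ _))// mulr_natl.
rewrite -[X in _ *+ X](card_ord N) -sumr_const; apply: ler_sum => j _.
by apply: H; exact: cmod_uroot.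
Qed.

Lemma ravg_dist N f g (e : R) : (0 < N)%N ->
  (forall u, cmod u = 1 -> `|f u - g u| <= e) -> `|ravg N f - ravg N g| <= e.
Proof.
move=> N0 H; rewrite /ravg -mulrBr normrM normfV normr_nat ler_pdivrMl ?ltr0n//.
rewrite -sumrB (le_trans (ler_norm_sum _ _ _))// mulr_natl.
rewrite -[X in _ *+ X](card_ord N) -sumr_const; apply: ler_sum => j _.
by apply: H; exact: cmod_uroot.
Qed.

(** Exact, because frequencies below N are distinguished by the N-th roots of
    unity. *)
Lemma parseval_psum a N z : (0 < N)%N ->
  ravg N (fun u => cmod (psum a N (z * u)) ^+ 2) =
  \sum_(n < N) cmod (a n) ^+ 2 * (cmod z ^+ 2) ^+ n.
Proof.
move=> N0; apply: complexI; rewrite /ravg rmorphM fmorphV rmorph_nat !rmorph_sum /=.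
have cmod2 (w : R[i]) : (cmod w ^+ 2)%:C = w * w^*.
  by rewrite -sqr_normc normc_cmod -rmorphXn.
have N0' : (N%:R : R[i]) != 0 by rewrite pnatr_eq0 -lt0n.
apply: (mulfI N0'); rewrite mulrA mulfV// mul1r.
transitivity (\sum_(j < N) \sum_(n < N) \sum_(m < N)
  (a n * z ^+ n) * (a m * z ^+ m)^* * (uroot N ^+ n * (uroot N)^* ^+ m) ^+ j).
  apply: eq_bigr => j _; rewrite cmod2 /psum rmorph_sum mulr_suml.
  apply: eq_bigr => n _; rewrite mulr_sumr; apply: eq_bigr => m _.
  rewrite !rmorphM !rmorphXn !rmorphM !rmorphXn !exprMn -!exprM (mulnC n) (mulnC m).
  by ring.
rewrite exchange_big /= mulr_sumr; apply: eq_bigr => n _.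
rewrite exchange_big /= (bigD1 n)//= [X in _ + X]big1 ?addr0; last first.
  move=> m mn; rewrite -mulr_sumr sum_uroot// (_ : (n == m :> nat) = false) ?muln0 ?mulr0//; apply: negbTE; rewrite eq_sym; exact: mn.
rewrite -mulr_sumr sum_uroot// eqxx muln1 mulrC; congr (_ * _).
rewrite -cmod2; congr (_ %:C).
by rewrite cmodM cmodX exprMn -!exprM mulnC.
Qed.

End RootsOfUnity.

(** * Mean squares on circles and the gradient estimate *)

Section MeanSquare.
Local Open Scope complex_scope.
Context {R : realType}.
Implicit Types (a b : nat -> R[i]) (z w : R[i]) (x q e : R).

Definition sqcoef a n : R[i] := (cmod (a n) ^+ 2)%:C.

(** The mean of the squared modulus of the sum of a over the circle of squared
    radius x. *)
Definition msq a x : R := complex.Re (pval (sqcoef a) x%:C).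

Lemma cmod_sqcoef a n : cmod (sqcoef a n) = cmod (a n) ^+ 2.
Proof. by rewrite cmod_real ger0_norm// sqr_ge0. Qed.

Lemma rad1_sqcoef a : rad1 a -> rad1 (sqcoef a).
Proof.
move=> Ha q q0 q1; pose s := (1 + q) / 2.
have s0 : 0 <= s by rewrite /s; lra.
have s1 : s < 1 by rewrite /s; lra.
have qs : q <= s ^+ 2 by have := sqr_ge0 (1 - q); rewrite /s; lra.
have [M HM] := Ha s s0 s1; exists (M ^+ 2) => n.
have M0 : 0 <= M by rewrite (le_trans _ (HM 0%N))// mulr_ge0 ?cmod_ge0// exprn_ge0.
rewrite cmod_sqcoef; apply: (@le_trans _ _ ((cmod (a n) * s ^+ n) ^+ 2)).
  rewrite exprMn ler_wpM2l ?sqr_ge0// -exprM mulnC exprM lerXn2r// nnegrE sqr_ge0//.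
by rewrite ler_sqr ?nnegrE ?mulr_ge0 ?cmod_ge0 ?exprn_ge0.
Qed.

Lemma psum_sqcoef a N x :
  psum (sqcoef a) N x%:C = (\sum_(n < N) cmod (a n) ^+ 2 * x ^+ n)%:C.
Proof.
by rewrite rmorph_sum; apply: eq_bigr => n _; rewrite rmorphM /= [X in _ = _ * X]rmorphXn.
Qed.

Lemma psum_sqcoef_ge0 a x N : 0 <= x -> 0 <= \sum_(n < N) cmod (a n) ^+ 2 * x ^+ n.
Proof. by move=> x0; apply: sumr_ge0 => n _; rewrite mulr_ge0 ?sqr_ge0 ?exprn_ge0. Qed.

Lemma msq_near a q e : rad1 a -> 0 <= q -> q < 1 -> 0 < e ->
  exists N0, forall N x, (N0 <= N)%N -> 0 <= x -> x <= q ->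
    `|msq a x - \sum_(n < N) cmod (a n) ^+ 2 * x ^+ n| <= e.
Proof.
move=> Ha q0 q1 e0.
have [M [t [M0 t0 t1 H]]] := pvalP (rad1_sqcoef Ha) q0 q1.
have [N0 HN] := geometric_small M t0 t1 e0.
exists N0 => N x NN x0 xq; rewrite (le_trans _ (HN N NN))//.
have := H x%:C N; rewrite cmod_real ger0_norm// => /(_ xq).
by apply: le_trans; rewrite psum_sqcoef (le_trans _ (Re_le_cmod _))// cReD cReN.
Qed.

Lemma msq_le a x B : rad1 a -> 0 <= x -> x < 1 ->
  (forall N, \sum_(n < N) cmod (a n) ^+ 2 * x ^+ n <= B) -> msq a x <= B.
Proof.
move=> Ha x0 x1 H; apply/ler_addgt0Pl => e e0.
have [N0 /(_ N0 x (leqnn _) x0 (lexx x))] := msq_near Ha x0 x1 e0.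
by rewrite ler_norml => /andP[_]; have := H N0; lra.
Qed.

Lemma psum_le_msq a x N : rad1 a -> 0 <= x -> x < 1 ->
  \sum_(n < N) cmod (a n) ^+ 2 * x ^+ n <= msq a x.
Proof.
move=> Ha x0 x1; apply/ler_addgt0Pl => e e0.
have [N0 /(_ (N + N0)%N x (leq_addl _ _) x0 (lexx x))] := msq_near Ha x0 x1 e0.
rewrite big_split_ord /= ler_norml => /andP[+ _].
have := @psum_sqcoef_ge0 (fun i => a (N + i)%N) x N0 x0.
have : 0 <= \sum_(i < N0) cmod (a (N + i)%N) ^+ 2 * x ^+ (N + i).
  by apply: sumr_ge0 => n _; rewrite mulr_ge0 ?sqr_ge0 ?exprn_ge0.
by lra.
Qed.

Lemma msq_ge0 a x : rad1 a -> 0 <= x -> x < 1 -> 0 <= msq a x.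
Proof.
by move=> Ha x0 x1; have := psum_le_msq 0 Ha x0 x1; rewrite big_ord0.
Qed.

Lemma msq0 a : msq a 0 = cmod (a 0%N) ^+ 2.
Proof. by rewrite /msq pval0. Qed.

Lemma msq_mono a x y : rad1 a -> 0 <= x -> x <= y -> y < 1 -> msq a x <= msq a y.
Proof.
move=> Ha x0 xy y1; apply: msq_le => //; first exact: le_lt_trans y1.
move=> N; rewrite (le_trans _ (psum_le_msq N Ha (le_trans x0 xy) y1))//.
apply: ler_sum => n _; rewrite ler_wpM2l ?sqr_ge0// lerXn2r// nnegrE//.
exact: le_trans xy.
Qed.

(** Parseval, uniformly on smaller discs: only the aliasing terms beyond
    degree N are lost. *)
Lemma parseval_near a q e : rad1 a -> 0 <= q -> q < 1 -> 0 < e ->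
  exists N0, forall N z, (N0 <= N)%N -> (0 < N)%N -> cmod z <= q ->
    `|ravg N (fun u => cmod (pval a (z * u)) ^+ 2) - msq a (cmod z ^+ 2)| <= e.
Proof.
move=> Ha q0 q1 e0.
have [M [t [M0 t0 t1 H]]] := pvalP Ha q0 q1.
have [B [B0 HB]] := pval_bounded Ha q0 q1.
pose L := 2 * B + M + 1.
have L0 : 0 < L by rewrite /L; lra.
have e2 : 0 < e / 2 by rewrite divr_gt0.
have [N1 HN1] := geometric_small M t0 t1 (divr_gt0 e2 L0).
have qq1 : q ^+ 2 < 1 by rewrite exprn_ilt1.
have [N2 HN2] := msq_near Ha (sqr_ge0 q) qq1 e2.
exists (maxn N1 N2) => N z; rewrite geq_max => /andP[n1 n2] N0 zq.
have h2 := HN2 N (cmod z ^+ 2) n2 (sqr_ge0 _) _.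
have /h2 {}h2 : cmod z ^+ 2 <= q ^+ 2 by rewrite ler_sqr ?nnegrE ?cmod_ge0.
rewrite -parseval_psum// in h2.
set A := ravg N _; set A' := ravg N _ in h2.
have h1 : `|A - A'| <= e / 2.
  apply: ravg_dist => // u u1.
  have zu : cmod (z * u) <= q by rewrite cmodM u1 mulr1.
  set p := pval a _; set s := psum a _ _.
  have ps : cmod (p - s) <= e / 2 / L by rewrite (le_trans (H _ N zu))// HN1.
  have ps' : cmod (p - s) <= M.
    by rewrite (le_trans (H _ N zu))// ler_piMr// exprn_ile1// ltW.
  have pB : cmod p <= B := HB _ zu.
  have sB : cmod s <= B + M.
    rewrite (_ : s = p - (p - s)); last by ring.
    by rewrite (le_trans (ler_cmodB _ _))// lerD.
  have d : `|cmod p - cmod s| <= cmod (p - s).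
    rewrite ler_norml ler_cmod_sub andbT lerNl opprB.
    by rewrite cmodB ler_cmod_sub.
  rewrite subr_sqr normrM -[leRHS](divfK (lt0r_neq0 L0)).
  rewrite ler_pM// ?(le_trans d)// ger0_norm ?addr_ge0 ?cmod_ge0// /L.
  by lra.
rewrite (le_trans (ler_distD A' _ _))//.
by move: h1 h2; rewrite (distrC A'); lra.
Qed.

Lemma sqrt_lt1 x : 0 <= x -> x < 1 -> Num.sqrt x < 1.
Proof. by move=> x0 x1; rewrite -sqrtr1 ltr_sqrt. Qed.

(** Averages over roots of unity approximate the mean squares and respect
    pointwise domination. *)
Lemma msq_dominated a b x c : rad1 a -> rad1 b -> 0 <= x -> x < 1 -> 0 <= c ->
  (forall w, cmod w = Num.sqrt x -> cmod (pval a w) <= c * cmod (pval b w)) ->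
  msq a x <= c ^+ 2 * msq b x.
Proof.
move=> Ha Hb x0 x1 c0 H; apply/ler_addgt0Pl => e e0.
have sx0 := sqrtr_ge0 x; have sx1 := sqrt_lt1 x0 x1.
pose e' := e / (1 + c ^+ 2).
have k0 : 0 < 1 + c ^+ 2 by rewrite ltr_pwDl// sqr_ge0.
have e'0 : 0 < e' by rewrite divr_gt0.
have ee : e' + c ^+ 2 * e' = e by rewrite -[X in X + _]mul1r -mulrDl mulrC /e' divfK// gt_eqF.
have [N1 H1] := parseval_near Ha sx0 sx1 e'0.
have [N2 H2] := parseval_near Hb sx0 sx1 e'0.
pose N := (maxn N1 N2).+1; pose z := (Num.sqrt x)%:C.
have zx : cmod z = Num.sqrt x by rewrite cmod_real ger0_norm.
have := H1 N z (leqW (leq_maxl _ _)) isT; rewrite zx lexx sqr_sqrtr// => /(_ isT) h1.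
have := H2 N z (leqW (leq_maxr _ _)) isT; rewrite zx lexx sqr_sqrtr// => /(_ isT) h2.
have h3 : ravg N (fun u => cmod (pval a (z * u)) ^+ 2) <=
          c ^+ 2 * ravg N (fun u => cmod (pval b (z * u)) ^+ 2).
  rewrite /ravg mulrCA ler_wpM2l ?invr_ge0// mulr_sumr; apply: ler_sum => j _.
  rewrite -exprMn ler_sqr ?nnegrE ?mulr_ge0 ?cmod_ge0//; apply: H.
  by rewrite cmodM cmod_uroot mulr1.
move: h1 h2; rewrite !ler_norml => /andP[h1 _] /andP[_ h2].
have := ler_wpM2l (sqr_ge0 c) h2; lra.
Qed.

End MeanSquare.

Section GradientEstimate.
Local Open Scope complex_scope.
Context {R : realType}.
Implicit Types (a : nat -> R[i]) (z w u : R[i]).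

Lemma uavg_binomial N n m z (rho : R[i]) : (n < N)%N -> (m < N)%N ->
  uavg N (fun u => (z + rho * u) ^+ n * u^* ^+ m) =
  z ^+ (n - m) * rho ^+ m *+ 'C(n, m).
Proof.
move=> nN mN; have N0 : (N%:R : R[i]) != 0 by rewrite pnatr_eq0 -lt0n (leq_ltn_trans _ nN).
apply: (mulfI N0); rewrite /uavg mulrA mulfV// mul1r.
transitivity (\sum_(j < N) \sum_(k < n.+1) z ^+ (n - k) * rho ^+ k *+ 'C(n, k) *
    (uroot N ^+ k * (uroot N)^* ^+ m) ^+ j).
  apply: eq_bigr => j _; rewrite exprDn mulr_suml; apply: eq_bigr => k _.
  have -> : ((uroot N ^+ j)^*) ^+ m = ((uroot N)^* ^+ m) ^+ j :> R[i].
    by rewrite rmorphXn -!exprM mulnC.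
  have -> : (rho * uroot N ^+ j) ^+ k = rho ^+ k * (uroot N ^+ k) ^+ j.
    by rewrite exprMn -!exprM [(k * j)%N]mulnC.
  by rewrite exprMn !mulrnAl !mulrA.
rewrite exchange_big /=.
rewrite (eq_bigr (fun k : 'I_n.+1 => z ^+ (n - k) * rho ^+ k *+ 'C(n, k) *
    (N * (k == m :> nat))%:R)); last first.
  move=> k _; rewrite -mulr_sumr sum_uroot//.
  exact: leq_trans (ltn_ord k) nN.
have [mn|mn] := ltnP m n.+1.
  rewrite (bigD1 (Ordinal mn))//= eqxx muln1 [X in _ + X]big1 ?addr0; first by rewrite mulrC.
  move=> k km; rewrite (_ : (k == m :> nat) = false) ?muln0 ?mulr0//.
  by apply: contraNF km => /eqP km; apply/eqP/val_inj.
rewrite bin_small// mulr0n mulr0 big1// => k _.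
by rewrite ltn_eqF ?muln0 ?mulr0// (leq_trans _ mn).
Qed.

Lemma uavg_psum N M a m z (rho : R[i]) : (M <= N)%N -> (m < N)%N ->
  uavg N (fun u => psum a M (z + rho * u) * u^* ^+ m) =
  \sum_(n < M) a n * (z ^+ (n - m) * rho ^+ m *+ 'C(n, m)).
Proof.
move=> MN mN; rewrite /uavg.
under eq_bigr => j _ do rewrite /psum mulr_suml.
rewrite exchange_big mulr_sumr /=; apply: eq_bigr => n _.
rewrite -(@uavg_binomial N n m z rho (leq_trans (ltn_ord n) MN) mN) /uavg mulrCA; congr (_ * _).
by rewrite mulr_sumr; apply: eq_bigr => j _; rewrite mulrA.
Qed.

(** Conjugate-analytic terms have no positive frequencies, so the first
    Fourier coefficient on a circle only sees the imaginary part. *)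
Lemma gradient_estimate a z (rho B : R) : rad1 a -> 0 < rho -> cmod z + rho < 1 ->
  (forall w, cmod (w - z) = rho -> `|complex.Im (pval a w)| <= B) ->
  rho * cmod (pval (pder a) z) <= 2 * B.
Proof.
move=> Ha rho0 zr HB.
have z1 : cmod z < 1 by rewrite (lt_trans _ zr)// ltrDl.
have q0 : 0 <= cmod z + rho by rewrite addr_ge0 ?cmod_ge0// ltW.
apply/ler_addgt0Pl => e e0; have e4 : 0 < e / 4 by rewrite divr_gt0.
have [M [t [M0 t0 t1 H]]] := pvalP Ha q0 zr.
have [N1 HN1] := geometric_small M t0 t1 e4.
have [N2 HN2] := geo_lim_near (geo_limZ rho%:C (pval_geo_lim (rad1_pder Ha) z1)) e4.
pose K := maxn N1 N2; pose N := K.+2.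
pose f u := pval a (z + rho%:C * u); pose P u := psum a K.+1 (z + rho%:C * u).
have fP u : cmod u = 1 -> cmod (f u - P u) <= e / 4.
  move=> u1; rewrite (le_trans (H _ _ _)) ?HN1 ?leqW ?leq_maxl//.
  by rewrite (le_trans (ler_cmodD _ _))// cmodM u1 mulr1 cmod_real gtr0_norm.
have uavgB (g h : R[i] -> R[i]) : uavg N (fun u => g u - h u) = uavg N g - uavg N h.
  by rewrite /uavg -mulrBr -sumrB.
have uavgD (g h : R[i] -> R[i]) : uavg N (fun u => g u + h u) = uavg N g + uavg N h.
  by rewrite /uavg -mulrDr -big_split.
have S : uavg N (fun u => P u * u^* ^+ 1) = rho%:C * psum (pder a) K z.
  rewrite uavg_psum// psum_pder mulr_sumr; apply: eq_bigr => n _.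
  by rewrite bin1 subn1 expr1 -mulr_natl; ring.
(* On the N-th roots of unity, N = K + 2, multiplication by u is multiplication
   by the (K+1)-st power of its conjugate: a frequency beyond the degree of P. *)
have T : uavg N (fun u => (P u * u)^*) = 0.
  have -> : uavg N (fun u => (P u * u)^*) = (uavg N (fun u => P u * u))^*.
    by rewrite /uavg rmorphM fmorphV rmorph_nat rmorph_sum.
  suff -> : uavg N (fun u => P u * u) = 0 by rewrite rmorph0.
  transitivity (uavg N (fun u => P u * u^* ^+ K.+1)).
    rewrite /uavg; congr (_ * _); apply: eq_bigr => j _; congr (_ * _).
    have c1 : uroot N ^+ j != 0 :> R[i].
      by apply/eqP => /(congr1 (@cmod R)); rewrite cmod_uroot cmod0 => /eqP; rewrite oner_eq0.
    have ec : uroot N ^+ j * (uroot N ^+ j)^* = 1 :> R[i].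
      by rewrite -sqr_normc normc_cmod cmod_uroot expr1n.
    have eN : (uroot N ^+ j) ^+ N = 1 :> R[i].
      by rewrite -exprM mulnC exprM uroot_exp ?expr1n.
    have eN' : (uroot N ^+ j) ^+ K.+1 * uroot N ^+ j = 1 :> R[i] by rewrite -exprSr.
    set v := uroot N ^+ j in ec eN' *.
    transitivity ((v ^+ K.+1 * v) * v^* ^+ K.+1); last by rewrite eN' mul1r.
    by rewrite mulrAC -exprMn ec expr1n mul1r.
  rewrite uavg_psum// big1// => n _.
  by rewrite bin_small ?mulr0n ?mulr0.
have main : uavg N (fun u => f u * u^* - (f u * u)^*) =
    rho%:C * psum (pder a) K z + (uavg N (fun u => (f u - P u) * u^* - ((f u - P u) * u)^*)).
  rewrite -S -[X in X + _]subr0 -{1}T -uavgB -uavgD; congr (uavg N _); apply/funext => u.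
  by rewrite expr1 !mulrBl !rmorphB /=; ring.
have b1 : cmod (uavg N (fun u => f u * u^* - (f u * u)^*)) <= 2 * B.
  apply: ler_cmod_uavg => // u u1.
  have -> : f u * u^* - (f u * u)^* = (f u - (f u)^*) * u^* by rewrite rmorphM mulrBl.
  rewrite subcJ cmodM cmod_conj u1 mulr1 !cmodM cmod_real.
  have -> : cmod ('i%C : R[i]) = 1 by rewrite /cmod /= expr0n add0r expr1n sqrtr1.
  rewrite mulr1 cmod_nat ler_wpM2l//; apply: HB.
  by rewrite addrC addKr cmodM u1 mulr1 cmod_real gtr0_norm.
have b2 : cmod (uavg N (fun u => (f u - P u) * u^* - ((f u - P u) * u)^*)) <= e / 2.
  apply: ler_cmod_uavg => // u u1.
  rewrite (le_trans (ler_cmodB _ _))// cmod_conj !cmodM cmod_conj u1 !mulr1.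
  by have := fP u u1; lra.
have b3 : cmod (rho%:C * psum (pder a) K z) <= 2 * B + e / 2.
  move: main b2; set D := (X in _ + X) => main b2.
  by rewrite -(addrK D (_ * _)) -main (le_trans (ler_cmodB _ _))// lerD.
have := HN2 K (leq_maxr _ _).
have -> : rho * cmod (pval (pder a) z) = cmod (rho%:C * pval (pder a) z).
  by rewrite cmodM cmod_real gtr0_norm.
set X := rho%:C * pval _ _; set Y := rho%:C * _ in b3 *.
by have := ler_cmodD (X - Y) Y; rewrite subrK; lra.
Qed.

End GradientEstimate.

(** * Logarithmic growth of mean squares *)

Section RealCalculus.
Local Open Scope complex_scope.
Context {R : realType}.
Implicit Types (f g : R -> R) (x a b c : R).

Lemma rderiveM f g x a b : is_derive x 1 f a -> is_derive x 1 g b ->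
  is_derive x 1 (fun t => f t * g t) (a * g x + f x * b).
Proof.
move=> Hf Hg; apply: is_derive_eq (is_deriveM Hf Hg) _.
by rewrite /GRing.scale /= addrC (mulrC a).
Qed.

Lemma rderiveD f g x a b : is_derive x 1 f a -> is_derive x 1 g b ->
  is_derive x 1 (fun t => f t + g t) (a + b).
Proof. by move=> Hf Hg; exact: (is_deriveD Hf Hg). Qed.

Lemma rderiveB f g x a b : is_derive x 1 f a -> is_derive x 1 g b ->
  is_derive x 1 (fun t => f t - g t) (a - b).
Proof. by move=> Hf Hg; exact: (is_deriveB Hf Hg). Qed.

Lemma rderiveN f x a : is_derive x 1 f a -> is_derive x 1 (fun t => - f t) (- a).
Proof. by move=> Hf; exact: (is_deriveN Hf). Qed.

Lemma rderive_cst x c : is_derive x 1 (fun=> c) (0 : R).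
Proof. exact: is_derive_cst. Qed.

Lemma rderive_id x : is_derive x 1 (fun t : R => t) (1 : R).
Proof. exact: is_derive_id. Qed.

Lemma rderiveZ f x a c : is_derive x 1 f a -> is_derive x 1 (fun t => c * f t) (c * a).
Proof.
move=> Hf; apply: is_derive_eq (rderiveM (rderive_cst x c) Hf) _.
by rewrite mul0r add0r.
Qed.

Lemma rderive_ln f x a : 0 < f x -> is_derive x 1 f a ->
  is_derive x 1 (fun t => ln (f t)) (a / f x).
Proof.
move=> fx Hf; apply: is_derive_eq (is_derive1_comp (is_derive1_ln fx) Hf) _.
exact: mulrC.
Qed.

Lemma rderive_expR f x a : is_derive x 1 f a ->
  is_derive x 1 (fun t => expR (f t)) (a * expR (f x)).
Proof.
move=> Hf; apply: is_derive_eq (is_derive1_comp (is_derive_expR (f x)) Hf) _.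
exact: mulrC.
Qed.

Lemma rderiveV f x a : f x != 0 -> is_derive x 1 f a ->
  is_derive x 1 (fun t => (f t)^-1) (- a / f x ^+ 2).
Proof.
move=> fx Hf; apply: is_derive_eq (is_deriveV fx Hf) _.
by rewrite /GRing.scale /= mulNr mulrC mulNr.
Qed.

Lemma ge0_rderive_le f (df : R -> R) b : 0 <= b ->
  (forall x, 0 <= x -> x <= b -> is_derive x 1 f (df x)) ->
  (forall x, 0 < x -> x < b -> 0 <= df x) -> f 0 <= f b.
Proof.
rewrite le_eqVlt => /predU1P[<-//|b0] H df0.
have [| |c] := @MVT R f df 0 b b0.
- by move=> x; rewrite in_itv/= => /andP[x0 xb]; apply: H; exact: ltW.
- apply: derivable_within_continuous => x; rewrite in_itv/= => /andP[x0 xb].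
  by have [] := H x x0 xb.
rewrite in_itv/= subr0 => /andP[c0 cb] e.
by rewrite -subr_ge0 e mulr_ge0 ?df0 ?ltW.
Qed.

End RealCalculus.

Section LogarithmicWeight.
Local Open Scope complex_scope.
Context {R : realType}.
Implicit Types (x t : R).

(** The logarithm log(e^2 / (1 - x)); the constant keeps it above 2 on [0, 1[. *)
Definition Lam x : R := 2 - ln (1 - x).

(** The rate of growth that a modulus of smoothness t / sqrt(log(e / t)) allows: a
    Bloch growth 1 / (1 - x) improved by half a power of the logarithm. *)
Definition beta x : R := ((1 - x) * Num.sqrt (Lam x))^-1.

Lemma Lam_ge2 x : 0 <= x -> 2 <= Lam x.
Proof. by move=> x0; rewrite /Lam lerDl oppr_ge0 ln_le0// gerBl. Qed.

Lemma Lam_gt0 x : 0 <= x -> 0 < Lam x.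
Proof. by move=> x0; rewrite (lt_le_trans _ (Lam_ge2 x0)). Qed.

Lemma half_le_Lam x : 0 <= x -> 2^-1 <= 1 - (2 * Lam x)^-1.
Proof.
move=> /Lam_ge2 x2; have : (2 * Lam x)^-1 <= 4^-1.
  by rewrite lef_pV2 ?posrE//; lra.
by lra.
Qed.

Lemma Lam0 : Lam 0 = 2.
Proof. by rewrite /Lam subr0 ln1 subr0. Qed.

Lemma Lam_mono x t : x <= t -> t < 1 -> Lam x <= Lam t.
Proof.
move=> xt t1; rewrite /Lam lerD2l lerN2 ler_ln ?posrE ?subr_gt0//.
  by rewrite lerD2l lerN2.
exact: le_lt_trans t1.
Qed.

Lemma is_derive_Lam x : x < 1 -> is_derive x 1 Lam (1 - x)^-1.
Proof.
move=> x1; have h : 0 < 1 - x by rewrite subr_gt0.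
have d := (rderiveB (rderive_cst x 2)
  (rderive_ln (f := fun t : R => 1 - t) h (rderiveB (rderive_cst x 1) (rderive_id x)))).
by apply: (is_derive_eq d); rewrite !sub0r mulN1r opprK.
Qed.

Lemma beta_gt0 x : 0 <= x -> x < 1 -> 0 < beta x.
Proof.
move=> x0 x1; rewrite /beta invr_gt0 mulr_gt0 ?subr_gt0// sqrtr_gt0.
exact: Lam_gt0.
Qed.

Lemma beta_expR x : 0 <= x -> x < 1 ->
  beta x = expR (- ln (1 - x) - 2^-1 * ln (Lam x)).
Proof.
move=> x0 x1; have l0 := Lam_gt0 x0; have h : 0 < 1 - x by rewrite subr_gt0.
rewrite -opprD expRN expRD lnK ?posrE// /beta.
congr (_ * _)^-1; rewrite -(powR12_sqrt (ltW l0)) /powR gt_eqF//.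
Qed.

Lemma beta_sqr x : 0 <= x -> x < 1 -> beta x ^+ 2 = ((1 - x) ^+ 2 * Lam x)^-1.
Proof.
by move=> x0 x1; rewrite /beta exprVn exprMn sqr_sqrtr// ltW// Lam_gt0.
Qed.

(** The exponential form of beta is the convenient one to differentiate. *)
Definition expbeta x := expR (- ln (1 - x) - 2^-1 * ln (Lam x)).

Lemma is_derive_expbeta x : 0 <= x -> x < 1 ->
  is_derive x 1 expbeta (expbeta x / (1 - x) * (1 - (2 * Lam x)^-1)).
Proof.
move=> x0 x1; have h : 0 < 1 - x by rewrite subr_gt0.
have l0 := Lam_gt0 x0.
have d1 := rderive_ln (f := fun t : R => 1 - t) h (rderiveB (rderive_cst x 1) (rderive_id x)).
have d2 := rderiveZ 2^-1 (rderive_ln l0 (is_derive_Lam x1)).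
apply: (is_derive_eq (rderive_expR (rderiveB (rderiveN d1) d2))).
by rewrite /expbeta sub0r; field; rewrite !gt_eqF.
Qed.

Lemma one_sub_sqrt x : 0 <= x -> x < 1 -> 1 - x <= 2 * (1 - Num.sqrt x).
Proof.
move=> x0 x1; have s0 := sqrtr_ge0 x; have s1 := sqrt_lt1 x0 x1.
rewrite -{1}(sqr_sqrtr x0).
have : 0 <= (1 - Num.sqrt x) * (1 - Num.sqrt x) by rewrite -expr2 sqr_ge0.
by rewrite expr2; lra.
Qed.

(** Mean squares are indexed by squared radii, hence beta at a square root. *)
Lemma beta_sqrt_sqr x : 0 <= x -> x < 1 ->
  beta (Num.sqrt x) ^+ 2 <= 4 / ((1 - x) ^+ 2 * Lam x).
Proof.
move=> x0 x1; have s0 := sqrtr_ge0 x; have s1 := sqrt_lt1 x0 x1.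
have h : 0 < 1 - x by rewrite subr_gt0.
have h' : 0 < 1 - Num.sqrt x by rewrite subr_gt0.
have l0 := Lam_gt0 x0; have l0' := Lam_gt0 s0.
rewrite beta_sqr// ler_pdivlMr ?mulr_gt0 ?exprn_gt0// mulrC.
rewrite ler_pdivrMr ?mulr_gt0 ?exprn_gt0// mulrA ler_pM ?sqr_ge0//.
- exact: ltW.
- have := one_sub_sqrt x0 x1 => k.
  rewrite (_ : 4 * _ = (2 * (1 - Num.sqrt x)) ^+ 2); last by rewrite exprMn; ring.
  by rewrite ler_sqr ?nnegrE ?mulr_ge0// ltW.
- apply: Lam_mono => //.
  rewrite -{1}(sqr_sqrtr x0) expr2 ler_piMr// ltW//.
Qed.

End LogarithmicWeight.

Section GrowthOfMeanSquares.
Local Open Scope complex_scope.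
Context {R : realType}.
Implicit Types (a : nat -> R[i]) (x c : R) (z w : R[i]).

Lemma is_derive_Re_pval a x : rad1 a -> `|x| < 1 ->
  is_derive x 1 (fun t => complex.Re (pval a t%:C)) (complex.Re (pval (pder a) x%:C)).
Proof.
move=> Ha x1; have z1 : cmod (0 + x%:C * 1) < 1 by rewrite add0r mulr1 cmod_real.
have E (t : R) : 0 + t%:C * 1 = t%:C :> R[i] by rewrite add0r mulr1.
have <- : (fun t : R => complex.Re (pval a (0 + t%:C * 1))) =
    (fun t => complex.Re (pval a t%:C)) by apply/funext => t; rewrite E.
by apply: (is_derive_eq (cdiff_ray (cdiff_pval Ha z1))); rewrite mul1r E.
Qed.

Lemma pval_nat a z : rad1 a -> cmod z < 1 ->
  pval (fun n => n%:R * a n) z = z * pval (pder a) z.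
Proof.
move=> Ha z1; apply: (geo_lim_unique (geo_limS (pval_geo_lim (rad1_nat Ha) z1))).
apply: geo_lim_ext (geo_limZ z (pval_geo_lim (rad1_pder Ha) z1)) => n.
rewrite psum_pder /psum mulr_sumr; apply: eq_bigr => -[[|i] hi] _ /=.
  by rewrite !mul0r !mulr0.
by rewrite exprS; ring.
Qed.

(** With j the mean square and Y = x j', Parseval gives Y' as the mean square of
    the derivative, hence Y' <= 4 c^2 j / ((1-x)^2 Lam). A first integration
    bounds the logarithmic derivative of j by that of Lam^(8 c^2), a second one
    concludes. *)
Lemma msq_growth a c : rad1 a -> 0 <= c ->
  (forall w, cmod w < 1 ->
     cmod (pval (pder a) w) <= c * beta (cmod w) * cmod (pval a w)) ->
  forall x, 0 <= x -> x < 1 ->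
    msq a x <= msq a 0 * expR (8 * c ^+ 2 * ln (Lam x)).
Proof.
move=> Ha c0 H.
have Hs := rad1_sqcoef Ha.
pose j := msq a; pose j1 x := complex.Re (pval (pder (sqcoef a)) x%:C).
pose Y x := complex.Re (pval (fun n => n%:R * sqcoef a n) x%:C).
have dj x : `|x| < 1 -> is_derive x 1 j (j1 x) by move=> x1; exact: is_derive_Re_pval.
have YE x : `|x| < 1 -> Y x = x * j1 x.
  by move=> x1; rewrite /Y pval_nat ?cmod_real// cReZ.
have dY x : `|x| < 1 -> is_derive x 1 Y (msq (pder a) x).
  move=> x1; have := is_derive_Re_pval (rad1_nat Hs) x1.
  rewrite /msq (_ : sqcoef (pder a) = pder (fun n => n%:R * sqcoef a n))//.
  apply/funext => n; rewrite /sqcoef /pder cmodM cmod_nat exprMn rmorphM /=.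
  by rewrite rmorphXn rmorph_nat expr2 mulrA.
have j0 x : 0 <= x -> x < 1 -> 0 <= j x by move=> *; exact: msq_ge0.
have nrm x b : 0 <= x -> x <= b -> b < 1 -> `|x| < 1.
  by move=> x0 xb b1; rewrite ger0_norm// (le_lt_trans xb).
have bd x : 0 <= x -> x < 1 -> msq (pder a) x <= 4 * c ^+ 2 * j x / ((1 - x) ^+ 2 * Lam x).
  move=> x0 x1; have sx0 := sqrtr_ge0 x; have sx1 := sqrt_lt1 x0 x1.
  have b0 := beta_gt0 sx0 sx1.
  have := @msq_dominated _ (pder a) a x (c * beta (Num.sqrt x)) (rad1_pder Ha) Ha x0 x1.
  move=> /(_ (mulr_ge0 c0 (ltW b0))) h; apply: (le_trans (h _)).
    by move=> w we; rewrite -we; apply: H; rewrite we.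
  rewrite exprMn; have := beta_sqrt_sqr x0 x1 => k.
  have := ler_wpM2l (sqr_ge0 c) k => /(ler_wpM2r (j0 x x0 x1)) /le_trans; apply.
  by rewrite le_eqVlt; apply/orP; left; apply/eqP; rewrite /j; ring.
have Y0 : Y 0 = 0 by rewrite /Y pval0 mul0r.
have j1_ge0 x : 0 < x -> x < 1 -> 0 <= j1 x.
  move=> x0 x1; have := @ge0_rderive_le _ Y (msq (pder a)) x (ltW x0).
  rewrite Y0 YE ?(nrm x x) ?(ltW x0)// pmulr_rge0//; apply.
    by move=> y y0 yx; apply: dY; exact: nrm x1.
  by move=> y y0 yx; apply: msq_ge0; rewrite ?(ltW y0) ?(lt_trans yx)//; exact: rad1_pder.
(* The derivative of W is at least half of 1 / ((1 - x)^2 Lam x). *)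
pose W x : R := x * ((1 - x) * Lam x)^-1.
pose dW x : R := (Lam x - x) / ((1 - x) * Lam x) ^+ 2.
have dWE x : 0 <= x -> x < 1 -> is_derive x 1 W (dW x).
  move=> x0 x1; have h : 0 < 1 - x by rewrite subr_gt0.
  have l0 := Lam_gt0 x0.
  have n0 : (1 - x) * Lam x != 0 by rewrite gt_eqF// mulr_gt0.
  have d1 := rderiveM (rderiveB (rderive_cst x 1) (rderive_id x)) (is_derive_Lam x1).
  apply: (is_derive_eq (rderiveM (rderive_id x)
    (rderiveV (f := fun t => (1 - t) * Lam t) n0 d1))).
  by rewrite /dW /=; field; rewrite !gt_eqF.
have j1W x : 0 < x -> x < 1 -> j1 x <= 8 * c ^+ 2 * j x / ((1 - x) * Lam x).
  move=> x0 x1.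
  pose phi x := 8 * c ^+ 2 * (j x * W x) - Y x.
  have := @ge0_rderive_le _ phi (fun x => 8 * c ^+ 2 * (j1 x * W x + j x * dW x) - msq (pder a) x) x (ltW x0).
  have -> : phi 0 = 0 by rewrite /phi Y0 /W mul0r !mulr0 subr0.
  rewrite /phi YE ?(nrm x x) ?(ltW x0)// /W => h.
  suff h0 : 0 <= 8 * c ^+ 2 * (j x * (x * ((1 - x) * Lam x)^-1)) - x * j1 x.
    rewrite -(ler_pM2l x0) -subr_ge0.
    by rewrite (_ : x * (8 * c ^+ 2 * j x / ((1 - x) * Lam x)) =
      8 * c ^+ 2 * (j x * (x * ((1 - x) * Lam x)^-1)))//; ring.
  apply: h.
  - move=> y y0 yx; have y1 : y < 1 := le_lt_trans yx x1.
    have yn : `|y| < 1 := nrm _ _ y0 yx x1.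
    exact: rderiveB (rderiveZ _ (rderiveM (dj y yn) (dWE y y0 y1))) (dY y yn).
  - move=> y y0 yx; have y1 : y < 1 := lt_trans yx x1.
    have l0 := Lam_gt0 (ltW y0); have l2 := Lam_ge2 (ltW y0).
    have hy : 0 < 1 - y by rewrite subr_gt0.
    rewrite subr_ge0 (le_trans (bd y (ltW y0) y1))//.
    apply: (@le_trans _ _ (8 * c ^+ 2 * (j y * dW y))); last first.
      rewrite ler_wpM2l ?mulr_ge0 ?sqr_ge0// lerDr mulr_ge0 ?j1_ge0//.
      by rewrite mulr_ge0 ?invr_ge0 ?mulr_ge0// ltW.
    rewrite /dW ler_pdivrMr ?mulr_gt0 ?exprn_gt0//.
    rewrite (_ : 8 * c ^+ 2 * _ * _ = 8 * c ^+ 2 * j y * ((Lam y - y) / Lam y)); last first.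
      by field; rewrite !gt_eqF.
    rewrite (_ : 4 * _ * _ = 8 * c ^+ 2 * j y * 2^-1); last by field.
    rewrite ler_wpM2l ?mulr_ge0 ?sqr_ge0 ?j0 ?(ltW y0)//.
    by rewrite ler_pdivlMr//; lra.
move=> x x0 x1.
pose g := 8 * c ^+ 2.
pose psi y := 0 - j y * expR (0 - g * ln (Lam y)).
have := @ge0_rderive_le _ psi (fun y => 0 - (j1 y * expR (0 - g * ln (Lam y)) +
   j y * ((0 - g * ((1 - y)^-1 / Lam y)) * expR (0 - g * ln (Lam y))))) x x0.
have h0 : psi 0 <= psi x -> msq a x <= msq a 0 * expR (8 * c ^+ 2 * ln (Lam x)).
  rewrite /psi Lam0 !sub0r lerN2 expRN ler_pdivrMr ?expR_gt0// => /le_trans; apply.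
  rewrite -/j -/g ler_wpM2r ?expR_ge0// ler_piMr// ?j0// expR_le1 oppr_le0.
  by rewrite mulr_ge0 ?mulr_ge0 ?sqr_ge0// ln_ge0// ler1n.
move=> h; apply: h0; apply: h.
  move=> y y0 yx; have y1 : y < 1 := le_lt_trans yx x1.
  have yn : `|y| < 1 := nrm _ _ y0 yx x1.
  have d := rderive_ln (Lam_gt0 y0) (is_derive_Lam y1).
  exact: rderiveB (rderive_cst y 0) (rderiveM (dj y yn)
    (rderive_expR (rderiveB (rderive_cst y 0) (rderiveZ g d)))).
move=> y y0 yx; have y1 : y < 1 := lt_trans yx x1.
rewrite sub0r oppr_ge0 mulrA -mulrDl pmulr_lle0 ?expR_gt0// sub0r mulrN subr_le0.
rewrite (le_trans (j1W y y0 y1))// /g le_eqVlt; apply/orP; left; apply/eqP.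
have l0 := Lam_gt0 (ltW y0); have hy : 0 < 1 - y by rewrite subr_gt0.
by field; rewrite !gt_eqF.
Qed.

(** Since beta' = beta / (1 - x) * (1 - 1 / (2 Lam)) >= beta / (2 (1 - x)), the
    function 2 C beta dominates along rays. Testing the ray against the
    conjugate of the value at its end turns the modulus into a real part. *)
Lemma integrate_beta a C : rad1 a -> 0 <= C -> a 0%N = 0 ->
  (forall w, cmod w < 1 -> cmod (pval (pder a) w) <= C * beta (cmod w) / (1 - cmod w)) ->
  forall z, cmod z < 1 -> cmod (pval a z) <= 2 * C * beta (cmod z).
Proof.
move=> Ha C0 a0 H z z1; have [->|z0] := eqVneq z 0.
  by rewrite pval0 a0 cmod0 mulr_ge0 ?mulr_ge0// ltW// beta_gt0.
set F := pval a z; have [->|F0] := eqVneq F 0.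
  by rewrite cmod0 mulr_ge0 ?mulr_ge0// ltW// beta_gt0 ?cmod_ge0.
have mz := cmod_gt0 z0; have mF := cmod_gt0 F0.
have [v mv zv] : exists2 v, cmod v = 1 & (cmod z)%:C * v = z.
  exists (z / (cmod z)%:C); first by rewrite cmodM cmodV cmod_real gtr0_norm// mulfV// gt_eqF.
  by rewrite mulrCA mulfV ?mulr1//; apply/eqP => -[/eqP]; rewrite gt_eqF.
pose g t := 2 * C * cmod F * expbeta t - complex.Re (F^* * pval a (0 + t%:C * v)).
have := @ge0_rderive_le _ g (fun t => 2 * C * cmod F * (expbeta t / (1 - t) * (1 - (2 * Lam t)^-1)) -
  complex.Re (v * (F^* * pval (pder a) (0 + t%:C * v)))) (cmod z) (ltW mz).
have h0 : g 0 <= g (cmod z) -> cmod F <= 2 * C * beta (cmod z).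
  rewrite /g mul0r !add0r zv pval0 a0 mulr0 subr0.
  have -> : complex.Re (F^* * pval a z) = cmod F * cmod F.
    by rewrite mulrC -/F -sqr_normc normc_cmod -rmorphXn /= expr2.
  rewrite /expbeta -!beta_expR ?cmod_ge0// => h.
  have : 0 <= 2 * C * cmod F * beta 0.
    by rewrite !mulr_ge0// ?cmod_ge0// ltW// beta_gt0.
  move=> /le_trans/(_ h); rewrite subr_ge0 mulrAC ler_pM2r//.
move=> h; apply: h0; apply: h => t t0 tz.
  have t1 : t < 1 := le_lt_trans tz z1.
  have w1 : cmod (0 + t%:C * v) < 1 by rewrite add0r cmodM mv mulr1 cmod_real ger0_norm.
  exact: rderiveB (rderiveZ _ (is_derive_expbeta t0 t1)) (cdiff_ray (cdiffZ _ (cdiff_pval Ha w1))).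
have t1 : t < 1 := lt_trans tz z1.
have wt : cmod (0 + t%:C * v) = t by rewrite add0r cmodM mv mulr1 cmod_real gtr0_norm.
have hb := beta_gt0 (ltW t0) t1.
rewrite subr_ge0 (le_trans (ler_norm _))// (le_trans (Re_le_cmod _))//.
rewrite !cmodM mv mul1r cmod_conj.
have := H (0 + t%:C * v); rewrite wt => /(_ t1) h.
rewrite (le_trans (ler_wpM2l (cmod_ge0 _) h))// /expbeta -beta_expR ?(ltW t0)//.
have k := half_le_Lam (ltW t0).
have p0 : 0 <= 2 * C * cmod F * (beta t / (1 - t)).
  apply: mulr_ge0; first by apply: mulr_ge0; rewrite ?mulr_ge0 ?cmod_ge0.
  by apply: divr_ge0; [exact: ltW | rewrite subr_ge0 ltW].
rewrite [leRHS]mulrA (_ : _ * (_ / _) = 2 * C * cmod F * (beta t / (1 - t)) * 2^-1); last first.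
  by field; rewrite gt_eqF ?subr_gt0.
exact: ler_wpM2l p0 _ _ k.
Qed.

End GrowthOfMeanSquares.

(** * Rotation invariance of planar Lebesgue measure *)

Notation leb2 := (lebesgue_measure \x lebesgue_measure)%E.

Section PlanarLebesgueMeasure.
Local Open Scope complex_scope.
Context {R : realType}.
Local Notation T := (measurableTypeR R).
Local Notation leb := (@lebesgue_measure R).

Lemma itv_shift (a b c : R) :
  (fun y : R => y + c) @^-1` `]a, b]%classic = `]a - c, b - c]%classic.
Proof. by apply/seteqP; split=> y /=; rewrite !in_itv /= ltrBlDr lerBrDr. Qed.

Lemma itv_scale (a b r : R) : 0 < r ->
  (fun y : R => r * y) @^-1` `]a, b]%classic = `]a / r, b / r]%classic.
Proof.
move=> r0; apply/seteqP; split=> y /=; rewrite !in_itv /=.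
  by rewrite ltr_pdivrMr// ler_pdivlMr// mulrC.
by rewrite ltr_pdivrMr// ler_pdivlMr// mulrC.
Qed.

Lemma measurable_shift (c : R) : measurable_fun [set: T] (fun y : T => y + c : T).
Proof. exact: measurable_funD. Qed.

Lemma measurable_scale (r : R) : measurable_fun [set: T] (fun y : T => r * y : T).
Proof. exact: measurable_funM. Qed.

Lemma lebesgue_measure_shift (c : R) (A : set T) : measurable A ->
  leb ((fun y : T => y + c : T) @^-1` A) = leb A.
Proof.
move=> mA; pose m' := pushforward leb (fun y : T => y + c : T).
have := @lebesgue_measure_unique R m'.
move=> /(_ (measurable_shift c)) H; apply/esym; apply: H => //.
move=> _ [[a b] _ <-]; transitivity (leb `]a - c, b - c]%classic); last first.
  by rewrite /pushforward; congr (leb _); exact/esym/itv_shift.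
rewrite !lebesgue_measure_itv /= !lte_fin ltrD2r.
by case: ifPn => // _; congr EFin; ring.
Qed.

Lemma lebesgue_measure_scale (r : R) (A : set T) : 0 < r -> measurable A ->
  leb A = (r%:E * leb ((fun y : T => (r * y)%R : T) @^-1` A))%E.
Proof.
move=> r0 mA; have r0' : 0 <= r := ltW r0.
pose m' := mscale (NngNum r0') (pushforward leb (fun y : T => r * y : T)).
apply: (@lebesgue_measure_unique R (m' (measurable_scale r))) => //.
move=> _ [[a b] _ <-]; pose I : set T := `](a / r), (b / r)]%classic.
transitivity (r%:E * leb I)%E; last first.
  by rewrite /mscale /pushforward; congr (_ * leb _)%E; exact/esym/itv_scale.
rewrite /I !lebesgue_measure_itv /= !lte_fin ltr_pM2r ?invr_gt0//.
case: ifPn => _; last by rewrite mule0.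
by rewrite -!EFinD -EFinM; congr EFin; field; rewrite gt_eqF.
Qed.

Definition mpreserving (f : T * T -> T * T) :=
  measurable_fun setT f /\ forall A, measurable A -> leb2 (f @^-1` A) = leb2 A.

Lemma mpreserving_comp f g : mpreserving f -> mpreserving g -> mpreserving (f \o g).
Proof.
move=> [mf Hf] [mg Hg]; split; first exact: measurableT_comp.
move=> A mA; rewrite comp_preimage Hg ?Hf//.
by rewrite -[X in measurable X]setTI; exact: mf.
Qed.

Definition vshear (t : R) (w : T * T) : T * T := (w.1, w.2 + t * w.1).

(** By Fubini: a shear translates each vertical section. *)
Lemma mpreserving_vshear t : mpreserving (vshear t).
Proof.
split.
  apply: measurable_fun_pair => //; apply: measurable_funD => //.
  exact: measurable_funM.
move=> A mA; rewrite /product_measure1; apply: eq_integral => x _ /=.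
rewrite -(lebesgue_measure_shift (t * x) (measurable_xsection x mA)).
by congr (leb _); apply/seteqP; split=> y; rewrite /xsection /= !inE.
Qed.

Definition vswap (w : T * T) : T * T := (w.2, w.1).

Lemma mpreserving_vswap : mpreserving vswap.
Proof.
have ms : measurable_fun setT vswap by exact: measurable_fun_pair.
split => // A mA; pose m' := pushforward leb2 vswap.
have := @product_measure_unique _ _ T T R leb leb m'.
move=> /(_ ms) H; apply/esym; apply: H => // B C mB mC.
transitivity (leb2 (C `*` B)).
  by congr (leb2 _); apply/seteqP; split=> [[x y] [? ?]|[x y] [? ?]]; split.
by rewrite product_measure1E// muleC.
Qed.

Lemma leb2_scale (r : R) (A : set (T * T)) : 0 < r -> measurable A ->
  leb2 A = ((r ^+ 2)%:E * leb2 ((fun w : T * T => ((r * w.1)%R : T, (r * w.2)%R : T)) @^-1` A))%E.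
Proof.
move=> r0 mA; pose f (w : T * T) : T * T := (r * w.1, r * w.2).
have mf : measurable_fun setT f.
  by apply: measurable_fun_pair; exact: measurable_funM.
have r20 : 0 <= r ^+ 2 by exact: sqr_ge0.
pose m' := mscale (NngNum r20) (pushforward leb2 f).
apply: (@product_measure_unique _ _ T T R leb leb (m' mf)) => // B C mB mC.
have mB' : measurable ((fun y : T => r * y : T) @^-1` B).
  by rewrite -[X in measurable X]setTI; exact: measurable_scale.
have mC' : measurable ((fun y : T => r * y : T) @^-1` C).
  by rewrite -[X in measurable X]setTI; exact: measurable_scale.
transitivity ((r ^+ 2)%:E * leb2 (((fun y : T => (r * y)%R : T) @^-1` B) `*`
   ((fun y : T => (r * y)%R : T) @^-1` C)))%E.
  by rewrite /mscale /pushforward; congr (_ * leb2 _)%E.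
rewrite -[RHS]/(leb B * leb C)%E (lebesgue_measure_scale r0 mB) (lebesgue_measure_scale r0 mC).
by rewrite expr2 EFinM [RHS]muleACA; congr (_ * _)%E; exact: product_measure1E.
Qed.

Definition vrot (c : R[i]) (w : T * T) : T * T :=
  (complex.Re c * w.1 - complex.Im c * w.2, complex.Im c * w.1 + complex.Re c * w.2).

(** A rotation with nonzero sine is a product of three shears. *)
Lemma mpreserving_vrot_shear c : cmod c = 1 -> complex.Im c != 0 -> mpreserving (vrot c).
Proof.
case: c => a b c1 /= b0.
have ab : a ^+ 2 + b ^+ 2 = 1.
  by rewrite -[RHS](expr1n _ 2) -c1 (cmod_sqr (a +i* b)).
pose t := (a - 1) / b; have tb : t * b = a - 1 by rewrite /t divfK.
have ta : t * (1 + a) = - b.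
  apply: (mulIf b0); rewrite mulrAC tb (_ : (a - 1) * (1 + a) = a ^+ 2 - 1); last by ring.
  by rewrite -ab; ring.
have -> : vrot (a +i* b) = (vswap \o vshear t \o vswap) \o vshear b \o
    (vswap \o vshear t \o vswap).
  apply/funext => -[x y]; rewrite /vrot /vshear /vswap /=; congr pair.
    transitivity (x + t * y + t * y + t * b * x + t * b * (t * y)); last by ring.
    rewrite tb (_ : x + _ + _ + _ + _ = a * x + (t * (1 + a)) * y); last by ring.
    by rewrite ta; ring.
  rewrite (_ : y + _ = b * x + (t * b + 1) * y); last by ring.
  by rewrite tb; ring.
have H : mpreserving (vswap \o vshear t \o vswap).
  exact: mpreserving_comp (mpreserving_comp mpreserving_vswap (mpreserving_vshear t)) mpreserving_vswap.
exact: mpreserving_comp (mpreserving_comp H (mpreserving_vshear b)) H.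
Qed.

(** A real c of modulus 1 is the product of two numbers of modulus 1 with nonzero
    imaginary part. *)
Lemma mpreserving_vrot c : cmod c = 1 -> mpreserving (vrot c).
Proof.
move=> c1; have [b0|] := eqVneq (complex.Im c) 0; last exact: mpreserving_vrot_shear.
case: c c1 b0 => a b c1 /= b0; subst b.
have i1 : cmod ('i : R[i]) = 1 by rewrite /cmod /= expr0n add0r expr1n sqrtr1.
have -> : vrot (a +i* 0) = vrot (0 +i* (- a)) \o vrot 'i.
  by apply/funext => -[x y]; rewrite /vrot /=; congr pair; ring.
have a1 : cmod (0 +i* (- a)) = 1.
  by rewrite -c1 /cmod /= expr0n sqrrN add0r addr0.
apply: mpreserving_comp; apply: mpreserving_vrot_shear => //=.
  rewrite oppr_eq0; apply/eqP => a0; move: c1.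
  by rewrite a0 /cmod /= expr0n addr0 sqrtr0 => /eqP; rewrite eq_sym oner_eq0.
Qed.

Lemma vrotE c w : xy_complex (vrot c w) = c * xy_complex w.
Proof.
case: c w => a b [x y]; rewrite /vrot /xy_complex /=.
by apply/eqP; rewrite eq_complex /= eqxx /= addrC.
Qed.

Lemma ge0_integral_vrot c (D : set (T * T)) (f : T * T -> \bar R) : cmod c = 1 ->
  measurable D -> vrot c @^-1` D = D -> measurable_fun D f ->
  (forall w, D w -> (0 <= f w)%E) ->
  (\int[leb2]_(w in D) f (vrot c w) = \int[leb2]_(w in D) f w)%E.
Proof.
move=> /mpreserving_vrot [mc Hc] mD cD mf f0.
have H := @ge0_integral_pushforward _ _ _ _ R (vrot c) mc leb2 D f mD mf.
rewrite cD in H; rewrite -H; last by move=> w /[!inE]; exact: f0.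
by apply: eq_measure_integral => A mA _; exact: Hc.
Qed.

End PlanarLebesgueMeasure.

(** * Integration over annuli *)

Section Annuli.
Local Open Scope complex_scope.
Context {R : realType}.
Local Notation T := (measurableTypeR R).
Local Notation xy := (@xy_complex R).
Implicit Types (a : nat -> R[i]) (r b c : R) (D : set (T * T)).

Definition cmeas D (f : T * T -> R[i]) :=
  measurable_fun D (fun w => complex.Re (f w) : T) /\
  measurable_fun D (fun w => complex.Im (f w) : T).

Lemma cmeas_cst D (z : R[i]) : cmeas D (fun=> z).
Proof. by split; exact: measurable_cst. Qed.

Lemma cmeas_xy D : cmeas D xy.
Proof. by split; apply: measurable_funTS; [exact: measurable_fst|exact: measurable_snd]. Qed.

Lemma cmeasD D f g : cmeas D f -> cmeas D g -> cmeas D (fun w => f w + g w).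
Proof.
move=> [f1 f2] [g1 g2]; split.
  under eq_fun do rewrite cReD; exact: measurable_funD.
under eq_fun do rewrite cImD; exact: measurable_funD.
Qed.

Lemma cmeasM D f g : cmeas D f -> cmeas D g -> cmeas D (fun w => f w * g w).
Proof.
move=> [f1 f2] [g1 g2]; split.
  under eq_fun do rewrite cReM.
  by apply: measurable_funB; exact: measurable_funM.
under eq_fun do rewrite cImM.
by apply: measurable_funD; exact: measurable_funM.
Qed.

Lemma cmeas_psum D a n : cmeas D (fun w => psum a n (xy w)).
Proof.
elim: n => [|n IH].
  by rewrite /psum; under eq_fun do rewrite big_ord0; exact: cmeas_cst.
under eq_fun do rewrite psumS.
apply: cmeasD => //; apply: cmeasM; first exact: cmeas_cst.
elim: n {IH} => [|n IH]; first by under eq_fun do rewrite expr0; exact: cmeas_cst.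
by under eq_fun do rewrite exprS; apply: cmeasM => //; exact: cmeas_xy.
Qed.

Lemma cmeas_cmod D f : cmeas D f -> measurable_fun D (fun w => cmod (f w) : T).
Proof.
move=> [f1 f2].
have -> : (fun w => cmod (f w) : T) =
    (fun x => x `^ 2^-1) \o (fun w => complex.Re (f w) ^+ 2 + complex.Im (f w) ^+ 2).
  apply/funext => w /=; rewrite powR12_sqrt ?addr_ge0 ?sqr_ge0// -cmod_sqr.
  by rewrite sqrtr_sqr ger0_norm// cmod_ge0.
apply: measurableT_comp; first exact: measurable_powR.
by apply: measurable_funD; exact: measurable_funX.
Qed.

Lemma measurable_cmod D : measurable_fun D (fun w => cmod (xy w) : T).
Proof. exact: (cmeas_cmod (cmeas_xy D)). Qed.

Definition odisc r : set (T * T) := [set w | cmod (xy w) < r].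
Definition annulus b c : set (T * T) := [set w | b <= cmod (xy w) < c].

Lemma odiscE : xy @^-1` (@unit_disc R) = odisc 1.
Proof. by apply/seteqP; split=> w; rewrite /odisc /unit_disc /= normc_cmod ltcR. Qed.

Lemma measurable_odisc r : measurable (odisc r).
Proof.
have -> : odisc r = (fun w => cmod (xy w) : T) @^-1` `]-oo, r[%classic.
  by apply/seteqP; split=> w; rewrite /odisc /annulus /= in_itv.
by rewrite -[X in measurable X]setTI; apply: measurable_cmod.
Qed.

Lemma measurable_annulus b c : measurable (annulus b c).
Proof.
have -> : annulus b c = (fun w => cmod (xy w) : T) @^-1` `[b, c[%classic.
  by apply/seteqP; split=> w; rewrite /odisc /annulus /= in_itv.
by rewrite -[X in measurable X]setTI; apply: measurable_cmod.
Qed.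

Lemma annulus_odisc b c : c <= 1 -> annulus b c `<=` odisc 1.
Proof. by move=> c1 w /= /andP[_ wc]; exact: lt_le_trans c1. Qed.

Lemma measurable_pval a : rad1 a ->
  measurable_fun (odisc 1) (fun w => cmod (pval a (xy w)) : T).
Proof.
move=> Ha; apply: (@measurable_fun_cvg _ _ _ _ (fun n w => cmod (psum a n (xy w)))).
  by move=> n; exact: (cmeas_cmod (cmeas_psum (odisc 1) a n)).
move=> w /= w1; apply/cvgrPdist_le => e e0.
have [N HN] := geo_lim_near (pval_geo_lim Ha w1) e0.
near=> n; have /HN : (N <= n)%N by near: n; exact: nbhs_infty_ge.
apply: le_trans; rewrite ler_norml ler_cmod_sub andbT lerNl opprB cmodB.
exact: ler_cmod_sub.
Unshelve. all: by end_near. Qed.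

Lemma leb2_odisc1 : exists ar : R, 0 < ar /\ leb2 (odisc 1) = ar%:E.
Proof.
pose sq (b c : R) : set T := `]b, c]%classic.
have E (b c : R) : b <= c -> leb2 (sq b c `*` sq b c) = ((c - b) ^+ 2)%:E.
  move=> bc; have msq : measurable (sq b c) by exact: measurable_itv.
  have L : lebesgue_measure (sq b c) = (c - b)%:E.
    rewrite /sq lebesgue_measure_itv /= lte_fin.
    move: bc; rewrite le_eqVlt => /predU1P[->|bc]; first by rewrite ltxx subrr.
    by rewrite bc EFinB.
  transitivity ((lebesgue_measure (sq b c)) * (lebesgue_measure (sq b c)))%E.
    exact: product_measure1E.
  by rewrite L -EFinM expr2.
have msq b c : measurable (sq b c `*` sq b c).
  by apply: measurableX; exact: measurable_itv.
have up : (leb2 (odisc 1) <= ((1 - (-1)) ^+ 2)%R%:E)%E.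
  rewrite -(E (-1) 1)%R; last by lra.
  apply: le_measure; rewrite ?inE//; first exact: measurable_odisc.
  move=> [x y] /= w1; have := Re_le_cmod (xy (x, y)); have := Im_le_cmod (xy (x, y)).
  rewrite /= => h1 h2; have := le_lt_trans h1 w1; have := le_lt_trans h2 w1.
  rewrite !ltr_norml /sq => /andP[? ?] /andP[? ?].
  by split; rewrite /= in_itv /=; apply/andP; split => //; apply: ltW.
have lo : (((2^-1 - 0) ^+ 2)%R%:E <= leb2 (odisc 1))%E.
  rewrite -(E 0 2^-1)//.
  apply: le_measure; rewrite ?inE//; first exact: measurable_odisc.
  move=> [x y] [] /=; rewrite /sq /= !in_itv /= => /andP[x0 x1] /andP[y0 y1].
  suff : cmod (xy (x, y)) ^+ 2 < 1 by rewrite expr_lt1// ?cmod_ge0.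
  rewrite cmod_sqr /=.
  have : x ^+ 2 <= 2^-1 ^+ 2 by rewrite lerXn2r// nnegrE ltW.
  have : y ^+ 2 <= 2^-1 ^+ 2 by rewrite lerXn2r// nnegrE ltW.
  lra.
have fin : leb2 (odisc 1) \is a fin_num.
  rewrite ge0_fin_numE ?(le_lt_trans up) ?ltry//.
exists (fine (leb2 (odisc 1))); rewrite fineK//; split => //.
apply: fine_gt0; apply/andP; split.
  by apply: lt_le_trans lo; rewrite lte_fin subr0 exprn_gt0.
by rewrite (le_lt_trans up) ?ltry.
Qed.

(** The area of the unit disc, known through its positivity rather than its value. *)
Definition area1 : R := projT1 (cid leb2_odisc1).

Lemma area1_gt0 : 0 < area1.
Proof. by rewrite /area1; case: cid => x []. Qed.

Lemma leb2_odisc r : 0 < r -> leb2 (odisc r) = (r ^+ 2 * area1)%:E.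
Proof.
move=> r0; rewrite (leb2_scale r0 (measurable_odisc r)) [RHS]EFinM; congr (_ * _)%E.
have <- : leb2 (odisc 1) = area1%:E by rewrite /area1; case: cid => x [].
have e (w : T * T) : cmod (xy (r * w.1, r * w.2)) = r * cmod (xy w).
  rewrite (_ : xy _ = r%:C * xy w) ?cmodM ?cmod_real ?gtr0_norm//.
  by rewrite /xy_complex /=; simpc.
by congr (leb2 _); apply/seteqP; split=> w; rewrite /preimage /odisc /mkset e gtr_pMr.
Qed.

Lemma leb2_annulus b c : 0 <= b -> b < c ->
  leb2 (annulus b c) = ((c ^+ 2 - b ^+ 2) * area1)%:E.
Proof.
move=> b0 bc; have c0 : 0 < c := le_lt_trans b0 bc.
have -> : annulus b c = odisc c `\` odisc b.
  apply/seteqP; split=> w /=; rewrite /odisc /annulus /= leNgt.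
    by move=> /andP[/negP h1 h2].
  by move=> [-> h]; rewrite andbT; exact/negP.
have fin : (leb2 (odisc c) < +oo)%E by rewrite leb2_odisc// ltry.
transitivity (leb2 (odisc c) - leb2 (odisc c `&` odisc b))%E.
  by apply: measureD fin; exact: measurable_odisc.
rewrite leb2_odisc// (_ : odisc c `&` odisc b = odisc b); last first.
  by apply/seteqP; split=> w /=; [case|rewrite /odisc /= => h; split => //; exact: lt_trans bc].
move: b0; rewrite le_eqVlt => /predU1P[<-|b0].
  rewrite (_ : odisc 0 = set0) ?measure0 ?sube0 ?expr0n ?subr0//.
  by apply/seteqP; split=> w //; rewrite /odisc /mkset ltNge cmod_ge0.
by rewrite leb2_odisc// -EFinB mulrBl.
Qed.

Lemma vrot_annulus (u : R[i]) b c : cmod u = 1 -> vrot u @^-1` annulus b c = annulus b c.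
Proof.
by move=> u1; apply/seteqP; split=> w; rewrite /preimage /annulus /mkset vrotE cmodM u1 mul1r.
Qed.

Lemma measurable_rot b c (f : R[i] -> R) (u : R[i]) :
  measurable_fun (annulus b c) (fun w => f (xy w) : T) -> cmod u = 1 ->
  measurable_fun (annulus b c) (fun w => f (xy w * u) : T).
Proof.
move=> mf u1; have mA := measurable_annulus b c.
have [mv _] := mpreserving_vrot u1.
have -> : (fun w => f (xy w * u) : T) = (fun w => f (xy w)) \o vrot u.
  by apply/funext => w /=; rewrite vrotE mulrC.
apply: (measurable_comp mA _ mf); last exact: measurable_funTS.
by move=> _ [w Aw <-]; rewrite -(vrot_annulus b c u1) in Aw.
Qed.

Lemma measurable_ravg N b c (f : R[i] -> R) :
  measurable_fun (annulus b c) (fun w => f (xy w) : T) ->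
  measurable_fun (annulus b c) (fun w => ravg N (fun u => f (xy w * u)) : T).
Proof.
move=> mf; apply: measurable_funM; first exact: measurable_cst.
by apply: measurable_sum => j; exact: measurable_rot mf (cmod_uroot N j).
Qed.

(** Rotation invariance lets every function be replaced by its average over
    the N-th roots of unity. *)
Lemma integral_ravg N b c (f : R[i] -> R) : (0 < N)%N ->
  measurable_fun (annulus b c) (fun w => f (xy w) : T) ->
  (forall z, 0 <= f z) ->
  (\int[leb2]_(w in annulus b c) (ravg N (fun u => f (xy w * u)))%:E =
   \int[leb2]_(w in annulus b c) (f (xy w))%:E)%E.
Proof.
move=> N0 mf f0; have mA := measurable_annulus b c.
have mj (j : nat) := measurable_rot mf (cmod_uroot N j).
transitivity (\int[leb2]_(w in annulus b c)
    ((N%:R^-1)%:E * \sum_(j < N) (f (xy w * uroot N ^+ j))%:E)%E)%E.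
  by apply: eq_integral => w _; rewrite /ravg EFinM sumEFin.
have mE (j : nat) : measurable_fun (annulus b c) (fun w => (f (xy w * uroot N ^+ j))%:E).
  by apply/measurable_EFinP; exact: mj.
have mS : measurable_fun (annulus b c)
    (fun w => \sum_(j < N) (f (xy w * uroot N ^+ j))%:E)%E.
  by apply: emeasurable_sum => j; exact: mE.
rewrite (ge0_integralZl _ mA mS); last 2 first.
- by move=> w _; apply: sume_ge0 => j _; rewrite lee_fin.
- by rewrite lee_fin invr_ge0.
rewrite (ge0_integral_sum _ mA (fun j : 'I_N => mE j)); last first.
  by move=> j w _; rewrite lee_fin.
rewrite (eq_bigr (fun=> \int[leb2]_(w in annulus b c) (f (xy w))%:E)%E); last first.
  move=> j _; rewrite -(ge0_integral_vrot (cmod_uroot N j) mA (vrot_annulus b c (cmod_uroot N j)))//.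
  - by apply: eq_integral => w _; rewrite vrotE mulrC.
  - exact/measurable_EFinP.
  - by move=> w _; rewrite lee_fin.
set I := (X in _ = X).
have -> : (\sum_(j < N) I = N%:R%:E * I)%E.
  elim: N {N0 mj mE mS} => [|n IH]; first by rewrite big_ord0 mul0e.
  by rewrite big_ord_recr /= IH -natr1 EFinD ge0_muleDl ?lee_fin// mul1e.
by rewrite muleA -EFinM mulVf ?mul1e// pnatr_eq0 -lt0n.
Qed.

End Annuli.

Section AnnularMeans.
Local Open Scope complex_scope.
Context {R : realType}.
Local Notation T := (measurableTypeR R).
Local Notation xy := (@xy_complex R).
Implicit Types (a : nat -> R[i]) (b c p q : R).

Lemma measurable_cmod_annulus b c (g : R[i] -> R[i]) : c <= 1 ->
  measurable_fun (odisc 1) (fun w => cmod (g (xy w)) : T) ->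
  measurable_fun (annulus b c) (fun w => cmod (g (xy w)) : T).
Proof.
move=> c1; apply: measurable_funS; first exact: measurable_odisc.
exact: annulus_odisc.
Qed.

Lemma integral_annulus_cst b c (k : R) : 0 <= b -> b < c ->
  (\int[leb2]_(w in annulus b c) k%:E = (k * ((c ^+ 2 - b ^+ 2) * area1))%:E)%E.
Proof.
move=> b0 bc; rewrite EFinM -leb2_annulus//.
apply: integral_cst; exact: measurable_annulus.
Qed.

(** Averaging over rotations replaces the integrand by an average over roots of
    unity, within 1 of the mean square for enough roots. *)
Lemma annulus_mean_upper a b c : rad1 a -> 0 <= b -> b < c -> c < 1 ->
  (\int[leb2]_(w in annulus b c) (cmod (pval a (xy w)) ^+ 2)%:E <=
   ((msq a (c ^+ 2) + 1) * ((c ^+ 2 - b ^+ 2) * area1))%:E)%E.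
Proof.
move=> Ha b0 bc c1; have c0 : 0 <= c := ltW (le_lt_trans b0 bc).
have mp := measurable_cmod_annulus (b := b) (ltW c1) (measurable_pval Ha).
have mp2 : measurable_fun (annulus b c) (fun w => cmod (pval a (xy w)) ^+ 2 : T).
  exact: measurable_funX.
have [N0 HN] := parseval_near Ha c0 c1 ltr01.
rewrite -(@integral_ravg _ N0.+1 b c (fun z => cmod (pval a z) ^+ 2))//; last first.
  by move=> z; exact: sqr_ge0.
rewrite -integral_annulus_cst//; apply: ge0_le_integral.
- exact: measurable_annulus.
- by move=> w _; rewrite lee_fin mulr_ge0 ?invr_ge0// sumr_ge0// => j _; exact: sqr_ge0.
- by apply/measurable_EFinP; exact: (@measurable_ravg _ N0.+1 b c (fun z => cmod (pval a z) ^+ 2)).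
- exact: measurable_cst.
move=> w /andP[wb wc]; rewrite lee_fin.
have := HN N0.+1 (xy w) (leqnSn _) isT (ltW wc); rewrite ler_norml => /andP[_].
rewrite lerBlDr => /le_trans; apply; rewrite addrC lerD2r.
have : msq a (cmod (xy w) ^+ 2) <= msq a (c ^+ 2).
  apply: msq_mono => //; first exact: sqr_ge0.
    by rewrite ler_sqr ?nnegrE ?cmod_ge0// ltW.
  by rewrite exprn_ilt1.
exact.
Qed.

(** The tangent line of a convex power, from Young's inequality. *)
Lemma powR_tangent (y q : R) : 0 <= y -> 1 < q -> 1 + q * (y - 1) <= y `^ q.
Proof.
move=> y0 q1; have q0 : 0 < q := lt_trans ltr01 q1.
pose r := q / (q - 1).
have r0 : 0 < r by rewrite divr_gt0// subr_gt0.
have e : q^-1 + r^-1 = 1.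
  by rewrite /r invf_div; field; rewrite !gt_eqF// subr_gt0.
have := conjugate_powR y0 ler01 q0 r0 e.
rewrite mulr1 powR1 mul1r.
have -> : r^-1 = 1 - q^-1 by rewrite -e addrAC subrr add0r.
rewrite -(ler_pM2l q0) => h.
have e2 : q * (y `^ q / q + (1 - q^-1)) = y `^ q + (q - 1) by field; rewrite gt_eqF.
by move: h; rewrite e2; lra.
Qed.

(** Sum the tangent inequality at the mean. *)
Lemma power_mean N (f : R[i] -> R) q : (0 < N)%N -> 1 < q -> (forall u, 0 <= f u) ->
  ravg N f `^ q <= ravg N (fun u => f u `^ q).
Proof.
move=> N0 q1 f0; have q0 : 0 < q := lt_trans ltr01 q1.
set m := ravg N f.
have m0 : 0 <= m by rewrite mulr_ge0 ?invr_ge0// sumr_ge0.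
have NR : (N%:R : R) != 0 by rewrite pnatr_eq0 -lt0n.
have [me|mn] := eqVneq m 0.
  rewrite me powR0 ?gt_eqF//.
  by rewrite mulr_ge0 ?invr_ge0// sumr_ge0// => j _; exact: powR_ge0.
have m1 : 0 < m by rewrite lt_neqAle eq_sym mn.
have mq : 0 < m `^ q by exact: powR_gt0.
have Sf : \sum_(j < N) f (uroot N ^+ j) = N%:R * m.
  by rewrite /m /ravg mulrA mulfV// mul1r.
rewrite /ravg ler_pdivlMl ?ltr0n//.
apply: (@le_trans _ _ (\sum_(j < N) m `^ q * (1 + q * (f (uroot N ^+ j) / m - 1)))).
  rewrite -mulr_sumr big_split -mulr_sumr sumrB -mulr_suml Sf !sumr_const card_ord /=.
  by rewrite mulfK ?gt_eqF// subrr mulr0 addr0 mulrC.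
apply: ler_sum => j _; set x := f _.
have x0 : 0 <= x / m by rewrite divr_ge0 ?f0// ltW.
have -> : x `^ q = m `^ q * (x / m) `^ q.
  by rewrite -powRM ?(ltW m1)// mulrC divfK.
by rewrite ler_wpM2l ?(ltW mq)// powR_tangent.
Qed.

(** Averaging over rotations and the power mean inequality on each circle; half of
    the mean square absorbs the discretization error. *)
Lemma annulus_mean_lower a b c q : rad1 a -> 0 <= b -> b < c -> c < 1 -> 1 < q ->
  (((msq a (b ^+ 2) / 2) `^ q * ((c ^+ 2 - b ^+ 2) * area1))%:E <=
   \int[leb2]_(w in annulus b c) (cmod (pval a (xy w)) `^ (2 * q))%:E)%E.
Proof.
move=> Ha b0 bc c1 q1; have c0 : 0 <= c := ltW (le_lt_trans b0 bc).
have q0 : 0 < q := lt_trans ltr01 q1.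
have b2 : b ^+ 2 < 1 by rewrite exprn_ilt1// (lt_trans bc).
set m := msq a (b ^+ 2).
have m0 : 0 <= m by apply: msq_ge0 => //; exact: sqr_ge0.
have [->|mn] := eqVneq m 0.
  rewrite mul0r powR0 ?gt_eqF// mul0r; apply: integral_ge0 => w _.
  by rewrite lee_fin powR_ge0.
have m1 : 0 < m by rewrite lt_neqAle eq_sym mn.
have mp := measurable_cmod_annulus (b := b) (ltW c1) (measurable_pval Ha).
pose f z := (cmod (pval a z) ^+ 2) `^ q.
have fE z : cmod (pval a z) `^ (2 * q) = f z.
  by rewrite powRrM powR_mulrn// cmod_ge0.
under eq_integral do rewrite fE.
have mp2 : measurable_fun (annulus b c) (fun w => f (xy w) : T).
  by apply: (measurableT_comp (measurable_powR _)); exact: measurable_funX.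
have [N0 HN] := parseval_near Ha c0 c1 (divr_gt0 m1 (ltr0n R 2)).
rewrite -(@integral_ravg _ N0.+1 b c f)//; last by move=> z; exact: powR_ge0.
rewrite -integral_annulus_cst//; apply: ge0_le_integral.
- exact: measurable_annulus.
- by move=> w _; rewrite lee_fin powR_ge0.
- exact: measurable_cst.
- by apply/measurable_EFinP; exact: measurable_ravg.
move=> w /andP[wb wc]; rewrite lee_fin.
apply: (le_trans _ (@power_mean N0.+1 (fun u => cmod (pval a (xy w * u)) ^+ 2) q isT q1 _)); last first.
  by move=> u; exact: sqr_ge0.
have := HN N0.+1 (xy w) (leqnSn _) isT (ltW wc); rewrite ler_norml => /andP[h _].
have h2 : m <= msq a (cmod (xy w) ^+ 2).
  apply: msq_mono => //; first exact: sqr_ge0.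
    by rewrite ler_sqr ?nnegrE ?cmod_ge0.
  by rewrite exprn_ilt1 ?cmod_ge0// (lt_trans wc).
move: h; rewrite lerBrDr addrC => h.
have h3 : m / 2 <= ravg N0.+1 (fun u => cmod (pval a (xy w * u)) ^+ 2).
  by rewrite (le_trans _ h)// lerBrDr -splitr.
have h4 : 0 <= m / 2 := divr_ge0 m0 (ler0n _ 2).
have n1 : m / 2 \is Num.nneg by rewrite nnegrE.
have n2 : ravg N0.+1 (fun u => cmod (pval a (xy w * u)) ^+ 2) \is Num.nneg.
  by rewrite nnegrE (le_trans h4 h3).
exact: (ge0_ler_powR (ltW q0) n1 n2 h3).
Qed.

End AnnularMeans.

(** * The weighted energy and its dyadic decomposition *)

Section DirichletEnergy.
Local Open Scope complex_scope.
Context {R : realType}.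
Local Notation T := (measurableTypeR R).
Local Notation xy := (@xy_complex R).
Implicit Types (a : nat -> R[i]) (b c p q : R) (g : R[i] -> R[i]).

(** The integral in the norm of D^p_{p-1}, as a functional of the derivative. *)
Definition energy p g : \bar R :=
  (\int[leb2]_(w in odisc 1)
    ((1 - cmod (xy w)) `^ (p - 1) * cmod (g (xy w)) `^ p)%:E)%E.

Definition cmeasurable g := measurable_fun (odisc 1) (fun w => cmod (g (xy w)) : T).

Definition dyad (j : nat) : R := 1 - 2^-1 ^+ j.

Lemma dyad_ge0 j : 0 <= dyad j.
Proof. by rewrite subr_ge0 exprn_ile1// invf_le1// ler1n. Qed.

Lemma dyad_lt1 j : dyad j < 1.
Proof. by rewrite ltrBlDr ltrDl exprn_gt0. Qed.

Lemma dyad_ltS j : dyad j < dyad j.+1.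
Proof.
rewrite /dyad ltrD2l ltrN2 exprS gtr_pMl ?exprn_gt0//.
by rewrite invf_lt1// ltr1n.
Qed.

Lemma dyad_homo i j : (i <= j)%N -> dyad i <= dyad j.
Proof.
move=> ij; rewrite /dyad lerD2l lerN2; apply: ler_wiXn2l => //.
by rewrite invf_le1// ler1n.
Qed.

Lemma bigcup_dyadic : \bigcup_j annulus (dyad j) (dyad j.+1) = odisc 1 :> set (T * T).
Proof.
apply/seteqP; split=> [w [j _ /andP[_ h]]|w w1]; first exact: lt_trans h (dyad_lt1 _).
have w1' : 0 < 1 - cmod (xy w) by rewrite subr_gt0.
have h0 : 0 <= 2^-1 :> R by rewrite invr_ge0.
have h1 : 2^-1 < 1 :> R by rewrite invf_lt1// ltr1n.
have [N HN] := geometric_small 1 h0 h1 w1'.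
have ex : exists n, cmod (xy w) < dyad n.+1.
  exists N; have := HN N (leqnn N); rewrite mul1r => h.
  by rewrite (le_lt_trans _ (dyad_ltS N))// /dyad lerBrDr addrC -lerBrDr.
case: (ex_minnP ex) => n hn min; exists n => //; apply/andP; split => //.
case: n hn min => [|n] hn min; first by rewrite /dyad expr0 subrr cmod_ge0.
rewrite leNgt; apply/negP => /min; by rewrite ltnn.
Qed.

Lemma trivIset_dyadic : trivIset setT (fun j => annulus (dyad j) (dyad j.+1) : set (T * T)).
Proof.
apply/trivIsetP => i j _ _ ij; wlog lij : i j ij / (i < j)%N => [H|].
  move: (ij); rewrite neq_ltn => /orP[/(H i j ij)//|h].
  by rewrite setIC; apply: H => //; rewrite eq_sym.
apply/seteqP; split=> w // -[/andP[_ h1] /andP[h2 _]].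
have := lt_le_trans h1 (dyad_homo lij).
by rewrite ltNge h2.
Qed.

Lemma measurable_energy p g : cmeasurable g ->
  measurable_fun (odisc 1)
    (fun w => (1 - cmod (xy w)) `^ (p - 1) * cmod (g (xy w)) `^ p : T).
Proof.
move=> mg; apply: measurable_funM.
  apply: (measurableT_comp (measurable_powR _)); apply: measurable_funB => //.
  exact: measurable_cmod.
exact: (measurableT_comp (measurable_powR _)).
Qed.

Lemma energy_dyadic p g : cmeasurable g ->
  energy p g = (\sum_(0 <= j <oo) \int[leb2]_(w in annulus (dyad j) (dyad j.+1))
    ((1 - cmod (xy w)) `^ (p - 1) * cmod (g (xy w)) `^ p)%:E)%E.
Proof.
move=> mg; rewrite /energy -bigcup_dyadic ge0_integral_bigcup//.
- by move=> j; exact: measurable_annulus.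
- by rewrite bigcup_dyadic; apply/measurable_EFinP; exact: measurable_energy.
- by move=> w _; rewrite lee_fin mulr_ge0 ?powR_ge0.
- exact: trivIset_dyadic.
Qed.

Lemma energy_le p g (e : nat -> R) (B : R) : cmeasurable g ->
  (forall j, (\int[leb2]_(w in annulus (dyad j) (dyad j.+1))
    ((1 - cmod (xy w)) `^ (p - 1) * cmod (g (xy w)) `^ p)%:E <= (e j)%:E)%E) ->
  (forall n, \sum_(j < n) e j <= B) ->
  (energy p g <= B%:E)%E.
Proof.
move=> mg He HB; rewrite energy_dyadic//; apply: lime_le.
  apply: is_cvg_nneseries => j _ _; apply: integral_ge0 => w _.
  by rewrite lee_fin mulr_ge0 ?powR_ge0.
apply: nearW => n; rewrite big_mkord.
apply: (@le_trans _ _ (\sum_(j < n) (e j)%:E)%E); first by apply: lee_sum => j _.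
by rewrite sumEFin lee_fin.
Qed.

End DirichletEnergy.

(** * The Herglotz transform as a power series *)

Section CircleIntegrals.
Local Open Scope complex_scope.
Context {R : realType}.
Local Notation T := (measurableTypeR R).
Context (mu : {finite_measure set T -> \bar R}).
Implicit Types (f g : R -> R) (a : nat -> R[i]) (z w : R[i]).

(** The integrands met on the circle; they are integrable since mu is finite. *)
Definition bmeas f := measurable_fun [set: T] (f : T -> T) /\ exists B, forall x, `|f x| <= B.

Definition mass : R := fine (mu (@circle R)).

Lemma measurable_circle : measurable (@circle R : set T).
Proof. exact: measurable_itv. Qed.

Lemma mass_ge0 : 0 <= mass.
Proof. exact: fine_ge0. Qed.

Lemma circle_finite : (mu (@circle R) < +oo)%E.
Proof. by rewrite ltey_eq fin_num_measure//; exact: measurable_circle. Qed.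

Lemma bmeas_integrable f : bmeas f -> mu.-integrable (@circle R) (EFin \o f).
Proof.
move=> [mf [B HB]]; apply: measurable_bounded_integrable.
- exact: measurable_circle.
- exact: circle_finite.
- exact: measurable_funTS.
exists B; split; first exact: num_real.
by move=> x Bx y _ /=; rewrite (le_trans (HB y))// ltW.
Qed.

Lemma bmeasD f g : bmeas f -> bmeas g -> bmeas (fun x => f x + g x).
Proof.
move=> [mf [A HA]] [mg [B HB]]; split; first exact: measurable_funD.
exists (A + B) => x; by rewrite (le_trans (ler_normD _ _))// lerD.
Qed.

Lemma bmeasM f g : bmeas f -> bmeas g -> bmeas (fun x => f x * g x).
Proof.
move=> [mf [A HA]] [mg [B HB]]; split; first exact: measurable_funM.
by exists (A * B) => x; rewrite normrM ler_pM.
Qed.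

Lemma bmeas_cst c : bmeas (fun=> c).
Proof. by split; [exact: measurable_cst|exists `|c|]. Qed.

Lemma bmeasZ c f : bmeas f -> bmeas (fun x => c * f x).
Proof. by move=> Hf; apply: bmeasM => //; exact: bmeas_cst. Qed.

Lemma bmeasN f : bmeas f -> bmeas (fun x => - f x).
Proof.
by move=> /(bmeasZ (-1)); under eq_fun do rewrite mulN1r.
Qed.

Lemma bmeasB f g : bmeas f -> bmeas g -> bmeas (fun x => f x - g x).
Proof. by move=> Hf /bmeasN; exact: bmeasD. Qed.

Definition rint f : R := \int[mu]_(x in @circle R) f x.

Lemma rintD f g : bmeas f -> bmeas g -> rint (fun x => f x + g x) = rint f + rint g.
Proof.
by move=> Hf Hg; apply: RintegralD; [exact: measurable_circle|exact: bmeas_integrable..].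
Qed.

Lemma rintB f g : bmeas f -> bmeas g -> rint (fun x => f x - g x) = rint f - rint g.
Proof.
by move=> Hf Hg; apply: RintegralB; [exact: measurable_circle|exact: bmeas_integrable..].
Qed.

Lemma rintZ c f : bmeas f -> rint (fun x => c * f x) = c * rint f.
Proof.
by move=> Hf; apply: RintegralZl; [exact: measurable_circle|exact: bmeas_integrable].
Qed.

Lemma rint_bound f B : bmeas f -> (forall x, @circle R x -> `|f x| <= B) -> `|rint f| <= B * mass.
Proof.
move=> Hf HB.
have := @le_normr_Rintegral _ T R mu (@circle R) f measurable_circle (bmeas_integrable Hf).
move=> /le_trans; apply.
rewrite -(Rintegral_cst mu measurable_circle B); apply: le_Rintegral => //.
- exact: measurable_circle.
- apply: (@bmeas_integrable (fun x => `|f x|)); case: Hf => mf [C HC]; split.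
    exact: measurableT_comp.
  by exists C => x; rewrite normr_id.
- exact: (bmeas_integrable (bmeas_cst B)).
Qed.

Implicit Types (h : R -> R[i]).

Definition cbmeas (g : R -> R[i]) :=
  bmeas (fun x => complex.Re (g x)) /\ bmeas (fun x => complex.Im (g x)).

Local Notation cint := (circle_integral mu).

Lemma cintE (g : R -> R[i]) : cint g = rint (fun x => complex.Re (g x)) +i* rint (fun x => complex.Im (g x)).
Proof. by []. Qed.

Lemma cbmeas_cst c : cbmeas (fun=> c).
Proof. by split; exact: bmeas_cst. Qed.

Lemma cbmeasD (g h : R -> R[i]) : cbmeas g -> cbmeas h -> cbmeas (fun x => g x + h x).
Proof.
move=> [g1 g2] [h1 h2]; split; rewrite /=.
  by under eq_fun do rewrite cReD; exact: bmeasD.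
by under eq_fun do rewrite cImD; exact: bmeasD.
Qed.

Lemma cbmeasM (g h : R -> R[i]) : cbmeas g -> cbmeas h -> cbmeas (fun x => g x * h x).
Proof.
move=> [g1 g2] [h1 h2]; split; rewrite /=.
  by under eq_fun do rewrite cReM; apply: bmeasB; exact: bmeasM.
by under eq_fun do rewrite cImM; apply: bmeasD; exact: bmeasM.
Qed.

Lemma cbmeasZ c (g : R -> R[i]) : cbmeas g -> cbmeas (fun x => c * g x).
Proof. by move=> Hg; apply: cbmeasM => //; exact: cbmeas_cst. Qed.

Lemma cintD (g h : R -> R[i]) : cbmeas g -> cbmeas h ->
  cint (fun x => g x + h x) = cint g + cint h.
Proof.
move=> [g1 g2] [h1 h2]; rewrite !cintE.
have -> : rint (fun x => complex.Re (g x + h x)) =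
    rint (fun x => complex.Re (g x)) + rint (fun x => complex.Re (h x)).
  by rewrite -rintD//; apply: eq_Rintegral => x _; rewrite cReD.
have -> : rint (fun x => complex.Im (g x + h x)) =
    rint (fun x => complex.Im (g x)) + rint (fun x => complex.Im (h x)).
  by rewrite -rintD//; apply: eq_Rintegral => x _; rewrite cImD.
by [].
Qed.

Lemma cintZ c (g : R -> R[i]) : cbmeas g -> cint (fun x => c * g x) = c * cint g.
Proof.
move=> [g1 g2]; rewrite !cintE.
have -> : rint (fun x => complex.Re (c * g x)) =
    complex.Re c * rint (fun x => complex.Re (g x)) - complex.Im c * rint (fun x => complex.Im (g x)).
  by rewrite -!rintZ// -rintB; [|exact: bmeasZ..]; apply: eq_Rintegral => x _; rewrite cReM.
have -> : rint (fun x => complex.Im (c * g x)) =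
    complex.Re c * rint (fun x => complex.Im (g x)) + complex.Im c * rint (fun x => complex.Re (g x)).
  by rewrite -!rintZ// -rintD; [|exact: bmeasZ..]; apply: eq_Rintegral => x _; rewrite cImM.
by case: c.
Qed.

Lemma cint_bound (g : R -> R[i]) B : cbmeas g -> (forall x, cmod (g x) <= B) ->
  cmod (cint g) <= 2 * B * mass.
Proof.
move=> [g1 g2] HB; rewrite (le_trans (cmod_le_ReIm _))// cintE /=.
have -> : 2 * B * mass = B * mass + B * mass by ring.
by rewrite lerD// rint_bound// => x _; rewrite (le_trans _ (HB x))// ?Re_le_cmod ?Im_le_cmod.
Qed.

Lemma eq_cint (g h : R -> R[i]) : g =1 h -> cint g = cint h.
Proof. by move=> /funext ->. Qed.

Lemma bmeas_continuous f : continuous f -> (forall x, `|f x| <= 1) -> bmeas f.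
Proof. by move=> cf f1; split; [exact: continuous_measurable_fun|exists 1]. Qed.

Lemma cbmeas_cisN : cbmeas (fun x => cis (- x)).
Proof.
split; rewrite /=.
  under eq_fun do rewrite cosN.
  by apply: bmeas_continuous; [exact: continuous_cos|exact: cos_max].
under eq_fun do rewrite sinN.
by apply/bmeasN/bmeas_continuous; [exact: continuous_sin|exact: sin_max].
Qed.

Lemma cbmeas_cisX n : cbmeas (fun x => cis (- x) ^+ n).
Proof.
elim: n => [|n IH]; first by under eq_fun do rewrite expr0; exact: cbmeas_cst.
by under eq_fun do rewrite exprS; apply: cbmeasM => //; exact: cbmeas_cisN.
Qed.

Definition moment n : R[i] := cint (fun x => cis (- x) ^+ n).

Lemma cmod_moment n : cmod (moment n) <= 2 * mass.
Proof.
rewrite -[2]mulr1; apply: cint_bound; first exact: cbmeas_cisX.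
by move=> x; rewrite cmodX cmod_cis expr1n.
Qed.

Lemma rad1_moment a : rad1 a -> rad1 (fun n => a n * moment n).
Proof.
move=> Ha q q0 q1; have [M HM] := Ha q q0 q1; exists (M * (2 * mass)) => n.
by rewrite cmodM mulrAC ler_pM ?mulr_ge0 ?cmod_ge0 ?exprn_ge0 ?cmod_moment.
Qed.

Lemma cbmeas_psum a n z : cbmeas (fun x => psum a n (z * cis (- x))).
Proof.
elim: n => [|n IH].
  by rewrite /psum; under eq_fun do rewrite big_ord0; exact: cbmeas_cst.
under eq_fun do rewrite psumS exprMn.
by apply: cbmeasD => //; do 2! apply: cbmeasZ; exact: cbmeas_cisX.
Qed.

Lemma cint_psum a n z :
  cint (fun x => psum a n (z * cis (- x))) = psum (fun n => a n * moment n) n z.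
Proof.
elim: n => [|n IH].
  rewrite /psum big_ord0 (eq_cint (h := fun x => 0 * cis (- x))); last first.
    by move=> x; rewrite big_ord0 mul0r.
  by rewrite cintZ ?mul0r//; exact: cbmeas_cisN.
rewrite psumS -IH.
rewrite (eq_cint (h := fun x => psum a n (z * cis (- x)) + (a n * z ^+ n) * cis (- x) ^+ n)).
  rewrite cintD; [|exact: cbmeas_psum|by apply: cbmeasZ; exact: cbmeas_cisX].
  by rewrite cintZ; [rewrite -/(moment n); ring|exact: cbmeas_cisX].
by move=> x; rewrite psumS exprMn; ring.
Qed.

Lemma cbmeas_pval a z : rad1 a -> cmod z < 1 -> cbmeas (fun x => pval a (z * cis (- x))).
Proof.
move=> Ha z1; have [B [B0 HB]] := pval_bounded Ha (cmod_ge0 z) z1.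
have zx x : cmod (z * cis (- x)) <= cmod z by rewrite cmodM cmod_cis mulr1.
have lim x (g : R[i] -> R) : (forall u v, `|g u - g v| <= cmod (u - v)) ->
    g (psum a n (z * cis (- x))) @[n --> \oo] --> g (pval a (z * cis (- x))).
  move=> Hg; apply/cvgrPdist_le => e e0.
  have [N HN] := geo_lim_near (pval_geo_lim Ha (le_lt_trans (zx x) z1)) e0.
  near=> n; rewrite (le_trans (Hg _ _))//; apply: HN.
  by near: n; exact: nbhs_infty_ge.
split; split.
- apply: (@measurable_fun_cvg _ T R setT (fun n x => complex.Re (psum a n (z * cis (- x))))).
    by move=> n; have [[]] := cbmeas_psum a n z.
  by move=> x _; apply: lim => u v; rewrite -cReN -cReD Re_le_cmod.
- by exists B => x; rewrite (le_trans (Re_le_cmod _))// HB.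
- apply: (@measurable_fun_cvg _ T R setT (fun n x => complex.Im (psum a n (z * cis (- x))))).
    by move=> n; have [_ []] := cbmeas_psum a n z.
  by move=> x _; apply: lim => u v; rewrite -cImN -cImD Im_le_cmod.
- by exists B => x; rewrite (le_trans (Im_le_cmod _))// HB.
Unshelve. all: by end_near. Qed.

(** Fubini for a power series in z e^{-i theta}, by uniform convergence. *)
Lemma cint_pval a z : rad1 a -> cmod z < 1 ->
  cint (fun x => pval a (z * cis (- x))) = pval (fun n => a n * moment n) z.
Proof.
move=> Ha z1; apply/esym/pval_unique.
have [M [t [M0 t0 t1 H]]] := pvalP Ha (cmod_ge0 z) z1.
apply: (@geo_limW _ _ _ (2 * M * mass) t t0 t1) => n.
rewrite -cint_psum -[X in _ - X]mul1r -mulNr -cintZ; last exact: cbmeas_psum.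
rewrite -cintD; [|exact: cbmeas_pval|by apply: cbmeasZ; exact: cbmeas_psum].
have -> : 2 * M * mass * t ^+ n = 2 * (M * t ^+ n) * mass by ring.
apply: cint_bound.
  by apply: cbmeasD; [exact: cbmeas_pval|by apply: cbmeasZ; exact: cbmeas_psum].
by move=> x; rewrite mulN1r H// cmodM cmod_cis mulr1.
Qed.

(** Coefficients of the Herglotz kernel (1 + w) / (1 - w). *)
Definition herglotz n : R[i] := if n is _.+1 then 2 else 1.

Lemma rad1_ones : rad1 (fun=> 1 : R[i]).
Proof. by apply: (@rad1_bounded _ _ 1) => n; rewrite cmod1. Qed.

Lemma rad1_herglotz : rad1 herglotz.
Proof.
apply: (@rad1_bounded _ _ 2) => -[|n]; rewrite /herglotz ?cmod1 ?ler1n//.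
by rewrite (cmod_nat 2).
Qed.

Lemma one_sub_neq0 w : cmod w < 1 -> 1 - w != 0.
Proof.
move=> w1; rewrite subr_eq0; apply/eqP => e; move: w1.
by rewrite -e cmod1 ltxx.
Qed.

Lemma pval_ones w : cmod w < 1 -> pval (fun=> 1) w = (1 - w)^-1.
Proof.
move=> w1; apply: pval_unique.
have nz := one_sub_neq0 w1.
exists (cmod (1 - w)^-1), (cmod w); split => //; first exact: cmod_ge0.
move=> n; rewrite /psum; under eq_bigr do rewrite mul1r.
have -> : \sum_(i < n) w ^+ i = (1 - w ^+ n) / (1 - w).
  apply: (mulfI nz); rewrite mulrCA mulfV// mulr1 -opprB mulNr -subrX1 opprB//.
have -> : (1 - w)^-1 - (1 - w ^+ n) / (1 - w) = (1 - w)^-1 * w ^+ n by field.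
by rewrite cmodM cmodX.
Qed.

Lemma pval_pder_herglotz w : cmod w < 1 -> pval (pder herglotz) w = 2 / (1 - w) ^+ 2.
Proof.
move=> w1; have -> : pder herglotz = (fun n => 2 * conv (fun=> 1) (fun=> 1) n).
  apply/funext => n; rewrite /pder /herglotz /conv mulrC; congr (_ * _).
  by under eq_bigr do rewrite mul1r; rewrite sumr_const card_ord.
rewrite pvalZ//; last by apply: rad1_conv; exact: rad1_ones.
rewrite pvalM//; [|exact: rad1_ones..].
by rewrite pval_ones// expr2 invfM.
Qed.

Lemma pval_herglotz w : cmod w < 1 -> pval herglotz w = (1 + w) / (1 - w).
Proof.
move=> w1; have nz := one_sub_neq0 w1.
have -> : herglotz = (fun n => 2 * 1 + (-1 : {poly R[i]})`_n).
  apply/funext => -[|n]; rewrite coefN coef1 /=; first by ring.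
  by ring.
rewrite pvalD//; [|exact/rad1Z/rad1_ones|exact: rad1_poly].
rewrite pvalZ//; last exact: rad1_ones.
by rewrite pval_poly// pval_ones// hornerN hornerC; field.
Qed.

(** Taylor coefficients of the Herglotz transform of mu. *)
Definition Fcoef n : R[i] := herglotz n * moment n.

Lemma rad1_Fcoef : rad1 Fcoef.
Proof. exact: (rad1_moment rad1_herglotz). Qed.

Lemma cisN_inv (x : R) : cis (- x) = (cis x)^-1.
Proof.
have h : cis x * cis (- x) = 1 by rewrite -cisD subrr cis0.
have nz : cis x != 0 by apply/eqP => e; move: h; rewrite e mul0r => /eqP; rewrite eq_sym oner_eq0.
by apply: (mulfI nz); rewrite h mulfV.
Qed.

Lemma herglotz_kernel (x : R) z : cmod z < 1 ->
  (cis x + z) / (cis x - z) = pval herglotz (z * cis (- x)).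
Proof.
move=> z1; rewrite pval_herglotz ?cmodM ?cmod_cis ?mulr1//.
have zw : cmod (z * cis (- x)) < 1 by rewrite cmodM cmod_cis mulr1.
have nz := one_sub_neq0 zw; rewrite cisN_inv in nz *.
have cx : cis x != 0 by apply/eqP => /(congr1 (@cmod R)); rewrite cmod_cis cmod0 => /eqP; rewrite oner_eq0.
have nz' : cis x - z != 0.
  apply: contra nz => /eqP e; have -> : 1 - z / cis x = (cis x - z) / cis x by field.
  by rewrite e mul0r.
by field; rewrite cx nz'.
Qed.

Lemma circle_integral_Fcoef z : cmod z < 1 ->
  cint (fun x => (cis x + z) / (cis x - z)) = pval Fcoef z.
Proof.
move=> z1; rewrite (eq_cint (h := fun x => pval herglotz (z * cis (- x)))).
  by rewrite cint_pval//; exact: rad1_herglotz.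
by move=> x; exact: herglotz_kernel.
Qed.

Lemma singular_inner_pval z : cmod z < 1 -> singular_inner mu z = cexp (- pval Fcoef z).
Proof. by move=> z1; rewrite /singular_inner circle_integral_Fcoef. Qed.

Lemma cmod_sqr_conj z : (cmod z ^+ 2)%:C = z * z^*.
Proof. by rewrite -sqr_normc normc_cmod -rmorphXn. Qed.

Lemma Re_herglotz_ge0 w : cmod w < 1 -> 0 <= complex.Re ((1 + w) / (1 - w)).
Proof.
move=> w1; have nz := one_sub_neq0 w1.
have m0 : 0 < cmod (1 - w) ^+ 2 by rewrite exprn_gt0// cmod_gt0.
rewrite -(pmulr_rge0 _ m0) -cReZ cmod_sqr_conj.
have -> : (1 - w) * (1 - w)^* * ((1 + w) / (1 - w)) = (1 + w) * (1 - w)^* by field.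
have : cmod w ^+ 2 < 1 by rewrite exprn_ilt1 ?cmod_ge0.
rewrite cmod_sqr; case: w {w1 nz m0} => a b /=.
by rewrite /= => h; nra.
Qed.

(** The real part of the Herglotz kernel is the Poisson kernel. *)
Lemma Re_Fcoef_ge0 z : cmod z < 1 -> 0 <= complex.Re (pval Fcoef z).
Proof.
move=> z1; rewrite -circle_integral_Fcoef// /circle_integral /=.
apply: Rintegral_ge0 => x _; rewrite herglotz_kernel// pval_herglotz ?cmodM ?cmod_cis ?mulr1//.
by apply: Re_herglotz_ge0; rewrite cmodM cmod_cis mulr1.
Qed.

End CircleIntegrals.

(** * The angular derivative of the Poisson kernel *)

Section PoissonDerivativeKernel.
Local Open Scope complex_scope.
Context {R : realType}.
Implicit Types (r x y al : R).

(** The squared modulus of 1 - r e^(i al). *)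
Definition poisson_den r al : R := 1 - 2 * r * cos al + r ^+ 2.

(** Minus the angular derivative of the Poisson kernel (1 - r^2) / poisson_den. *)
Definition dpoisson r al : R := 2 * r * (1 - r ^+ 2) * sin al / poisson_den r al ^+ 2.

(** Where cos y >= 1/2 use y cos y <= sin y; elsewhere sin y >= sqrt(3) / 2 and
    y <= 2. *)
Lemma sin_lower y : 0 <= y -> y <= pi / 2 -> 2 / 5 * y <= sin y.
Proof.
move=> y0 y1; have y2 : y <= 2 by have [/andP[_ h] _] := @pihalf_02_cos_pihalf R; exact: le_trans h.
have s0 : 0 <= sin y.
  by apply: sin_ge0_pi; rewrite y0 /=; have := pi_ge0 R; lra.
have [c1|c1] := lerP 2^-1 (cos y).
  have : y * cos y <= sin y.
    rewrite -subr_ge0.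
    have -> : 0 = sin 0 - 0 * cos 0 :> R by rewrite sin0 mul0r subr0.
    apply: (@ge0_rderive_le _ (fun t => sin t - t * cos t)
      (fun t => cos t - (1 * cos t + t * - sin t)) y y0).
      move=> t t0 ty.
      exact: (rderiveB (is_derive_sin t) (rderiveM (rderive_id t) (is_derive_cos t))).
    move=> t t0 ty; have -> : cos t - (1 * cos t + t * - sin t) = t * sin t by ring.
    apply: mulr_ge0; first exact: ltW.
    by apply: sin_ge0_pi; rewrite (ltW t0) /=; have := pi_ge0 R; lra.
  have := ler_wpM2l y0 c1; lra.
have c0 : 0 <= cos y by apply: cos_ge0_pihalf; rewrite y1 andbT; have := pi_ge0 R; lra.
have := cos2Dsin2 y; have : cos y * cos y <= 2^-1 * 2^-1 by rewrite ler_pM// ltW.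
rewrite -expr2 => h1 h2.
rewrite -ler_sqr ?nnegrE//; last by lra.
have : y ^+ 2 <= 2 ^+ 2 by rewrite ler_sqr ?nnegrE.
rewrite exprMn; move: (y ^+ 2) (sin y ^+ 2) (cos y ^+ 2) h1 h2 => a b c; lra.
Qed.

Lemma cos_upper al : 0 <= al -> al <= pi -> 2 * (al / 5) ^+ 2 <= 1 - cos al.
Proof.
move=> a0 a1.
have -> : 1 - cos al = 2 * sin (al / 2) ^+ 2.
  rewrite [in LHS](_ : al = al / 2 + al / 2); last by field.
  by rewrite cosD -!expr2 cos2sin2; ring.
rewrite ler_wpM2l// ler_sqr ?nnegrE; last 2 first.
- by rewrite divr_ge0.
- by apply: sin_ge0_pi; apply/andP; split; lra.
by have := @sin_lower (al / 2) ltac:(lra) ltac:(lra); lra.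
Qed.

Lemma poisson_denE r al : poisson_den r al = (1 - r) ^+ 2 + 2 * r * (1 - cos al).
Proof. by rewrite /poisson_den; ring. Qed.

(** For r <= 1/2 the first term of poisson_denE suffices; for larger r the second
    one is comparable to al^2. *)
Lemma poisson_den_lower r al : 0 <= r -> r < 1 -> 0 <= al -> al <= pi ->
  (1 - r + al) ^+ 2 / 81 <= poisson_den r al.
Proof.
move=> r0 r1 a0 a1; have c := cos_upper a0 a1.
have a4 : al <= 4 by have [/andP[_ h] _] := @pihalf_02_cos_pihalf R; lra.
rewrite poisson_denE ler_pdivrMr//.
have [rh|rh] := lerP r 2^-1.
  have h1 : (1 - r + al) ^+ 2 <= (9 * (1 - r)) ^+ 2.
    by rewrite ler_sqr ?nnegrE; lra.
  have h2 : 0 <= 2 * r * (1 - cos al).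
    by rewrite !mulr_ge0// subr_ge0 cos_le1.
  by rewrite exprMn in h1; lra.
have h2 : 2 * (al / 5) ^+ 2 <= 2 * r * (1 - cos al).
  by rewrite (le_trans c)// ler_peMl ?subr_ge0 ?cos_le1//; lra.
have e1 : (al / 5) ^+ 2 = al ^+ 2 / 25 by field.
have e2 : (1 - r + al) ^+ 2 = 2 * ((1 - r) ^+ 2 + al ^+ 2) - (1 - r - al) ^+ 2 by ring.
rewrite e1 in h2; rewrite e2.
have := sqr_ge0 (1 - r - al); have := sqr_ge0 al; have := sqr_ge0 (1 - r).
move: (2 * r * (1 - cos al)) (al ^+ 2) ((1 - r) ^+ 2) ((1 - r - al) ^+ 2) h2 => X A B D h2.
lra.
Qed.

Lemma poisson_den_gt0 r al : 0 <= r -> r < 1 -> 0 < poisson_den r al.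
Proof.
move=> r0 r1; rewrite poisson_denE ltr_pwDl ?exprn_gt0 ?subr_gt0// !mulr_ge0//.
Qed.

Definition ddpoisson r al : R := 2 * r * (1 - r ^+ 2) *
  (cos al / poisson_den r al ^+ 2 - 4 * (r * sin al ^+ 2) / poisson_den r al ^+ 3).

Lemma is_derive_dpoisson r al : 0 <= r -> r < 1 -> is_derive al 1 (dpoisson r) (ddpoisson r al).
Proof.
move=> r0 r1; have D0 := poisson_den_gt0 al r0 r1.
have dD : is_derive al 1 (poisson_den r) (2 * r * sin al).
  have d := rderiveD (rderiveB (rderive_cst al 1) (rderiveZ (2 * r) (is_derive_cos al)))
    (rderive_cst al (r ^+ 2)).
  by apply: (is_derive_eq d); ring.
have dD2 := rderiveM dD dD.
have n0 : poisson_den r al * poisson_den r al != 0 by rewrite mulf_neq0// gt_eqF.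
have d := rderiveM (rderiveZ (2 * r * (1 - r ^+ 2)) (is_derive_sin al))
  (rderiveV (f := fun t => poisson_den r t * poisson_den r t) n0 dD2).
by apply: (is_derive_eq d); rewrite /ddpoisson; field; rewrite gt_eqF.
Qed.

(** The inequality r sin(al)^2 <= poisson_den absorbs one power of the
    denominator. *)
Lemma ddpoisson_bound r al : 0 <= r -> r < 1 -> `|ddpoisson r al| <= 20 * (1 - r) / poisson_den r al ^+ 2.
Proof.
move=> r0 r1; have D0 := poisson_den_gt0 al r0 r1.
have s2 : r * sin al ^+ 2 <= poisson_den r al.
  rewrite sin2cos2 poisson_denE.
  have -> : 1 - cos al ^+ 2 = (1 - cos al) * (1 + cos al) by ring.
  have c1 : 0 <= 1 - cos al by rewrite subr_ge0 cos_le1.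
  have c2 : 1 + cos al <= 2 by have := cos_le1 al; lra.
  have : r * ((1 - cos al) * (1 + cos al)) <= r * ((1 - cos al) * 2).
    by rewrite !ler_wpM2l.
  have := sqr_ge0 (1 - r); lra.
have s0 : 0 <= r * sin al ^+ 2 by rewrite mulr_ge0// sqr_ge0.
have k1 : `|cos al / poisson_den r al ^+ 2 - 4 * (r * sin al ^+ 2) / poisson_den r al ^+ 3| <= 5 / poisson_den r al ^+ 2.
  rewrite (le_trans (ler_normB _ _))//.
  rewrite (_ : 5 = 1 + 4 :> R); last by ring.
  rewrite [leRHS]mulrDl lerD//.
    rewrite normrM [X in _ * X]ger0_norm ?invr_ge0 ?sqr_ge0// ler_wpM2r ?invr_ge0 ?sqr_ge0//.
    exact: cos_max.
  rewrite ger0_norm; last by apply: divr_ge0; [exact: mulr_ge0|apply: exprn_ge0; exact: ltW].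
  rewrite ler_pdivrMr ?exprn_gt0// (_ : 4 / _ * _ = 4 * poisson_den r al); last by field; rewrite gt_eqF.
  by rewrite ler_wpM2l.
rewrite /ddpoisson normrM (_ : 20 * (1 - r) / _ = (4 * (1 - r)) * (5 / poisson_den r al ^+ 2)); last by field; rewrite gt_eqF.
have r2 : 0 <= 1 - r ^+ 2 by rewrite subr_ge0 exprn_ile1// ltW.
rewrite ler_pM// ger0_norm ?mulr_ge0//.
have -> : 2 * r * (1 - r ^+ 2) = 2 * (1 - r) * (r * (1 + r)) by ring.
have -> : 4 * (1 - r) = 2 * (1 - r) * 2 by ring.
rewrite ler_wpM2l ?mulr_ge0 ?subr_ge0 ?(ltW r1)//.
by rewrite -[leRHS]mul1r ler_pM//; lra.
Qed.

Definition dpoisson_cst : R := 20 * 81 ^+ 2.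

Lemma dpoisson_lipschitz r x y : 0 <= r -> r < 1 -> 0 <= x -> x <= y -> y <= pi ->
  `|dpoisson r x - dpoisson r y| <= dpoisson_cst * (1 - r) * (y - x) / (1 - r + x) ^+ 4.
Proof.
move=> r0 r1 x0; rewrite le_eqVlt => /predU1P[<- _|xy ypi].
  by rewrite !subrr normr0 mulr0 mul0r.
have [||c] := @MVT R (dpoisson r) (ddpoisson r) x y xy.
- by move=> c _; exact: is_derive_dpoisson.
- by apply: derivable_within_continuous => c _; have [] := is_derive_dpoisson c r0 r1.
rewrite in_itv/= => /andP[xc cy] e.
rewrite distrC e normrM (gtr0_norm (x := y - x)) ?subr_gt0//.
rewrite [leRHS]mulrAC ler_wpM2r ?subr_ge0 ?(ltW xy)//.
rewrite (le_trans (ddpoisson_bound c r0 r1))//.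
have d0 : 0 < 1 - r by rewrite subr_gt0.
have dx0 : 0 < 1 - r + x by rewrite ltr_pwDl.
have L : (1 - r + x) ^+ 2 / 81 <= poisson_den r c.
  apply: (le_trans _ (poisson_den_lower r0 r1 (ltW (le_lt_trans x0 xc)) (le_trans (ltW cy) ypi))).
  rewrite ler_wpM2r// ler_sqr ?nnegrE; [lra|lra|].
  have := ltW xc; lra.
have L2 : ((1 - r + x) ^+ 2 / 81) ^+ 2 <= poisson_den r c ^+ 2.
  by rewrite ler_sqr ?nnegrE ?divr_ge0 ?sqr_ge0// ltW// poisson_den_gt0.
rewrite ler_pdivrMr ?exprn_gt0 ?poisson_den_gt0//.
have := ler_wpM2l (_ : 0 <= dpoisson_cst * (1 - r) / (1 - r + x) ^+ 4) L2.
move=> /(_ _)/le_trans h; apply: (le_trans _ (h _ _ _)) => //.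
  rewrite le_eqVlt; apply/orP; left; apply/eqP; rewrite /dpoisson_cst; field.
  by rewrite gt_eqF.
by rewrite divr_ge0 ?mulr_ge0 ?exprn_ge0 ?(ltW d0) ?(ltW dx0)// /dpoisson_cst.
Qed.

Lemma dpoissonN r al : dpoisson r (- al) = - dpoisson r al.
Proof. by rewrite /dpoisson /poisson_den cosN sinN mulrN mulNr. Qed.

Lemma dpoisson_pi r : dpoisson r pi = 0.
Proof. by rewrite /dpoisson sinpi mulr0 mul0r. Qed.

Lemma dpoisson_periodic r al (k : int) : dpoisson r (al + 2 * pi * k%:~R) = dpoisson r al.
Proof.
have P (f : R -> R) : periodic f (pi *+ 2) -> f (al + 2 * pi * k%:~R) = f al.
  move=> Hf; have per n (b : R) : f (b + 2 * pi * n%:R) = f b.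
    elim: n b => [|n IH] b; first by rewrite mulr0 addr0.
    have -> : b + 2 * pi * n.+1%:R = (b + 2 * pi * n%:R) + pi *+ 2.
      by rewrite -[n.+1%:R]natr1 -[pi *+ 2]mulr_natl; ring.
    by rewrite Hf IH.
  case: k => n; first exact: per.
  rewrite NegzE mulrNz mulrN -[LHS](per n.+1); congr f.
  by rewrite -[in RHS](subrK (2 * pi * n.+1%:R) al).
rewrite /dpoisson /poisson_den (P _ (@cosD2pi R)) (P _ (@sinD2pi R))//.
Qed.

Lemma Im_herglotz_angular r al : 0 <= r -> r < 1 ->
  complex.Im (r%:C * cis al * (2 / (1 - r%:C * cis al) ^+ 2)) = dpoisson r al.
Proof.
move=> r0 r1; have D0 := poisson_den_gt0 al r0 r1.
pose w := r%:C * cis al.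
have w1 : cmod w < 1 by rewrite cmodM cmod_cis mulr1 cmod_real ger0_norm.
have nz := one_sub_neq0 w1.
have cD : cmod (1 - w) ^+ 2 = poisson_den r al.
  rewrite cmod_sqr cReD cReN cImD cImN cRe1 cIm1 cReZ cImZ /poisson_den /=.
  have := cos2Dsin2 al; move: (cos al) (sin al) => c s h.
  transitivity (1 - 2 * r * c + r ^+ 2 * (c ^+ 2 + s ^+ 2)); first by ring.
  by rewrite h mulr1.
have -> : r%:C * cis al * (2 / (1 - r%:C * cis al) ^+ 2) =
    (poisson_den r al ^+ 2)^-1%:C * (2 * w * ((1 - w)^*) ^+ 2).
  have -> : (poisson_den r al ^+ 2)^-1%:C = (((1 - w) * (1 - w)^*) ^+ 2)^-1.
    by rewrite -cmod_sqr_conj cD -rmorphXn -fmorphV.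
  rewrite -/w.
  have nz' : (1 - w)^* != 0 by rewrite conjc_eq0.
  by rewrite rmorphB rmorph1 in nz'; field; apply/andP; split; [exact: nz'|exact: nz].
rewrite cImZ /dpoisson mulrC; congr (_ / _).
rewrite /w; have := cos2Dsin2 al; rewrite /cis; move: (cos al) (sin al) => c s h.
transitivity (2 * r * s * (1 - r ^+ 2 * (c ^+ 2 + s ^+ 2))); last by rewrite h mulr1; ring.
rewrite expr2 /=; ring.
Qed.

End PoissonDerivativeKernel.

(** * Arcs of the circle and the modulus of smoothness *)

Section Arcs.
Local Open Scope complex_scope.
Context {R : realType}.
Local Notation T := (measurableTypeR R).
Local Notation leb := (@lebesgue_measure R).
Implicit Types (a b x y : R).

(** Half-open, so that adjacent arcs tile the circle. *)
Definition arc a b : set T := circle_arc (Interval (BSide true a) (BSide true b)).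

Lemma arcP a b th : arc a b th <->
  [/\ 0 <= th, th < 2 * pi & exists k : int, a <= th + 2 * pi * k%:~R /\ th + 2 * pi * k%:~R < b].
Proof.
rewrite /arc /circle_arc /circle /=; split.
  move=> [h [k]]; rewrite in_itv /= => /andP[k1 k2]; move: h; rewrite in_itv /= => /andP[h1 h2].
  by split => //; exists k.
by move=> [h1 h2 [k [k1 k2]]]; split; [rewrite in_itv /= h1|exists k; rewrite in_itv /= k1].
Qed.

Lemma pi2_gt0 : 0 < 2 * pi :> R.
Proof. exact: mulr_gt0 (ltr0n R 2) (pi_gt0 R). Qed.

Lemma angle_representative b : exists k : int, 0 <= b + 2 * pi * k%:~R < 2 * pi.
Proof.
have p := pi2_gt0; pose m := Num.floor (b / (2 * pi)).
exists (- m); have /andP[m1 m2] : m%:~R <= b / (2 * pi) < (m + 1)%:~R := floor_itv _.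
move: m1 m2; rewrite ler_pdivlMr// ltr_pdivrMr// intrD => m1 m2.
rewrite mulrNz mulrN subr_ge0 ltrBlDr; apply/andP; split; first by rewrite mulrC.
by rewrite (lt_le_trans m2)// mulrDl mul1r addrC (mulrC _ m%:~R).
Qed.

Lemma int_eq01 (m : int) : -1 < m%:~R :> R -> m%:~R < 2 :> R -> m = 0 \/ m = 1.
Proof.
rewrite (_ : -1 = (-1)%:~R :> R)// (_ : 2 = 2%:~R :> R)// !ltr_int => h1 h2.
by lia.
Qed.

Lemma arc_shift a b (n : int) : arc (a + 2 * pi * n%:~R) (b + 2 * pi * n%:~R) = arc a b.
Proof.
apply/seteqP; split=> th /arcP[h1 h2 [k [k1 k2]]]; apply/arcP; split => //.
  exists (k - n); have e : 2 * pi * (k - n)%:~R = 2 * pi * k%:~R - 2 * pi * n%:~R :> R.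
    by rewrite intrB mulrBr.
  by rewrite e; split; lra.
exists (k + n); have e : 2 * pi * (k + n)%:~R = 2 * pi * k%:~R + 2 * pi * n%:~R :> R.
  by rewrite intrD mulrDr.
by rewrite e; split; lra.
Qed.

(** An arc of length at most 2 pi that starts in [0, 2 pi[ wraps around at most
    once. *)
Lemma arc_pieces a L : 0 <= a -> a < 2 * pi -> 0 <= L -> L <= 2 * pi ->
  arc a (a + L) = (`[a, Num.min (a + L) (2 * pi)[%classic `|` `[0, a + L - 2 * pi[%classic : set T).
Proof.
move=> a0 a2 L0 L2; have p := pi2_gt0; apply/seteqP; split=> th.
  move=> /arcP[h1 h2 [k [k1 k2]]].
  have [||k0|k0] := @int_eq01 k.
  - rewrite -(ltr_pM2l p); lra.
  - rewrite -(ltr_pM2l p); lra.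
  - left; rewrite /= in_itv /= lt_min h2 andbT; move: k1 k2; rewrite k0 mulr0 addr0.
    by move=> -> ->.
  - right; rewrite /= in_itv /= h1 /=; move: k2; rewrite k0 mulr1; lra.
case; rewrite /= in_itv /=.
  rewrite lt_min => /and3P[h1 h2 h3]; apply/arcP; split => //; first exact: le_trans h1.
  by exists 0; rewrite mulr0 addr0.
move=> /andP[h1 h2]; apply/arcP; split => //; first by lra.
exists 1; rewrite mulr1; split; lra.
Qed.

Lemma leb_arc_itv a b : leb (`[a, b[%classic : set T) = (Num.max 0 (b - a))%:E.
Proof.
rewrite lebesgue_measure_itv /= lte_fin; case: ltP => ab; rewrite -?EFinB; congr EFin.
  by rewrite max_r// subr_ge0 ltW.
by rewrite max_l// subr_le0.
Qed.

Lemma arc_measurable_length a b : a <= b -> b <= a + 2 * pi ->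
  measurable (arc a b) /\ leb (arc a b) = (b - a)%:E.
Proof.
move=> ab ba; have [k /andP[k0 k1]] := angle_representative a.
set a' := a + _ in k0 k1; pose L := b - a.
have L0 : 0 <= L by rewrite subr_ge0.
have L2 : L <= 2 * pi by rewrite lerBlDl.
rewrite -(arc_shift a b k) -/a'.
rewrite (_ : b + 2 * pi * k%:~R = a' + L); last by rewrite /a' /L; ring.
rewrite arc_pieces// -/L; set A := (X in X `|` _); set B := (X in _ `|` X).
have mA : measurable A by exact: measurable_itv.
have mB : measurable B by exact: measurable_itv.
split; first exact: measurableU.
rewrite measureU//.
  rewrite [X in (X + _)%E]leb_arc_itv [X in (_ + X)%E]leb_arc_itv -EFinD; congr EFin.
  rewrite subr0; have [h|h] := leP (a' + L) (2 * pi).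
    rewrite (max_l (_ : a' + L - 2 * pi <= 0)) ?subr_le0// addr0 max_r; lra.
  rewrite (max_r (_ : 0 <= a' + L - 2 * pi)) ?subr_ge0 ?(ltW h)// max_r; lra.
apply/seteqP; split=> th // -[]; rewrite /A /B /= !in_itv /= => /andP[h1 _] /andP[_ h2].
by have : L <= 2 * pi := L2; lra.
Qed.

End Arcs.

Section SmoothMeasures.
Local Open Scope complex_scope.
Context {R : realType}.
Local Notation T := (measurableTypeR R).
Local Notation leb := (@lebesgue_measure R).
Context (mu : {finite_measure set T -> \bar R}) (C : R).
Context (C0 : 0 < C).
Context (mu_smooth : forall t : R, 0 < t -> t < 1 ->
  (modulus_of_smoothness mu t <= (C * (t / Num.sqrt (ln (expR 1 / t))))%:E)%E).
Implicit Types (x ph r : R).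

Definition arc_mass a b : R := fine (mu (arc a b)).

Definition arc_defect ph x : R := arc_mass (ph - x) ph - arc_mass ph (ph + x).

Lemma arc_circle a b : arc a b `<=` @circle R.
Proof. by move=> th []. Qed.

Lemma arc_mass_ge0 a b : 0 <= arc_mass a b.
Proof. exact: fine_ge0. Qed.

Lemma arc_mass_le_mass a b : a <= b -> b <= a + 2 * pi -> arc_mass a b <= mass mu.
Proof.
move=> ab ba; have [mA _] := arc_measurable_length ab ba.
rewrite /arc_mass /mass fine_le ?fin_num_measure//; first exact: measurable_circle.
by apply: le_measure; rewrite ?inE//; [exact: measurable_circle|exact: arc_circle].
Qed.

Lemma arc_defect_smooth ph x : 0 < x -> x < 1 ->
  `|arc_defect ph x| <= C * (x / Num.sqrt (1 - ln x)).
Proof.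
move=> x0 x1; have p : 2 <= 2 * pi :> R by have := pi_ge2 R; lra.
have [mI lI] := @arc_measurable_length _ (ph - x) ph ltac:(lra) ltac:(lra).
have [mJ lJ] := @arc_measurable_length _ ph (ph + x) ltac:(lra) ltac:(lra).
have -> : 1 - ln x = ln (expR 1 / x) by rewrite ln_div ?posrE ?expR_gt0// expRK.
rewrite -lee_fin; apply: (le_trans _ (mu_smooth x0 x1)).
apply: ereal_sup_ubound; exists (arc (ph - x) ph), (arc ph (ph + x)); split.
- exists (ph - x), ph, (ph + x), true, true, true; split => //; lra.
- by rewrite lI lJ; congr EFin; ring.
- by rewrite lI lee_fin; lra.
have fI : mu (arc (ph - x) ph) = (arc_mass (ph - x) ph)%:E by rewrite /arc_mass fineK// fin_num_measure.
have fJ : mu (arc ph (ph + x)) = (arc_mass ph (ph + x))%:E by rewrite /arc_mass fineK// fin_num_measure.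
by rewrite fI fJ.
Qed.

Lemma arc_defect_mass ph x : 0 <= x -> x <= pi -> `|arc_defect ph x| <= mass mu.
Proof.
move=> x0 x1; have := arc_mass_ge0 (ph - x) ph; have := arc_mass_ge0 ph (ph + x).
have := @arc_mass_le_mass (ph - x) ph ltac:(lra) ltac:(lra).
have := @arc_mass_le_mass ph (ph + x) ltac:(lra) ltac:(lra).
rewrite /arc_defect; move: (arc_mass _ _) (arc_mass _ _) (mass mu) => A B D h1 h2 h3 h4.
by rewrite ler_norml; apply/andP; split; lra.
Qed.

Lemma ln_le_id x : 0 < x -> ln x <= x.
Proof.
move=> x0; have := @le_ln1Dx R (x - 1) ltac:(lra).
by rewrite addrC subrK; lra.
Qed.

(** The logarithm at the scale x is traded for the logarithm at the fixed scale
    1 - r; the loss x / (1 - r) is absorbed by the decay of the kernel. For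
    x >= 1 the total mass is bound enough. *)
Lemma arc_defect_bound ph x r : 0 <= r -> r < 1 -> 0 < x -> x <= pi ->
  `|arc_defect ph x| <= 2 * (C + mass mu) * (x + x ^+ 2 / (1 - r)) / Num.sqrt (Lam r).
Proof.
move=> r0 r1 x0 xpi; set d := 1 - r.
have d0 : 0 < d by rewrite /d subr_gt0.
have d1 : d <= 1 by rewrite /d; lra.
have l0 := Lam_gt0 r0; have sl0 : 0 < Num.sqrt (Lam r) by rewrite sqrtr_gt0.
have m0 := mass_ge0 mu; have C0' := ltW C0.
rewrite ler_pdivlMr//; set y := x / d.
have y0 : 0 < y by rewrite divr_gt0.
have -> : x + x ^+ 2 / d = x * (1 + y) by rewrite /y; field; rewrite gt_eqF.
have sq_le (k : R) : 0 <= k -> Lam r <= k ^+ 2 -> Num.sqrt (Lam r) <= k.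
  by move=> k0 h; rewrite -(ger0_norm k0) -sqrtr_sqr ler_sqrt// sqr_ge0.
have [x1|x1] := ltP x 1.
  have lx : 1 <= 1 - ln x by rewrite lerBrDr gerDl ln_le0// ltW.
  have lx0 : 0 < 1 - ln x := lt_le_trans ltr01 lx.
  have slx : 0 < Num.sqrt (1 - ln x) by rewrite sqrtr_gt0.
  have k : Num.sqrt (Lam r) <= 2 * (1 + y) * Num.sqrt (1 - ln x).
    apply: sq_le; first by rewrite !mulr_ge0// ?addr_ge0 ?ltW.
    rewrite !exprMn sqr_sqrtr ?(ltW lx0)//.
    have -> : Lam r = 2 - ln x + ln y by rewrite /Lam -/d /y ln_div ?posrE//; ring.
    have h := ln_le_id y0.
    have h2 : y <= y * (1 - ln x) by rewrite ler_peMr// ltW.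
    have h3 : (2 + y) * (1 - ln x) <= 2 ^+ 2 * (1 + y) ^+ 2 * (1 - ln x).
      by rewrite ler_wpM2r ?(ltW lx0)//; have := sqr_ge0 y; rewrite sqrrD1 mulr2n; lra.
    have -> : 2 - ln x + ln y = 1 + (1 - ln x) + ln y by ring.
    rewrite mulrDl in h3; lra.
  apply: (le_trans (ler_wpM2r (ltW sl0) (arc_defect_smooth ph x0 x1))).
  rewrite mulrA mulrAC ler_pdivrMr//.
  apply: (@le_trans _ _ (C * x * (2 * (1 + y) * Num.sqrt (1 - ln x)))).
    by rewrite ler_wpM2l ?mulr_ge0// ltW.
  have -> : C * x * (2 * (1 + y) * Num.sqrt (1 - ln x)) =
    2 * C * (x * (1 + y)) * Num.sqrt (1 - ln x) by ring.
  rewrite ler_wpM2r ?(ltW slx)// ler_wpM2r ?mulr_ge0 ?addr_ge0 ?(ltW x0) ?(ltW y0)//.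
  by rewrite ler_wpM2l// lerDl.
have k : Num.sqrt (Lam r) <= 2 * (x * (1 + y)).
  apply: (@le_trans _ _ (2 / d)).
    apply: sq_le; first by rewrite divr_ge0// ltW.
    have id : 1 <= d^-1 by rewrite invf_ge1.
    have := ln_le_id (_ : 0 < d^-1); rewrite invr_gt0 => /(_ d0).
    rewrite lnV ?posrE// => h; rewrite /Lam -/d exprMn.
    have : d^-1 * 1 <= d^-1 * d^-1 by rewrite ler_wpM2l// invr_ge0 ltW.
    rewrite -expr2; lra.
  rewrite ler_wpM2l// /y mulrDr mulr1 mulrA -expr2.
  have : 1 / d <= x ^+ 2 / d by rewrite ler_wpM2r ?invr_ge0 ?(ltW d0)// exprn_ege1.
  rewrite mul1r; lra.
apply: (le_trans (ler_wpM2r (ltW sl0) (arc_defect_mass ph (ltW x0) xpi))).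
apply: (le_trans (ler_wpM2l m0 k)); rewrite mulrCA -mulrA ler_wpM2l//.
by rewrite ler_wpM2r ?mulr_ge0 ?addr_ge0 ?(ltW x0) ?(ltW y0)// lerDr.
Qed.

Lemma rint_indic a b : a <= b -> b <= a + 2 * pi ->
  bmeas (fun th => \1_(arc a b) th) /\ rint mu (fun th => \1_(arc a b) th) = arc_mass a b.
Proof.
move=> ab ba; have [mA _] := arc_measurable_length ab ba; split.
  split; first exact: measurable_indic.
  by exists 1 => th; rewrite indicE; case: (_ \in _); rewrite ?normr1 ?normr0.
rewrite /rint /Rintegral integral_indic//; last exact: measurable_circle.
by rewrite setIidl//; exact: arc_circle.
Qed.

Lemma rint_sum n (f : nat -> R -> R) : (forall i, bmeas (f i)) ->
  bmeas (fun th => \sum_(i < n) f i th) /\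
  rint mu (fun th => \sum_(i < n) f i th) = \sum_(i < n) rint mu (f i).
Proof.
move=> Hf; elim: n => [|n [IH1 IH2]].
  rewrite big_ord0; under [X in bmeas X]eq_fun do rewrite big_ord0.
  under [X in rint mu X]eq_fun do rewrite big_ord0.
  split; first exact: bmeas_cst.
  by rewrite /rint Rintegral_cst ?mul0r//; exact: measurable_circle.
have e : (fun th => \sum_(i < n.+1) f i th) = (fun th => \sum_(i < n) f i th + f n th).
  by apply/funext => th; rewrite big_ord_recr.
by rewrite e rintD// IH2 [in RHS]big_ord_recr; split => //; exact: bmeasD.
Qed.

End SmoothMeasures.

Section AbelSummation.
Local Open Scope complex_scope.
Context {R : realType}.

Lemma abel_step (v : nat -> R) (P : nat -> bool) m j : (j <= m)%N ->
  (forall i, (i < m)%N -> P i = (j <= i)%N) ->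
  \sum_(i < m) (v i - v i.+1) * (P i)%:R = v j - v m.
Proof.
move=> jm HP; rewrite -(big_mkord xpredT (fun i => (v i - v i.+1) * (P i)%:R)).
rewrite (big_cat_nat (leq0n j) jm)//= big_nat_cond big1 ?add0r; last first.
  by move=> i /andP[/andP[_ ij] _]; rewrite HP ?(leq_trans ij)// leqNgt ij mulr0.
rewrite (eq_big_nat _ _ (F2 := fun i => - (v i.+1 - v i))).
  by rewrite sumrN telescope_sumr// opprB.
by move=> i /andP[ji im]; rewrite HP// ji mulr1 opprB.
Qed.

(** Abel summation: the jumps of v over the grid points that pass a monotone test
    recover the value of v at the first of them. This is how a kernel becomes a
    combination of indicators of arcs. *)
Lemma abel_grid (v : nat -> R) (P : nat -> bool) m :
  (forall i, P i -> P i.+1) -> P m ->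
  exists j, [/\ (j <= m)%N, P j, (forall i, (i < j)%N -> ~~ P i) &
    \sum_(i < m) (v i - v i.+1) * (P i)%:R = v j - v m].
Proof.
move=> Pmono Pm; have ex : exists n, P n by exists m.
case: (ex_minnP ex) => j Pj min; exists j; split => //; first exact: min.
  by move=> i ij; apply/negP => /min; rewrite leqNgt ij.
apply: abel_step; first exact: min.
move=> i _; apply/idP/idP; first exact: min.
move=> ji; rewrite -(subnKC ji); elim: (i - j)%N => [|k IH]; first by rewrite addn0.
by rewrite addnS; exact: Pmono.
Qed.

End AbelSummation.

(** * Growth of the derivative of the Herglotz transform *)

Section DerivativeBound.
Local Open Scope complex_scope.
Context {R : realType}.
Local Notation T := (measurableTypeR R).
Context (mu : {finite_measure set T -> \bar R}) (C : R).
Context (C0 : 0 < C).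
Context (mu_smooth : forall t : R, 0 < t -> t < 1 ->
  (modulus_of_smoothness mu t <= (C * (t / Num.sqrt (ln (expR 1 / t))))%:E)%E).
Implicit Types (x ph r : R) (z w : R[i]).

Lemma int_eq0 (m : int) : -1 < m%:~R :> R -> m%:~R < 1 :> R -> m = 0.
Proof.
rewrite (_ : -1 = (-1)%:~R :> R)// (_ : 1 = 1%:~R :> R)// !ltr_int => h1 h2.
by lia.
Qed.

Lemma bmeas_dpoisson r ph : 0 <= r -> r < 1 -> bmeas (fun th => dpoisson r (ph - th)).
Proof.
move=> r0 r1; split.
  apply: (@measurableT_comp _ _ _ T T T (dpoisson r) setT (fun th => ph - th : T)).
    apply: continuous_measurable_fun => al; apply: differentiable_continuous.
    by apply/derivable1_diffP; have [] := is_derive_dpoisson al r0 r1.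
  by apply: measurable_funB => //; exact: measurable_cst.
have d0 : 0 < 1 - r by rewrite subr_gt0.
exists (2 / (1 - r) ^+ 4) => th; rewrite /dpoisson; set al := ph - th.
have D0 := poisson_den_gt0 al r0 r1.
have r2 : 0 <= 1 - r ^+ 2 by rewrite subr_ge0 exprn_ile1// ltW.
have r2' : 1 - r ^+ 2 <= 1 by rewrite lerBlDr lerDl sqr_ge0.
rewrite !normrM (ger0_norm r0) (ger0_norm r2) (ger0_norm (ler0n _ 2)).
rewrite [X in _ * X]ger0_norm ?invr_ge0 ?sqr_ge0// ler_pM ?mulr_ge0 ?invr_ge0 ?sqr_ge0//.
  rewrite -[leRHS]mulr1 ler_pM ?mulr_ge0//; last exact: sin_max.
  rewrite -[leRHS]mulr1 ler_pM ?mulr_ge0//.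
  by rewrite ler_piMr// ltW.
rewrite lef_pV2 ?posrE ?exprn_gt0//.
rewrite (_ : 4%N = (2 * 2)%N)// exprM ler_sqr ?nnegrE ?sqr_ge0 ?(ltW D0)//.
by rewrite poisson_denE lerDl !mulr_ge0// subr_ge0 cos_le1.
Qed.

Definition angular_cst : R := dpoisson_cst * (2 * (C + mass mu)).

Lemma angular_cst_ge0 : 0 <= angular_cst.
Proof.
rewrite /angular_cst /dpoisson_cst !mulr_ge0 ?addr_ge0 ?(ltW C0) ?mass_ge0//.
Qed.

Section Discretization.
Context (r ph : R) (r0 : 0 <= r) (r1 : r < 1) (m : nat).

Let h : R := pi / m.+1%:R.
Let xg (i : nat) : R := i%:R * h.
Let v (i : nat) : R := dpoisson r (xg i.+1).
Let d : R := 1 - r.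
Let Lq : R := dpoisson_cst * d / d ^+ 4.
Let Iarc i := arc (ph - xg i.+1) ph.
Let Jarc i := arc ph (ph + xg i.+1).
(** A step function close to the kernel: the jumps of the kernel over the grid
    weigh differences of indicators of adjacent arcs of equal length. *)
Let Q th := \sum_(i < m) (v i - v i.+1) * (\1_(Iarc i) th - \1_(Jarc i) th).

Let d0 : 0 < d. Proof. by rewrite /d subr_gt0. Qed.
Let h0 : 0 < h. Proof. by rewrite /h divr_gt0 ?pi_gt0. Qed.
Let xg0 i : 0 <= xg i. Proof. by rewrite /xg mulr_ge0// ltW. Qed.
Let xgS i : xg i.+1 = xg i + h. Proof. by rewrite /xg -natr1 mulrDl mul1r. Qed.
Let xgm : xg m.+1 = pi. Proof. by rewrite /xg /h mulrC divfK. Qed.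
Let xg_mono i j : (i <= j)%N -> xg i <= xg j.
Proof. by move=> ij; rewrite /xg ler_pM2r// ler_nat. Qed.
Let xg_pi i : (i <= m.+1)%N -> xg i <= pi.
Proof. by move=> im; rewrite -xgm; exact: xg_mono. Qed.
Let dpoisson_cst_ge0 : 0 <= dpoisson_cst :> R. Proof. by rewrite /dpoisson_cst. Qed.
Let vm : v m = 0. Proof. by rewrite /v xgm dpoisson_pi. Qed.

Let lip x y : 0 <= x -> x <= y -> y <= pi -> `|dpoisson r x - dpoisson r y| <= Lq * (y - x).
Proof.
move=> x0 xy ypi; rewrite (le_trans (dpoisson_lipschitz r0 r1 x0 xy ypi))//.
rewrite -/d /Lq mulrAC ler_wpM2r ?subr_ge0// ler_wpM2l ?mulr_ge0 ?(ltW d0)//.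
have dx : 0 < d + x by rewrite ltr_pwDl.
rewrite lef_pV2 ?posrE ?exprn_gt0//.
by apply: lerXn2r; rewrite ?nnegrE ?(ltW d0) ?(ltW dx)// lerDl.
Qed.

Let near_grid s j : 0 <= s -> (j <= m)%N -> s <= xg j.+1 -> (j = 0%N \/ xg j <= s) ->
  `|v j - dpoisson r s| <= Lq * h.
Proof.
move=> s0 jm sx sj; rewrite distrC (le_trans (lip s0 sx (xg_pi _)))//.
rewrite ler_wpM2l ?divr_ge0 ?mulr_ge0 ?exprn_ge0 ?(ltW d0)//.
rewrite xgS; case: sj => [->|sj]; first by rewrite /xg mul0r; lra.
by lra.
Qed.

Let angle th : exists2 k : int, - pi < ph - (th + 2 * pi * k%:~R) & ph - (th + 2 * pi * k%:~R) <= pi.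
Proof.
have [k /andP[k0 k1]] := angle_representative (th - ph + pi).
exists k; lra.
Qed.

Let IarcE th k i : @circle R th -> (i < m)%N ->
  - pi < ph - (th + 2 * pi * k%:~R) -> ph - (th + 2 * pi * k%:~R) <= pi ->
  (\1_(Iarc i) th : R) = (0 < ph - (th + 2 * pi * k%:~R) <= xg i.+1)%R%:R.
Proof.
rewrite /circle /= in_itv /= => /andP[t0 t1] im a1 a2.
have xp : xg i.+1 <= pi by apply: xg_pi; exact: leqW.
rewrite indicE; congr (nat_of_bool _)%:R; apply/idP/idP.
  rewrite inE => /arcP[_ _ [k' [k1 k2]]].
  suff e : k' = k by rewrite e in k1 k2; apply/andP; split; lra.
  have p := @pi2_gt0 R.
  have : -1 < (k' - k)%:~R :> R by rewrite -(ltr_pM2l p) intrB; lra.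
  have : (k' - k)%:~R < 1 :> R by rewrite -(ltr_pM2l p) intrB; lra.
  by move=> c1 c2; apply: subr0_eq; exact: int_eq0 c2 c1.
move=> /andP[b1 b2]; rewrite inE; apply/arcP; split => //; exists k; split; lra.
Qed.

Let JarcE th k i : @circle R th -> (i < m)%N ->
  - pi < ph - (th + 2 * pi * k%:~R) -> ph - (th + 2 * pi * k%:~R) <= pi ->
  (\1_(Jarc i) th : R) = (0 <= - (ph - (th + 2 * pi * k%:~R)) < xg i.+1)%R%:R.
Proof.
rewrite /circle /= in_itv /= => /andP[t0 t1] im a1 a2.
have xp : xg i.+1 <= pi by apply: xg_pi; exact: leqW.
rewrite indicE; congr (nat_of_bool _)%:R; apply/idP/idP.
  rewrite inE => /arcP[_ _ [k' [k1 k2]]].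
  suff e : k' = k by rewrite e in k1 k2; apply/andP; split; lra.
  have p := @pi2_gt0 R.
  have : -1 < (k' - k)%:~R :> R by rewrite -(ltr_pM2l p) intrB; lra.
  have : (k' - k)%:~R < 1 :> R by rewrite -(ltr_pM2l p) intrB; lra.
  by move=> c1 c2; apply: subr0_eq; exact: int_eq0 c2 c1.
move=> /andP[b1 b2]; rewrite inE; apply/arcP; split => //; exists k; split; lra.
Qed.

Let Q_near th : @circle R th -> `|Q th - dpoisson r (ph - th)| <= Lq * h.
Proof.
move=> ct; have [k a1 a2] := angle th.
pose al := ph - (th + 2 * pi * k%:~R).
have -> : dpoisson r (ph - th) = dpoisson r al.
  rewrite -(dpoisson_periodic r al k); congr dpoisson; rewrite /al; ring.
have QE : Q th = \sum_(i < m) (v i - v i.+1) *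
    ((0 < al <= xg i.+1)%R%:R - (0 <= - al < xg i.+1)%R%:R).
  by rewrite /Q; apply: eq_bigr => i _; rewrite (IarcE ct (ltn_ord i) a1 a2) (JarcE ct (ltn_ord i) a1 a2).
have [al0|al0] := ltP 0 al.
  pose P i := al <= xg i.+1.
  have [||j [jm Pj nPj S]] := @abel_grid R v P m.
  - by move=> i /le_trans; apply; exact: xg_mono.
  - by rewrite /P xgm.
  have -> : Q th = v j.
    rewrite QE; transitivity (v j - v m); last by rewrite vm subr0.
    rewrite -S; apply: eq_bigr => i _; rewrite al0 /=.
    by rewrite [X in X && _]leNgt oppr_lt0 al0 /= subr0.
  apply: near_grid => //; first exact: ltW.
  case: j nPj {jm Pj S} => [|j] nPj; first by left.
  by right; have := nPj j (ltnSn j); rewrite /P -ltNge => /ltW.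
pose P i := - al < xg i.+1.
have [||j [jm Pj nPj S]] := @abel_grid R v P m.
- by move=> i /lt_le_trans; apply; exact: xg_mono.
- by rewrite /P xgm ltrNl.
have -> : Q th = - v j.
  rewrite QE; transitivity (- (v j - v m)); last by rewrite vm subr0.
  rewrite -S -sumrN; apply: eq_bigr => i _.
  by rewrite ltNge al0 /= oppr_ge0 al0 /= sub0r mulrN.
rewrite -[al]opprK dpoissonN -opprD normrN.
apply: near_grid => //; [by rewrite oppr_ge0|exact: ltW|].
case: j nPj {jm Pj S} => [|j] nPj; first by left.
by right; have := nPj j (ltnSn j); rewrite /P -leNgt.
Qed.

Let bmeas_Qi i : (i < m)%N ->
  bmeas (fun th => (v i - v i.+1) * (\1_(Iarc i) th - \1_(Jarc i) th)) /\
  rint mu (fun th => (v i - v i.+1) * (\1_(Iarc i) th - \1_(Jarc i) th)) =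
  (v i - v i.+1) * arc_defect mu ph (xg i.+1).
Proof.
move=> im; have x1 := xg_pi (leqW im : (i.+1 <= m.+1)%N); have x0 := xg0 i.+1.
have [bI eI] := @rint_indic R mu (ph - xg i.+1) ph ltac:(lra) ltac:(lra).
have [bJ eJ] := @rint_indic R mu ph (ph + xg i.+1) ltac:(lra) ltac:(lra).
split; first by apply: bmeasZ; exact: bmeasB.
by rewrite rintZ ?rintB ?eI ?eJ//; exact: bmeasB.
Qed.

(** Smoothness of mu bounds the arc defect and the Lipschitz estimate bounds the
    jump; the product is dominated by a telescoping difference. *)
Let term_bound i : (i < m)%N ->
  `|(v i - v i.+1) * arc_defect mu ph (xg i.+1)| <=
  angular_cst / Num.sqrt (Lam r) * ((d + xg i)^-1 - (d + xg i.+1)^-1).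
Proof.
move=> im; set x := xg i.+1.
have x0 : 0 < x by rewrite /x xgS ltr_wpDl.
have dx0 : 0 < d + x by rewrite addr_gt0.
have dx0' : 0 < d + xg i by rewrite ltr_pwDl.
have sl0 : 0 < Num.sqrt (Lam r) by rewrite sqrtr_gt0 Lam_gt0.
have l1 : `|v i - v i.+1| <= dpoisson_cst * d * h / (d + x) ^+ 4.
  have := dpoisson_lipschitz r0 r1 (ltW x0) (xg_mono (leqnSn i.+1)) (xg_pi _).
  rewrite /v -/x -/d => /(_ im); rewrite [xg i.+2]xgS -/x addrAC subrr add0r; exact.
have l2 := arc_defect_bound C0 mu_smooth ph r0 r1 x0 (xg_pi (leqW im)).
rewrite -/d -/x in l2.
rewrite normrM (le_trans (ler_pM _ _ l1 l2))//.
have -> : dpoisson_cst * d * h / (d + x) ^+ 4 * (2 * (C + mass mu) * (x + x ^+ 2 / d) / Num.sqrt (Lam r)) =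
    angular_cst / Num.sqrt (Lam r) * (h * x / (d + x) ^+ 3).
  by rewrite /angular_cst; field; rewrite !gt_eqF.
rewrite ler_wpM2l ?divr_ge0 ?angular_cst_ge0 ?(ltW sl0)//.
have -> : (d + xg i)^-1 - (d + x)^-1 = h / ((d + xg i) * (d + x)).
  have -> : h = (d + x) - (d + xg i) by rewrite /x xgS; ring.
  by field; rewrite !gt_eqF.
have -> : h * x / (d + x) ^+ 3 = h * (x / (d + x) ^+ 3) by ring.
rewrite ler_wpM2l ?(ltW h0)//.
rewrite ler_pdivrMr ?exprn_gt0// mulrC ler_pdivlMr ?mulr_gt0//.
have -> : (d + x) ^+ 3 = (d + x) * (d + x) * (d + x) by rewrite !exprS expr0 mulr1 mulrA.
rewrite mulrA; apply: ler_wpM2r; first exact: ltW.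
have xi : xg i <= x := xg_mono (leqnSn i).
by apply: ler_pM; rewrite ?(ltW x0) ?(ltW dx0')//; [rewrite lerDr ltW|rewrite lerD2l].
Qed.

Lemma kernel_integral_discrete :
  `|rint mu (fun th => dpoisson r (ph - th))| <= angular_cst * beta r + Lq * h * mass mu.
Proof.
pose f (i : nat) : R -> R := if (i < m)%N
  then fun th => (v i - v i.+1) * (\1_(Iarc i) th - \1_(Jarc i) th) else fun=> 0.
have bf i : bmeas (f i).
  rewrite /f; case: ifP => im; last exact: bmeas_cst.
  exact: (bmeas_Qi im).1.
have [bS eS] := rint_sum mu m bf.
have QE : Q = (fun th => \sum_(i < m) f i th).
  by apply/funext => th; apply: eq_bigr => i _; rewrite /f ltn_ord.
have bQ : bmeas Q by rewrite QE.
have b1 : `|rint mu Q| <= angular_cst * beta r.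
  rewrite QE eS (le_trans (ler_norm_sum _ _ _))//.
  apply: (@le_trans _ _ (\sum_(i < m) angular_cst / Num.sqrt (Lam r) * ((d + xg i)^-1 - (d + xg i.+1)^-1))).
    apply: ler_sum => i _; have := term_bound (ltn_ord i).
    by rewrite -(bmeas_Qi (ltn_ord i)).2 /f ltn_ord.
  rewrite -mulr_sumr.
  rewrite -(big_mkord xpredT (fun i => (d + xg i)^-1 - (d + xg i.+1)^-1)).
  rewrite (eq_big_nat _ _ (F2 := fun i => - ((d + xg i.+1)^-1 - (d + xg i)^-1))); last first.
    by move=> i _; rewrite opprB.
  rewrite sumrN telescope_sumr// opprB /beta invfM -/d.
  have -> : angular_cst * (d^-1 / Num.sqrt (Lam r)) = angular_cst / Num.sqrt (Lam r) * d^-1.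
    by rewrite mulrA mulrAC.
  apply: ler_wpM2l.
    by rewrite divr_ge0 ?angular_cst_ge0 ?sqrtr_ge0.
  have x00 : xg 0%N = 0 by rewrite /xg mul0r.
  by rewrite x00 addr0 lerBlDr lerDl invr_ge0 addr_ge0 ?(ltW d0) ?xg0.
have b2 : `|rint mu (fun th => Q th - dpoisson r (ph - th))| <= Lq * h * mass mu.
  apply: rint_bound; last exact: Q_near.
  by apply: bmeasB => //; exact: bmeas_dpoisson.
move: b2; rewrite rintB//; last exact: bmeas_dpoisson.
move: b1; move: (rint mu Q) (rint mu (fun th => dpoisson r (ph - th))) => A B b1 b2.
rewrite (_ : B = A - (A - B)); last by ring.
by rewrite (le_trans (ler_normB _ _))// lerD.
Qed.

End Discretization.

(** The mesh of the grid tends to 0. *)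
Lemma kernel_integral_bound r ph : 0 <= r -> r < 1 ->
  `|rint mu (fun th => dpoisson r (ph - th))| <= angular_cst * beta r.
Proof.
move=> r0 r1; have d0 : 0 < 1 - r by rewrite subr_gt0.
apply/ler_addgt0Pl => e e0.
pose L := dpoisson_cst * (1 - r) / (1 - r) ^+ 4 * pi * mass mu.
have L0 : 0 <= L.
  by rewrite /L !mulr_ge0 ?invr_ge0 ?exprn_ge0 ?pi_ge0 ?mass_ge0 ?(ltW d0).
have Le : 0 <= L / e by rewrite divr_ge0// ltW.
pose m := Num.bound (L / e).
have := kernel_integral_discrete ph r0 r1 m => /le_trans; apply.
rewrite addrC lerD2r.
have -> : dpoisson_cst * (1 - r) / (1 - r) ^+ 4 * (pi / m.+1%:R) * mass mu = L / m.+1%:R.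
  by rewrite /L; ring.
rewrite ler_pdivrMr ?ltr0n// mulrC -ler_pdivrMr//.
by rewrite (le_trans (ltW (archi_boundP Le)))// ler_nat leqnSn.
Qed.

Lemma polar z : exists ph : R, z = (cmod z)%:C * cis ph.
Proof.
have [->|z0] := eqVneq z 0; first by exists 0; rewrite cmod0 mul0r.
have m0 := cmod_gt0 z0.
pose x := complex.Re z / cmod z; pose y := complex.Im z / cmod z.
have xy : x ^+ 2 + y ^+ 2 = 1.
  rewrite /x /y !expr_div_n -mulrDl -cmod_sqr mulfV//.
  by rewrite expf_neq0// gt_eqF.
have x1 : -1 <= x <= 1.
  rewrite -ler_norml -(@ler_pXn2r _ 2)// ?nnegrE// expr1n real_normK ?num_real//.
  by rewrite -xy lerDl sqr_ge0.
have zE c s : c = x -> s = y -> z = (cmod z)%:C * (c +i* s).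
  move=> -> ->; apply/eqP; rewrite eq_complex !cReZ !cImZ /= /x /y.
  have m1 : cmod z != 0 by rewrite gt_eqF.
  by apply/andP; split; apply/eqP; rewrite mulrC divfK.
have sa : sin (acos x) ^+ 2 = y ^+ 2.
  by rewrite sin2cos2 acosK ?in_itv//; rewrite -xy addrAC subrr add0r.
have : sin (acos x) = y \/ sin (acos x) = - y.
  by move/eqP: sa; rewrite eqf_sqr => /orP[/eqP|/eqP]; [left|right].
case=> e; [exists (acos x)|exists (- acos x)]; apply: zE.
- by rewrite acosK ?in_itv.
- exact: e.
- by rewrite cosN acosK ?in_itv.
- by rewrite sinN e opprK.
Qed.

(** The imaginary part is, up to sign, the angular derivative of the Poisson
    integral of mu. *)
Lemma Im_angular_bound z : cmod z < 1 ->
  `|complex.Im (pval (fun n => n%:R * Fcoef mu n) z)| <= angular_cst * beta (cmod z).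
Proof.
move=> z1; have Hh := @rad1_herglotz R.
have [ph zE] := polar z.
have -> : (fun n => n%:R * Fcoef mu n) = (fun n => (n%:R * herglotz n) * moment mu n).
  by apply/funext => n; rewrite /Fcoef mulrA.
rewrite -cint_pval//; last exact: rad1_nat.
rewrite cintE /=.
have -> : rint mu (fun x => complex.Im (pval (fun n => n%:R * herglotz n) (z * cis (- x)))) =
    rint mu (fun th => dpoisson (cmod z) (ph - th)).
  apply: eq_Rintegral => th _.
  have w1 : cmod (z * cis (- th)) < 1 by rewrite cmodM cmod_cis mulr1.
  rewrite pval_nat// pval_pder_herglotz//.
  have -> : z * cis (- th) = (cmod z)%:C * cis (ph - th) by rewrite {1}zE -mulrA -cisD.
  by rewrite Im_herglotz_angular ?cmod_ge0.
exact: kernel_integral_bound (cmod_ge0 z) z1.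
Qed.

Lemma beta_mono x y : 0 <= x -> x <= y -> y < 1 -> beta x <= beta y.
Proof.
move=> x0 xy y1; have y0 := le_trans x0 xy; have x1 := le_lt_trans xy y1.
set u := 1 - y; set w := 1 - x.
have u0 : 0 < u by rewrite /u subr_gt0.
have w0 : 0 < w by rewrite /w subr_gt0.
have uw : u <= w by rewrite /u /w; lra.
have lx := Lam_ge2 x0; have ly := Lam_gt0 y0; have lx0 := Lam_gt0 x0.
rewrite /beta lef_pV2 ?posrE ?mulr_gt0 ?sqrtr_gt0// -ler_sqr ?nnegrE ?mulr_ge0 ?sqrtr_ge0 ?(ltW u0) ?(ltW w0)//.
rewrite !exprMn !sqr_sqrtr ?(ltW ly) ?(ltW lx0)//.
have e : Lam y = Lam x + ln (w / u) by rewrite /Lam -/u -/w ln_div ?posrE//; ring.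
have h : ln (w / u) <= w / u - 1.
  have wu : 0 < w / u by rewrite divr_gt0.
  by have := @le_ln1Dx R (w / u - 1) ltac:(lra); rewrite (_ : 1 + (w / u - 1) = w / u)//; ring.
have h2 : u ^+ 2 * ln (w / u) <= u * (w - u).
  have -> : u * (w - u) = u ^+ 2 * (w / u - 1) by field; rewrite gt_eqF.
  by rewrite ler_wpM2l ?sqr_ge0.
have h3 : 2 * (w ^+ 2 - u ^+ 2) <= Lam x * (w ^+ 2 - u ^+ 2).
  by rewrite ler_wpM2r// subr_ge0 ler_sqr ?nnegrE ?(ltW u0) ?(ltW w0).
have h4 : u * (w - u) <= 2 * (w ^+ 2 - u ^+ 2).
  have -> : 2 * (w ^+ 2 - u ^+ 2) = (2 * (w + u)) * (w - u) by ring.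
  by rewrite ler_wpM2r ?subr_ge0//; lra.
rewrite -/u -/w e mulrDr; clear -h2 h3 h4; clearbody u w.
by move: h2 h3 h4; move: (ln (w / u)) (Lam x) => l L h2 h3 h4; lra.
Qed.

(** The kernel estimate controls the imaginary part of z F', the gradient estimate
    on discs of radius (1 - |z|) / 2 its derivative, and an integration along
    rays z F' itself. On |z| <= 1/2 division by z is avoided: F' is bounded
    there. *)
Lemma herglotz_derivative_bound : exists K : R, 0 <= K /\
  forall z, cmod z < 1 -> cmod (pval (pder (Fcoef mu)) z) <= K * beta (cmod z).
Proof.
have HF := rad1_Fcoef mu; have HH := rad1_nat HF; have K0 := angular_cst_ge0.
have grad w : cmod w < 1 ->
    cmod (pval (pder (fun n => n%:R * Fcoef mu n)) w) <= 8 * angular_cst * beta (cmod w) / (1 - cmod w).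
  move=> w1; set t := cmod w; have t0 : 0 <= t := cmod_ge0 w.
  pose rho := (1 - t) / 2.
  have rho0 : 0 < rho by rewrite divr_gt0// subr_gt0.
  have tr : t + rho = (1 + t) / 2 by rewrite /rho; field.
  have tr1 : t + rho < 1 by rewrite tr; lra.
  have b2 : beta (t + rho) <= 2 * beta t.
    have lt0 := Lam_gt0 t0; have ltr0 : 0 < Lam (t + rho) by apply: Lam_gt0; rewrite addr_ge0// ltW.
    have e : (1 - (t + rho)) = (1 - t) / 2 by rewrite tr; field.
    have -> : beta (t + rho) = 2 * ((1 - t)^-1 * (Num.sqrt (Lam (t + rho)))^-1).
      by rewrite /beta e !invfM invrK mulrA (mulrC 2).
    rewrite /beta invfM; apply: ler_wpM2l => //; apply: ler_wpM2l.
      by rewrite invr_ge0 subr_ge0 ltW.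
    rewrite lef_pV2 ?posrE ?sqrtr_gt0//; apply: ler_wsqrtr.
    by apply: Lam_mono => //; rewrite lerDl ltW.
  have := @gradient_estimate R _ w rho (2 * angular_cst * beta t) HH rho0 tr1.
  have B w' : cmod (w' - w) = rho -> `|complex.Im (pval (fun n => n%:R * Fcoef mu n) w')| <= 2 * angular_cst * beta t.
    move=> we; have w'r : cmod w' <= t + rho.
      rewrite (_ : w' = w + (w' - w)); last by ring.
      by rewrite (le_trans (ler_cmodD _ _))// we.
    rewrite (le_trans (Im_angular_bound (le_lt_trans w'r tr1)))//.
    rewrite [leRHS](_ : _ = angular_cst * (2 * beta t)); last by rewrite (mulrC 2) mulrA.
    by apply: ler_wpM2l => //; exact: le_trans (beta_mono (cmod_ge0 _) w'r tr1) b2.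
  move=> /(_ B); rewrite mulrC -ler_pdivlMr// => /le_trans; apply.
  rewrite le_eqVlt; apply/orP; left; apply/eqP; rewrite /rho; field.
  by rewrite subr_eq0 gt_eqF.
have HB w : cmod w < 1 -> cmod (pval (fun n => n%:R * Fcoef mu n) w) <= 16 * angular_cst * beta (cmod w).
  move=> w1; have := @integrate_beta R _ (8 * angular_cst) HH (mulr_ge0 (ler0n _ 8) K0) (mul0r _) grad w w1.
  by rewrite mulrA -natrM.
have h12 : 2^-1 < 1 :> R by rewrite invf_lt1// ltr1n.
have h0 : 0 <= 2^-1 :> R by rewrite invr_ge0.
have [B [B0 HBd]] := pval_bounded (rad1_pder HF) h0 h12.
have b0 : 0 < beta (0 : R) by rewrite beta_gt0.
exists (32 * angular_cst + B / beta 0); split.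
  apply: addr_ge0; first by apply: mulr_ge0.
  by apply: divr_ge0 => //; exact: ltW.
move=> z z1; have bz := beta_gt0 (cmod_ge0 z) z1; rewrite mulrDl.
have [zh|zh] := leP (cmod z) 2^-1.
  have k : B <= B / beta 0 * beta (cmod z).
    rewrite mulrAC ler_pdivlMr// ler_wpM2l//.
    exact: beta_mono (lexx 0) (cmod_ge0 z) z1.
  apply: le_trans (HBd z zh) (le_trans k _); rewrite lerDr.
  by apply: mulr_ge0; [exact: mulr_ge0|exact: ltW].
have := HB z z1; rewrite pval_nat// cmodM => h.
apply: (@le_trans _ _ (32 * angular_cst * beta (cmod z))); last first.
  by rewrite lerDl; apply: mulr_ge0; [apply: divr_ge0 => //; exact: ltW|exact: ltW].
have z0 : 0 < cmod z by rewrite (lt_trans _ zh)// invr_gt0.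
rewrite -(ler_pM2l z0) (le_trans h)//.
have -> : cmod z * (32 * angular_cst * beta (cmod z)) = (2 * cmod z) * (16 * angular_cst * beta (cmod z)) by ring.
apply: ler_peMl; first by apply: mulr_ge0; [exact: mulr_ge0|exact: ltW].
by rewrite -ler_pdivrMl// mulr1 ltW.
Qed.

End DerivativeBound.

(** * Energy on dyadic annuli *)

Section DyadicEnergy.
Local Open Scope complex_scope.
Context {R : realType}.
Local Notation T := (measurableTypeR R).
Local Notation xy := (@xy_complex R).
Implicit Types (a : nat -> R[i]) (p q t M : R) (g : R[i] -> R[i]).

Lemma powR_pos (x y : R) : 0 < x -> x `^ y = expR (y * ln x).
Proof. by move=> x0; rewrite /powR gt_eqF. Qed.

(** What remains of the singularity is 1 / (1 - t), at the edge of integrability: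
    the power of the logarithm decides. *)
Lemma weight_beta p t : 0 <= t -> t < 1 ->
  (1 - t) `^ (p - 1) * beta t `^ p = (1 - t)^-1 * Lam t `^ (- (p / 2)).
Proof.
move=> t0 t1; have d0 : 0 < 1 - t by rewrite subr_gt0.
rewrite !powR_pos ?beta_gt0 ?Lam_gt0// beta_expR// expRK.
rewrite -[in RHS](lnK (x := 1 - t)) ?posrE// -expRN -!expRD; congr expR.
by move: (ln _) (ln _) => A B; field.
Qed.

Lemma dyad_gap j : 1 - dyad j = 2^-1 ^+ j :> R.
Proof. by rewrite /dyad opprB addrC subrK. Qed.

Local Notation L j := (Lam (dyad j)).

Lemma Lam_dyad j : L j = 2 + j%:R * ln 2 :> R.
Proof.
rewrite /Lam dyad_gap lnXn// ?invr_gt0// lnV ?posrE//.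
by rewrite mulNrn opprK mulr_natl.
Qed.

Lemma ln2_01 : 0 < ln (2 : R) <= 1.
Proof.
rewrite ln_gt0 ?ltr1n//=.
by have := @le_ln1Dx R 1 ltac:(lra); rewrite (_ : 1 + 1 = 2).
Qed.

Lemma Lam_dyadS j : L j.+1 = L j + ln 2 :> R.
Proof. by rewrite !Lam_dyad -[j.+1%:R]natr1 mulrDl mul1r addrA. Qed.

Lemma Lam_dyad_ge2 j : 2 <= L j :> R.
Proof. exact/Lam_ge2/dyad_ge0. Qed.

Lemma Lam_dyad_gt0 j : 0 < L j :> R.
Proof. exact/Lam_gt0/dyad_ge0. Qed.

Lemma Lam_dyad_double j : L j.+1 <= 2 * L j :> R.
Proof. by rewrite Lam_dyadS; have := Lam_dyad_ge2 j; have /andP[_] := ln2_01; lra. Qed.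

(** Telescoping: the derivative of x^(1-q) is comparable to x^(-q), and Lam grows
    by the constant ln 2 from one dyadic radius to the next. *)
Lemma dyadic_telescope q j : 1 < q ->
  (q - 1) * ln 2 * L j.+1 `^ (- q) <= L j `^ (1 - q) - L j.+1 `^ (1 - q).
Proof.
move=> q1; set u := L j; set v := L j.+1.
have u0 : 0 < u := Lam_dyad_gt0 j; have v0 : 0 < v := Lam_dyad_gt0 j.+1.
have vu : ln 2 = v - u by rewrite /v Lam_dyadS addrAC subrr add0r.
rewrite !powR_pos//.
have uE : (1 - q) * ln u = (1 - q) * ln v + (q - 1) * (ln v - ln u) by ring.
have vE : - q * ln v = (1 - q) * ln v - ln v by ring.
rewrite uE vE !expRD expRN lnK ?posrE//.
set E := expR ((1 - q) * ln v).
have E0 : 0 <= E := expR_ge0 _.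
have h1 : 1 - u / v <= ln v - ln u.
  have uv : 0 < u / v by rewrite divr_gt0.
  have := @le_ln1Dx R (u / v - 1) ltac:(lra).
  rewrite (_ : 1 + (u / v - 1) = u / v); last by ring.
  by rewrite ln_div ?posrE//; lra.
have h2 := expR_ge1Dx ((q - 1) * (ln v - ln u)).
have h3 : (q - 1) * (1 - u / v) <= (q - 1) * (ln v - ln u).
  by apply: ler_wpM2l => //; lra.
have e : (q - 1) * ln 2 * (E / v) = E * ((q - 1) * (1 - u / v)).
  by rewrite vu; field; rewrite gt_eqF.
rewrite e -[X in _ <= _ - X]mulr1 -mulrBr; apply: ler_wpM2l => //.
by lra.
Qed.

Lemma dyadic_tail q m n : 1 < q -> (m <= n)%N ->
  \sum_(m <= j < n) L j.+1 `^ (- q) <= L m `^ (1 - q) / ((q - 1) * ln 2).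
Proof.
move=> q1 mn; have /andP[l0 _] := ln2_01.
have k0 : 0 < (q - 1) * ln 2 by rewrite mulr_gt0// subr_gt0.
rewrite ler_pdivlMr// mulr_suml.
apply: (@le_trans _ _ (\sum_(m <= j < n) - (L j.+1 `^ (1 - q) - L j `^ (1 - q)))).
  by apply: ler_sum => j _; rewrite mulrC opprB; exact: dyadic_telescope.
by rewrite sumrN telescope_sumr// opprB lerBlDr lerDl powR_ge0.
Qed.

Lemma dyadic_tail_small q e : 1 < q -> 0 < e ->
  exists m, forall n, (m <= n)%N -> \sum_(m <= j < n) L j.+1 `^ (- q) <= e.
Proof.
move=> q1 e0; have /andP[l0 _] := ln2_01.
have k0 : 0 < (q - 1) * ln 2 by rewrite mulr_gt0// subr_gt0.
have q10 : 0 < q - 1 by rewrite subr_gt0.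
pose A := (e * ((q - 1) * ln 2)) `^ (- (q - 1)^-1).
have A0 : 0 <= A / ln 2 by rewrite divr_ge0 ?powR_ge0 ?(ltW l0).
exists (Num.bound (A / ln 2)) => n mn; set m := Num.bound _ in mn *.
apply: le_trans (dyadic_tail q1 mn) _; rewrite ler_pdivrMr//.
have ek0 : 0 < e * ((q - 1) * ln 2) by rewrite mulr_gt0.
have Am : A <= L m.
  have := ltW (archi_boundP A0); rewrite -/m ler_pdivrMr// Lam_dyad.
  by move=> h; rewrite (le_trans h)// lerDr.
have Ap : 0 < A by rewrite powR_gt0.
have -> : e * ((q - 1) * ln 2) = A `^ (1 - q).
  rewrite -powRrM (_ : - (q - 1)^-1 * (1 - q) = 1); last by field; rewrite gt_eqF.
  by rewrite powRr1// ltW.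
rewrite !powR_pos ?Lam_dyad_gt0// ler_expR -opprB !mulNr lerN2.
by apply: ler_wpM2l; [exact: ltW|rewrite ler_ln ?posrE ?Lam_dyad_gt0].
Qed.

Lemma dyadic_area_le j : (dyad j.+1 ^+ 2 - dyad j ^+ 2) * area1 <= 2^-1 ^+ j * area1 :> R.
Proof.
apply: ler_wpM2r; first by rewrite ltW// area1_gt0.
have h0 := @dyad_ge0 R j; have h1 := @dyad_lt1 R j.+1; have h2 := @dyad_ltS R j.
have g1 := dyad_gap j; have g2 := dyad_gap j.+1.
have -> : 2^-1 ^+ j = 2 * 2^-1 ^+ j.+1 :> R by rewrite exprS mulrA mulfV// mul1r.
have e : dyad j.+1 - dyad j = 2^-1 ^+ j.+1 :> R.
  rewrite -g2; have : 2^-1 ^+ j = 2 * 2^-1 ^+ j.+1 :> R.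
    by rewrite exprS mulrA mulfV// mul1r.
  by rewrite -g1 -g2; lra.
rewrite subr_sqr e mulrC; apply: ler_wpM2r; first by rewrite exprn_ge0 ?invr_ge0.
by lra.
Qed.

(** On a dyadic annulus the weight and beta^p amount to an average against
    Lam^(-p/2). *)
Lemma annulus_energy_le g a p M gam j : 0 <= M -> 0 <= gam -> 0 <= p ->
  cmeasurable g -> rad1 a ->
  (forall x, 0 <= x -> x < 1 -> msq a x <= Lam x `^ gam) ->
  (forall w, cmod w < 1 ->
     cmod (g w) `^ p <= M * beta (cmod w) `^ p * (1 + cmod (pval a w) ^+ 2)) ->
  (\int[leb2]_(w in annulus (dyad j) (dyad j.+1))
     ((1 - cmod (xy w)) `^ (p - 1) * cmod (g (xy w)) `^ p)%:E <=
   (6 * area1 * 2 `^ (p / 2) * M * L j.+1 `^ (gam - p / 2))%:E)%E.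
Proof.
move=> M0 gam0 p0 mg Ha Hm Hg; set b := dyad j : R; set c := dyad j.+1 : R.
have b0 : 0 <= b := dyad_ge0 j; have c1 : c < 1 := dyad_lt1 _.
have bc : b < c := dyad_ltS j; have c0 := le_trans b0 (ltW bc).
pose W := M * (2 ^+ j.+1 * L j `^ (- (p / 2))).
have W0 : 0 <= W by rewrite /W !mulr_ge0 ?powR_ge0 ?exprn_ge0.
have mp : measurable_fun (annulus b c) (fun w => cmod (pval a (xy w)) : T).
  exact: measurable_cmod_annulus (ltW c1) (measurable_pval Ha).
have mp2 : measurable_fun (annulus b c) (fun w => 1 + cmod (pval a (xy w)) ^+ 2 : T).
  by apply: measurable_funD => //; exact: measurable_funX.
have mE : measurable_fun (annulus b c)
    (fun w => (1 - cmod (xy w)) `^ (p - 1) * cmod (g (xy w)) `^ p : T).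
  apply: measurable_funS (measurable_energy p mg); first exact: measurable_odisc.
  exact: annulus_odisc (ltW c1).
have step w : annulus b c w ->
    (1 - cmod (xy w)) `^ (p - 1) * cmod (g (xy w)) `^ p <= W * (1 + cmod (pval a (xy w)) ^+ 2).
  move=> /andP[wb wc]; set t := cmod (xy w) in wb wc *.
  have t0 : 0 <= t := cmod_ge0 _; have t1 : t < 1 := lt_trans wc c1.
  have d0 : 0 < 1 - t by rewrite subr_gt0.
  apply: (@le_trans _ _ ((1 - t) `^ (p - 1) * (M * beta t `^ p * (1 + cmod (pval a (xy w)) ^+ 2)))).
    by apply: ler_wpM2l; [exact: powR_ge0|exact: Hg].
  rewrite [leLHS](_ : _ = M * ((1 - t) `^ (p - 1) * beta t `^ p) * (1 + cmod (pval a (xy w)) ^+ 2)); last first.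
    by move: (_ `^ _) (_ `^ _) (_ ^+ _) => A B D; ring.
  apply: ler_wpM2r; first by rewrite addr_ge0 ?sqr_ge0.
  apply: ler_wpM2l => //; rewrite weight_beta//.
  apply: ler_pM; [by rewrite invr_ge0 ltW|exact: powR_ge0| |].
    rewrite -[leRHS]invrK -exprVn lef_pV2 ?posrE ?exprn_gt0 ?invr_gt0//.
    by rewrite -dyad_gap lerD2l lerN2 ltW.
  rewrite !powR_pos ?Lam_dyad_gt0 ?Lam_gt0// ler_expR !mulNr lerN2.
  apply: ler_wpM2l; first by rewrite divr_ge0.
  by rewrite ler_ln ?posrE ?Lam_dyad_gt0 ?Lam_gt0//; exact: Lam_mono.
apply: (@le_trans _ _ (\int[leb2]_(w in annulus b c) (W * (1 + cmod (pval a (xy w)) ^+ 2))%:E)%E).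
  apply: ge0_le_integral.
  - exact: measurable_annulus.
  - by move=> w _; rewrite lee_fin mulr_ge0 ?powR_ge0.
  - exact/measurable_EFinP.
  - by apply/measurable_EFinP; exact: measurable_funM.
  by move=> w /step; rewrite lee_fin.
have -> : (\int[leb2]_(w in annulus b c) (W * (1 + cmod (pval a (xy w)) ^+ 2))%:E =
    W%:E * (\int[leb2]_(w in annulus b c) 1%:E + \int[leb2]_(w in annulus b c) (cmod (pval a (xy w)) ^+ 2)%:E))%E.
  rewrite -ge0_integralD//; last 3 first.
  - exact: measurable_annulus.
  - by move=> w _; rewrite lee_fin sqr_ge0.
  - by apply/measurable_EFinP; exact: measurable_funX.
  rewrite -ge0_integralZl//; last 3 first.
  - exact: measurable_annulus.
  - by apply/measurable_EFinP.
  - by move=> w _; rewrite lee_fin addr_ge0 ?sqr_ge0.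
rewrite integral_annulus_cst// mul1r.
set A := (c ^+ 2 - b ^+ 2) * area1.
have A0 : 0 <= A.
  by rewrite mulr_ge0 ?(ltW area1_gt0)// subr_ge0 ler_sqr ?nnegrE// ltW.
have Lc1 : 1 <= L j.+1 `^ gam.
  rewrite powR_pos ?Lam_dyad_gt0// -expR0 ler_expR mulr_ge0// ln_ge0//.
  by have := Lam_dyad_ge2 j.+1; lra.
have msqc : msq a (c ^+ 2) <= L j.+1 `^ gam.
  have c2 : c ^+ 2 <= c by rewrite expr2 ler_piMl// ltW.
  apply: le_trans (msq_mono Ha _ c2 c1) (Hm _ c0 c1).
  exact: sqr_ge0.
apply: (@le_trans _ _ (W%:E * (A + (msq a (c ^+ 2) + 1) * A)%:E)%E).
  rewrite EFinD; apply: lee_wpmul2l; first by rewrite lee_fin.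
  by apply: leeD => //; exact: annulus_mean_upper.
rewrite -EFinM lee_fin.
have h1 : A + (msq a (c ^+ 2) + 1) * A <= 3 * L j.+1 `^ gam * (2^-1 ^+ j * area1).
  rewrite -{1}[A]mul1r -mulrDl; apply: ler_pM => //; last exact: dyadic_area_le.
    by have := msq_ge0 Ha (sqr_ge0 c) (exprn_ilt1 2 c0 c1); lra.
  by lra.
apply: le_trans (ler_wpM2l W0 h1) _.
have e2 : (2 : R) ^+ j.+1 * 2^-1 ^+ j = 2 by rewrite exprS -mulrA -exprMn mulfV// expr1n mulr1.
rewrite /W [leLHS](_ : _ = (2 ^+ j.+1 * 2^-1 ^+ j) * 3 * area1 * M * (L j `^ (- (p / 2)) * L j.+1 `^ gam)); last first.
  by move: (_ `^ _) (_ `^ _) (_ ^+ _) (_ ^+ _) area1 => A1 A2 A3 A4 A5; ring.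
rewrite e2 [leRHS](_ : _ = 2 * 3 * area1 * M * (2 `^ (p / 2) * L j.+1 `^ (gam - p / 2))); last first.
  by move: (_ `^ _) (_ `^ _) area1 => A1 A2 A5; ring.
apply: ler_wpM2l; first by rewrite !mulr_ge0 ?(ltW area1_gt0).
rewrite !powR_pos ?Lam_dyad_gt0// -!expRD ler_expR.
have h2 : ln (L j.+1) <= ln 2 + ln (L j) :> R.
  rewrite -lnM ?posrE ?Lam_dyad_gt0// ler_ln ?posrE ?mulr_gt0 ?Lam_dyad_gt0//.
  exact: Lam_dyad_double.
have : p / 2 * ln (L j.+1) <= p / 2 * (ln 2 + ln (L j)).
  by apply: ler_wpM2l h2; rewrite divr_ge0.
by move: (ln _) (ln _) (ln _) (p / 2) => A1 A2 A3 A4; lra.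
Qed.

End DyadicEnergy.

Section EnergyEstimates.
Local Open Scope complex_scope.
Context {R : realType}.
Local Notation T := (measurableTypeR R).
Local Notation xy := (@xy_complex R).
Local Notation L j := (Lam (dyad j)).
Implicit Types (p q M : R) (g : R[i] -> R[i]).

Lemma powR_mono (x y p : R) : 0 <= p -> 0 <= x -> x <= y -> x `^ p <= y `^ p.
Proof.
by move=> p0 x0 xy; apply: ge0_ler_powR => //; rewrite nnegrE// (le_trans x0).
Qed.

Lemma powR_sum_le (x y p : R) : 0 <= p -> 0 <= x -> 0 <= y ->
  (x + y) `^ p <= 2 `^ p * (x `^ p + y `^ p).
Proof.
move=> p0 x0 y0; wlog xy : x y x0 y0 / x <= y => [H|].
  have [xy|/ltW yx] := leP x y; first exact: H.
  by rewrite (addrC x) (addrC (x `^ p)); exact: H.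
have h : x + y <= 2 * y by lra.
apply: le_trans (powR_mono p0 (addr_ge0 x0 y0) h) _.
rewrite powRM//; apply: ler_wpM2l; first exact: powR_ge0.
by rewrite lerDr powR_ge0.
Qed.

Lemma energyD p g g1 g2 (e1 e2 : R) : 0 <= p ->
  cmeasurable g -> cmeasurable g1 -> cmeasurable g2 ->
  (forall w, cmod w < 1 -> cmod (g w) <= cmod (g1 w) + cmod (g2 w)) ->
  (energy p g1 <= e1%:E)%E -> (energy p g2 <= e2%:E)%E ->
  (energy p g <= (2 `^ p * (e1 + e2))%:E)%E.
Proof.
move=> p0 mg m1 m2 H H1 H2.
pose W w := (1 - cmod (xy w)) `^ (p - 1).
have W0 w : 0 <= W w := powR_ge0 _ _.
have mE f : cmeasurable f -> measurable_fun (odisc 1) (fun w => (W w * cmod (f (xy w)) `^ p)%:E).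
  by move=> mf; apply/measurable_EFinP; exact: measurable_energy.
have E0 f : forall w, odisc 1 w -> (0 <= (W w * cmod (f (xy w)) `^ p)%:E)%E.
  by move=> w _; rewrite lee_fin mulr_ge0 ?powR_ge0.
apply: (@le_trans _ _ ((2 `^ p)%:E * (energy p g1 + energy p g2))%E); last first.
  rewrite EFinM EFinD; apply: lee_wpmul2l; first by rewrite lee_fin powR_ge0.
  exact: leeD.
rewrite /energy -ge0_integralD//; last 5 first.
- exact: measurable_odisc.
- exact: E0.
- exact: mE.
- exact: E0.
- exact: mE.
rewrite -ge0_integralZl//; last 3 first.
- exact: measurable_odisc.
- by apply: emeasurable_funD; exact: mE.
- by move=> w w1; apply: adde_ge0; exact: E0.
apply: ge0_le_integral.
- exact: measurable_odisc.
- exact: E0.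
- exact: mE.
- apply: measurable_funeM; apply: emeasurable_funD; exact: mE.
move=> w w1; rewrite -EFinD -EFinM lee_fin -/(W w) -mulrDr mulrCA.
apply: ler_wpM2l => //.
apply: le_trans (powR_sum_le p0 (cmod_ge0 _) (cmod_ge0 _)).
exact: powR_mono p0 (cmod_ge0 _) (H _ w1).
Qed.

Lemma annulus_energy_sup p g j (del : R) : 1 <= p -> 0 <= del -> cmeasurable g ->
  (forall w, cmod w < dyad j.+1 -> cmod (g w) <= del) ->
  (\int[leb2]_(w in annulus (dyad j) (dyad j.+1))
     ((1 - cmod (xy w)) `^ (p - 1) * cmod (g (xy w)) `^ p)%:E <=
   (del `^ p * area1)%:E)%E.
Proof.
move=> p1 del0 mg H; have c1 := @dyad_lt1 R j.+1.
have p0 : 0 <= p := le_trans ler01 p1.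
apply: (@le_trans _ _ (\int[leb2]_(w in annulus (dyad j) (dyad j.+1)) (del `^ p)%:E)%E).
  apply: ge0_le_integral.
  - exact: measurable_annulus.
  - by move=> w _; rewrite lee_fin mulr_ge0 ?powR_ge0.
  - apply/measurable_EFinP; apply: measurable_funS (measurable_energy p mg).
      exact: measurable_odisc.
    exact: annulus_odisc (ltW c1).
  - exact: measurable_cst.
  move=> w /andP[_ wc]; rewrite lee_fin -[leRHS]mul1r.
  apply: ler_pM; [exact: powR_ge0|exact: powR_ge0| |].
    apply: (@le_trans _ _ (1 `^ (p - 1))); last by rewrite powR1.
    apply: powR_mono; first by rewrite subr_ge0.
      by rewrite subr_ge0 ltW// (lt_trans wc).
    by rewrite lerBlDr lerDl cmod_ge0.
  exact: powR_mono p0 (cmod_ge0 _) (H _ wc).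
rewrite integral_annulus_cst ?dyad_ge0 ?dyad_ltS// lee_fin.
apply: ler_wpM2l; first exact: powR_ge0.
apply: le_trans (dyadic_area_le j) _; apply: ler_piMl; first exact: ltW area1_gt0.
by rewrite exprn_ile1 ?invr_ge0// invf_le1// ler1n.
Qed.

(** A summable bound on the dyadic annuli makes the outer part of the energy
    uniformly small; the inner part is controlled by the supremum. *)
Lemma energy_small p q M (e : R) : 1 <= p -> 1 < q -> 0 <= M -> 0 < e ->
  exists m (del : R), 0 < del /\ forall g, cmeasurable g ->
    (forall j, (\int[leb2]_(w in annulus (dyad j) (dyad j.+1))
       ((1 - cmod (xy w)) `^ (p - 1) * cmod (g (xy w)) `^ p)%:E <=
       (M * L j.+1 `^ (- q))%:E)%E) ->
    (forall w, cmod w < dyad m -> cmod (g w) <= del) ->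
    (energy p g <= e%:E)%E.
Proof.
move=> p1 q1 M0 e0; have p0 : 0 < p := lt_le_trans ltr01 p1.
have M1 : 0 < M + 1 by lra.
have e2 : 0 < e / 2 by rewrite divr_gt0.
have [m Hm] := @dyadic_tail_small R q (e / 2 / (M + 1)) q1 (divr_gt0 e2 M1).
pose k := e / 2 / m.+1%:R.
have k0 : 0 < k by rewrite divr_gt0.
have ar0 := @area1_gt0 R.
pose del := (k / area1) `^ p^-1.
have del0 : 0 < del by rewrite powR_gt0 ?divr_gt0.
have delp : del `^ p * area1 = k.
  by rewrite /del -powRrM mulVf ?gt_eqF// powRr1 ?divfK ?gt_eqF// divr_ge0// ltW.
exists m, del; split => // g mg Hj Hd.
pose ee j := if (j < m)%N then k else M * L j.+1 `^ (- q).
have inner n : (n <= m)%N -> \sum_(0 <= j < n) ee j <= e / 2.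
  move=> nm; apply: (@le_trans _ _ (\sum_(0 <= j < n) k)).
    by apply: ler_sum_nat => j /andP[_ jn]; rewrite /ee (leq_trans jn nm).
  rewrite sumr_const_nat subn0 -[_ *+ n]mulr_natl /k mulrCA -[leRHS]mulr1.
  apply: ler_wpM2l; first exact: ltW.
  by rewrite ler_pdivrMr ?ltr0n// mul1r ler_nat leqW.
apply: (@energy_le _ p g ee) => // [j|n].
  rewrite /ee; case: ifPn => jm; last exact: Hj.
  rewrite -delp; apply: annulus_energy_sup => //; first exact: ltW.
  by move=> w wj; apply: Hd; exact: lt_le_trans wj (dyad_homo jm).
rewrite -(big_mkord xpredT ee); have [nm|mn] := leqP n m.
  by rewrite (le_trans (inner n nm))// ler_pdivrMr// ler_peMr ?(ltW e0)// ler1n.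
rewrite (big_cat_nat (leq0n m) (ltnW mn))/= [e in _ <= e](splitr e).
apply: lerD; first exact: inner.
apply: (@le_trans _ _ (M * \sum_(m <= j < n) L j.+1 `^ (- q))).
  rewrite mulr_sumr; apply: ler_sum_nat => j /andP[mj _].
  by rewrite /ee ltnNge mj.
apply: le_trans (ler_wpM2l M0 (Hm n (ltnW mn))) _.
rewrite mulrA ler_pdivrMr// mulrC; apply: ler_wpM2l; first exact: ltW.
by rewrite lerDl.
Qed.

(** The dyadic sums of Lam^(-p/2) converge because p / 2 > 1. *)
Lemma energy_beta p : 2 < p -> exists E : R, 0 <= E /\
  forall g M, 0 <= M -> cmeasurable g ->
    (forall w, cmod w < 1 -> cmod (g w) <= M * beta (cmod w)) ->
    (energy p g <= (M `^ p * E)%:E)%E.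
Proof.
move=> p2; have p0 : 0 <= p by lra.
have q1 : 1 < p / 2 by rewrite ltr_pdivlMr// mul1r.
have ar0 := @area1_gt0 R; have /andP[l0 _] := @ln2_01 R.
pose S := L 0 `^ (1 - p / 2) / ((p / 2 - 1) * ln 2) : R.
have S0 : 0 <= S.
  apply: divr_ge0; first exact: powR_ge0.
  by apply: mulr_ge0; [rewrite subr_ge0 ltW|exact: ltW].
have c0 : 0 <= 6 * area1 * 2 `^ (p / 2) :> R.
  by rewrite !mulr_ge0 ?powR_ge0 ?(ltW ar0).
exists (6 * area1 * 2 `^ (p / 2) * S); split; first exact: mulr_ge0.
move=> g M M0 mg H.
pose z : nat -> R[i] := fun=> 0.
have Hz : rad1 z by apply: (@rad1_bounded _ _ 0) => n; rewrite cmod0.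
have mz x : 0 <= x -> x < 1 -> msq z x <= Lam x `^ 0.
  move=> x0 x1; apply: msq_le => // N; rewrite big1 ?powR_ge0// => i _.
  by rewrite cmod0 expr0n mul0r.
have bz w : cmod w < 1 ->
    cmod (g w) `^ p <= M `^ p * beta (cmod w) `^ p * (1 + cmod (pval z w) ^+ 2).
  move=> w1; have b0 := beta_gt0 (cmod_ge0 w) w1.
  rewrite -powRM ?(ltW b0)//.
  apply: le_trans (powR_mono p0 (cmod_ge0 _) (H w w1)) _.
  by apply: ler_peMr; [exact: powR_ge0|rewrite lerDl sqr_ge0].
have Hj j := annulus_energy_le j (powR_ge0 M p) (lexx 0) p0 mg Hz mz bz.
apply: (energy_le mg Hj) => n.
rewrite -mulr_sumr sub0r -(big_mkord xpredT (fun j => L j.+1 `^ (- (p / 2)))).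
rewrite [leRHS](_ : _ = 6 * area1 * 2 `^ (p / 2) * M `^ p * S); last first.
  by rewrite mulrCA mulrA.
by apply: ler_wpM2l; [rewrite mulr_ge0 ?powR_ge0|exact: dyadic_tail].
Qed.

End EnergyEstimates.

(** * Analytic functions on the disc and their dilations *)

Section Holomorphic.
Local Open Scope complex_scope.
Context {R : realType}.
Local Notation T := (measurableTypeR R).
Local Notation xy := (@xy_complex R).
Implicit Types (f g : R[i] -> R[i]) (z w c : R[i]) (r q del : R).

(** Sums of power series of radius at least 1, the working notion of analytic
    function on the disc: it is stable under exponentiation and makes dilations
    and Taylor polynomials available at once. *)
Definition holo f := exists2 a, rad1 a & forall z, cmod z < 1 -> f z = pval a z.

Lemma holo_ext f g : (forall z, cmod z < 1 -> g z = f z) -> holo f -> holo g.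
Proof. by move=> e [a Ha H]; exists a => // z z1; rewrite e// H. Qed.

Lemma holo_pval a : rad1 a -> holo (pval a).
Proof. by exists a. Qed.

Lemma holo_cderive f : holo f -> holo (cderive f).
Proof.
move=> [a Ha H]; exists (pder a); first exact: rad1_pder.
by move=> z z1; exact: cderive_pval.
Qed.

Lemma holo_cdiff f z : holo f -> cmod z < 1 -> cdiff f z (cderive f z).
Proof.
move=> [a Ha H] z1; rewrite (cderive_pval Ha H z1).
by apply: cdiff_ext (cdiff_pval Ha z1) => // w w1; rewrite H.
Qed.

Lemma holo_cmeasurable f : holo f -> cmeasurable f.
Proof.
move=> [a Ha H]; apply: eq_measurable_fun (measurable_pval Ha) => w.
by rewrite inE => w1; rewrite H.
Qed.

Lemma holo_bounded f q : holo f -> 0 <= q -> q < 1 ->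
  exists B, 0 <= B /\ forall z, cmod z <= q -> cmod (f z) <= B.
Proof.
move=> [a Ha H] q0 q1; have [B [B0 HB]] := pval_bounded Ha q0 q1.
by exists B; split => // z zq; rewrite H ?HB// (le_lt_trans zq).
Qed.

Lemma holoD f g : holo f -> holo g -> holo (fun z => f z + g z).
Proof.
move=> [a Ha Hf] [b Hb Hg]; exists (fun n => a n + b n); first exact: rad1D.
by move=> z z1; rewrite pvalD// Hf// Hg.
Qed.

Lemma holoZ f c : holo f -> holo (fun z => c * f z).
Proof.
move=> [a Ha Hf]; exists (fun n => c * a n); first exact: rad1Z.
by move=> z z1; rewrite pvalZ// Hf.
Qed.

Lemma holoB f g : holo f -> holo g -> holo (fun z => f z - g z).
Proof.
move=> Hf Hg; apply: holo_ext (holoD Hf (holoZ (-1) Hg)) => z _.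
by rewrite mulN1r.
Qed.

Lemma holoM f g : holo f -> holo g -> holo (fun z => f z * g z).
Proof.
move=> [a Ha Hf] [b Hb Hg]; exists (conv a b); first exact: rad1_conv.
by move=> z z1; rewrite pvalM// Hf// Hg.
Qed.

Lemma holo_poly (P : {poly R[i]}) : holo (fun z => P.[z]).
Proof. by exists (fun i => P`_i); [exact: rad1_poly|move=> z z1; rewrite pval_poly]. Qed.

Lemma holo_cst c : holo (fun=> c).
Proof. by apply: holo_ext (holo_poly c%:P) => z _; rewrite hornerC. Qed.

Lemma holo_cexp f : holo f -> holo (fun z => cexp (f z)).
Proof.
move=> [a Ha Hf]; exists (pexp a); first exact: rad1_pexp.
by move=> z z1; rewrite pval_pexp// Hf.
Qed.

Lemma holo_dilate f c : cmod c <= 1 -> holo f -> holo (fun z => f (c * z)).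
Proof.
move=> c1 [a Ha Hf]; exists (fun n => c ^+ n * a n); first exact: rad1_dilate.
move=> z z1; rewrite pval_dilate// Hf// cmodM.
by rewrite (le_lt_trans _ z1)// ler_piMl// cmod_ge0.
Qed.

Lemma cderiveD f g z : holo f -> holo g -> cmod z < 1 ->
  cderive (fun z => f z + g z) z = cderive f z + cderive g z.
Proof. by move=> Hf Hg z1; apply: cdiff_cderive; apply: cdiffD; exact: holo_cdiff. Qed.

Lemma cderiveB f g z : holo f -> holo g -> cmod z < 1 ->
  cderive (fun z => f z - g z) z = cderive f z - cderive g z.
Proof. by move=> Hf Hg z1; apply: cdiff_cderive; apply: cdiffB; exact: holo_cdiff. Qed.

Lemma cderiveZ f c z : holo f -> cmod z < 1 ->
  cderive (fun z => c * f z) z = c * cderive f z.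
Proof. by move=> Hf z1; apply: cdiff_cderive; apply: cdiffZ; exact: holo_cdiff. Qed.

Lemma cderiveM f g z : holo f -> holo g -> cmod z < 1 ->
  cderive (fun z => f z * g z) z = cderive f z * g z + f z * cderive g z.
Proof. by move=> Hf Hg z1; apply: cdiff_cderive; apply: cdiffM; exact: holo_cdiff. Qed.

Lemma cderive_cexp f z : holo f -> cmod z < 1 ->
  cderive (fun z => cexp (f z)) z = cderive f z * cexp (f z).
Proof. by move=> Hf z1; apply: cdiff_cderive; apply: cdiff_cexp; exact: holo_cdiff. Qed.

Lemma cderive_dilate f c z : holo f -> cmod c <= 1 -> cmod z < 1 ->
  cderive (fun z => f (c * z)) z = c * cderive f (c * z).
Proof.
move=> Hf c1 z1; apply: cdiff_cderive; apply: cdiff_dilate; apply: holo_cdiff => //.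
by rewrite cmodM (le_lt_trans _ z1)// ler_piMl// cmod_ge0.
Qed.

Lemma cderive_cst c z : cderive (fun=> c) z = 0.
Proof. exact/cdiff_cderive/cdiff_cst. Qed.

Lemma cderive_ext f g z : (forall w, cmod w < 1 -> f w = g w) -> holo f -> cmod z < 1 ->
  cderive g z = cderive f z.
Proof.
by move=> e Hf z1; apply: cdiff_cderive; exact: cdiff_ext e (holo_cdiff Hf z1).
Qed.

Lemma bernoulli_le r n : 0 <= r -> r <= 1 -> 1 - r ^+ n <= n%:R * (1 - r).
Proof.
move=> r0 r1; elim: n => [|n IH]; first by rewrite expr0 subrr mul0r.
have h : r ^+ n <= 1 by rewrite exprn_ile1.
rewrite exprS -[n.+1%:R]natr1 mulrDl mul1r.
have -> : 1 - r * r ^+ n = (1 - r ^+ n) + r ^+ n * (1 - r) by ring.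
by apply: lerD => //; apply: ler_piMl; rewrite ?subr_ge0.
Qed.

(** Compare both values with a Taylor polynomial, for which Bernoulli's inequality
    is enough. *)
Lemma dilate_uniform f q del : holo f -> 0 <= q -> q < 1 -> 0 < del ->
  exists r0 : R, [/\ 0 <= r0, r0 < 1 & forall r, r0 <= r -> r <= 1 ->
    forall z, cmod z <= q -> cmod (f (r%:C * z) - f z) <= del].
Proof.
move=> [a Ha Hf] q0 q1 d0; have [M [t [M0 t0 t1 H]]] := pvalP Ha q0 q1.
have d4 : 0 < del / 4 by rewrite divr_gt0.
have [n Hn] := geometric_small M t0 t1 d4; have {Hn} hn := Hn n (leqnn n).
pose B := \sum_(i < n) i%:R * cmod (a i).
have B0 : 0 <= B by apply: sumr_ge0 => i _; rewrite mulr_ge0 ?cmod_ge0.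
have B1 : 0 < B + 1 by lra.
pose s := del / 2 / (B + 1).
have s0 : 0 < s by rewrite !divr_gt0.
exists (Num.max 0 (1 - s)); split.
- by rewrite le_max lexx.
- by rewrite gt_max ltr01/= ltrBlDr ltrDl.
move=> r; rewrite ge_max => /andP[r0 rs] r1 z zq.
have z1 := le_lt_trans zq q1.
have rE : cmod r%:C = r by rewrite cmod_real ger0_norm.
have rz : cmod (r%:C * z) <= cmod z by rewrite cmodM rE ler_piMl ?cmod_ge0.
have rz1 := le_lt_trans rz z1; have rzq := le_trans rz zq.
rewrite !Hf//.
have -> : pval a (r%:C * z) - pval a z = (pval a (r%:C * z) - psum a n (r%:C * z))
    - (pval a z - psum a n z) + (psum a n (r%:C * z) - psum a n z).
  by move: (pval _ _) (pval _ _) (psum _ _ _) (psum _ _ _) => A1 A2 A3 A4; ring.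
have h3 : cmod (psum a n (r%:C * z) - psum a n z) <= B * (1 - r).
  rewrite /psum -sumrB mulr_suml; apply: le_trans (ler_cmod_sum _ _ _) _.
  apply: ler_sum => i _.
  have -> : a i * (r%:C * z) ^+ i - a i * z ^+ i = (a i * z ^+ i) * (r ^+ i - 1)%:C.
    by rewrite exprMn rmorphB rmorphXn rmorph1; ring.
  have ri : r ^+ i <= 1 by rewrite exprn_ile1.
  rewrite !cmodM cmodX cmod_real ler0_norm ?subr_le0// opprB.
  rewrite [leRHS](_ : _ = cmod (a i) * (i%:R * (1 - r))); last by ring.
  apply: ler_pM; rewrite ?mulr_ge0 ?exprn_ge0 ?cmod_ge0 ?subr_ge0//.
    by apply: ler_piMr; rewrite ?cmod_ge0// exprn_ile1 ?cmod_ge0// ltW.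
  exact: bernoulli_le.
apply: le_trans (ler_cmodD _ _) _.
rewrite [leRHS](_ : _ = (del / 4 + del / 4) + del / 2); last by field.
apply: lerD.
  apply: le_trans (ler_cmodB _ _) _.
  by apply: lerD; apply: le_trans hn; exact: H.
apply: le_trans h3 _.
have : (1 - r) * (B + 1) <= del / 2.
  by rewrite -ler_pdivlMr// -/s; lra.
by move: (del / 2) => D h; rewrite (le_trans _ h)// mulrC; apply: ler_wpM2l; lra.
Qed.

(** The dilation is analytic on a larger disc, so its Taylor polynomials and their
    derivatives converge uniformly up to the circle. *)
Lemma dilate_poly_approx f r del : holo f -> 0 <= r -> r < 1 -> 0 < del ->
  exists P : {poly R[i]}, forall z, cmod z < 1 ->
    cmod (f (r%:C * z) - P.[z]) <= del /\
    cmod (cderive (fun z => f (r%:C * z)) z - cderive (fun z => P.[z]) z) <= del.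
Proof.
move=> Hf r0 r1 d0; have [a Ha fE] := Hf.
have rE : cmod r%:C = r by rewrite cmod_real ger0_norm.
have r1' : cmod r%:C <= 1 by rewrite rE ltW.
have [M [t [M0 t0 t1 H]]] := pvalP Ha r0 r1.
have [M' [t' [M0' t0' t1' H']]] := pvalP (rad1_pder Ha) r0 r1.
have [n Hn] := geometric_small M t0 t1 d0.
have [n' Hn'] := geometric_small M' t0' t1' d0.
pose N := maxn n n'.
pose b i := r%:C ^+ i * a i.
exists (\poly_(i < N.+1) b i) => z z1.
have rz : cmod (r%:C * z) <= r by rewrite cmodM rE ler_piMr// ltW.
have rz1 := le_lt_trans rz r1.
have psumE (c : nat -> R[i]) m : psum (fun i => r%:C ^+ i * c i) m z = psum c m (r%:C * z).
  by apply: eq_bigr => i _; rewrite exprMn; ring.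
split.
  rewrite -psum_horner psumE fE//; apply: le_trans (H _ _ rz) (Hn _ _).
  by rewrite leqW// leq_maxl.
rewrite cderive_dilate// (cderive_pval Ha fE)//.
have PE w : cmod w < 1 -> (\poly_(i < N.+1) b i).[w] = pval (fun i => (\poly_(i < N.+1) b i)`_i) w.
  by move=> w1; rewrite pval_poly.
rewrite (cderive_pval (rad1_poly (\poly_(i < N.+1) b i)) PE z1).
have -> : pder (fun i => (\poly_(i < N.+1) b i)`_i) =
    (fun i => (\poly_(i < N) (r%:C * (r%:C ^+ i * pder a i)))`_i).
  apply/funext => i; rewrite /pder !coef_poly ltnS; case: ifP => _; last by rewrite mulr0.
  by rewrite /b exprS; ring.
rewrite pval_poly// -psum_horner.
have -> : psum (fun i => r%:C * (r%:C ^+ i * pder a i)) N z = r%:C * psum (pder a) N (r%:C * z).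
  by rewrite -psumE /psum mulr_sumr; apply: eq_bigr => i _; rewrite -!mulrA.
rewrite -mulrBr cmodM rE; apply: (@le_trans _ _ (1 * del)); last by rewrite mul1r.
apply: ler_pM; rewrite ?cmod_ge0//; first exact: ltW.
apply: le_trans (H' _ _ rz) (Hn' _ _); exact: leq_maxr.
Qed.

End Holomorphic.

(** * Approximate inverses of the inner function *)

Section PolynomialBounds.
Local Open Scope complex_scope.
Context {R : realType}.
Implicit Types (P : {poly R[i]}) (z : R[i]).

Lemma poly_bounded P : exists B : R, 0 <= B /\ forall z, cmod z < 1 -> cmod P.[z] <= B.
Proof.
exists (\sum_(i < size P) cmod P`_i); split.
  by apply: sumr_ge0 => i _; exact: cmod_ge0.
move=> z z1; rewrite horner_coef; apply: le_trans (ler_cmod_sum _ _ _) _.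
apply: ler_sum => i _; rewrite cmodM cmodX; apply: ler_piMr; first exact: cmod_ge0.
by rewrite exprn_ile1 ?cmod_ge0// ltW.
Qed.

Lemma cderive_poly P z : cmod z < 1 -> cderive (fun z => P.[z]) z = P^`().[z].
Proof.
move=> z1.
have PE w : cmod w < 1 -> P.[w] = pval (fun i => P`_i) w by move=> w1; rewrite pval_poly.
rewrite (cderive_pval (rad1_poly P) PE z1) -pval_poly//; congr pval.
by apply/funext => i; rewrite /pder coef_deriv mulr_natl.
Qed.

Lemma beta_ge_half (x : R) : 0 <= x -> x < 1 -> 2^-1 <= beta x.
Proof.
move=> x0 x1; apply: le_trans (beta_mono (lexx 0) x0 x1).
rewrite /beta Lam0 subr0 mul1r lef_pV2 ?posrE ?sqrtr_gt0//.
by rewrite -[leRHS]ger0_norm// -sqrtr_sqr ler_wsqrtr// expr2; lra.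
Qed.

End PolynomialBounds.

Section Approximation.
Local Open Scope complex_scope.
Context {R : realType}.
Context (F : R[i] -> R[i]) (K p : R).
Context (holoF : holo F) (K0 : 0 <= K) (p2 : 2 < p).
Context (ReF : forall z, cmod z < 1 -> 0 <= complex.Re (F z)).
Context (dF : forall z, cmod z < 1 -> cmod (cderive F z) <= K * beta (cmod z)).
Implicit Types (G : R[i] -> R[i]) (z w : R[i]) (r l e M : R).

(** Real powers of exp F; the inner function is the power -1. *)
Definition epow l z := cexp (l%:C * F z).

Lemma holo_epow l : holo (epow l).
Proof. exact/holo_cexp/holoZ. Qed.

Lemma epowD l m z : epow l z * epow m z = epow (l + m) z.
Proof. by rewrite /epow -cexpD rmorphD mulrDl. Qed.

Lemma epow0 z : epow 0 z = 1.
Proof. by rewrite /epow mul0r cexp0. Qed.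

Lemma cderive_epow l z : cmod z < 1 -> cderive (epow l) z = l%:C * cderive F z * epow l z.
Proof. by move=> z1; rewrite cderive_cexp ?cderiveZ//; exact: holoZ. Qed.

Lemma cmod_epow_le1 l z : l <= 0 -> cmod z < 1 -> cmod (epow l z) <= 1.
Proof.
move=> l0 z1; rewrite cmod_cexp cReZ -expR0 ler_expR.
by apply: mulr_le0_ge0 => //; exact: ReF.
Qed.

Lemma cmod_cderive_epow l z : 0 <= l -> cmod z < 1 ->
  cmod (cderive (epow (- l)) z) <= l * K * beta (cmod z).
Proof.
move=> l0 z1; rewrite cderive_epow// !cmodM cmod_real normrN ger0_norm// -mulrA.
rewrite -mulrA; apply: ler_wpM2l => //; rewrite -[leRHS]mulr1.
apply: ler_pM; rewrite ?cmod_ge0//; first exact: dF.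
by apply: cmod_epow_le1 => //; rewrite oppr_le0.
Qed.

Definition dil r z := F (r%:C * z) - F z.

Let cmod_r r : 0 <= r -> cmod r%:C = r.
Proof. by move=> r0; rewrite cmod_real ger0_norm. Qed.

Let cmod_rz r z : 0 <= r -> r <= 1 -> cmod (r%:C * z) <= cmod z.
Proof. by move=> r0 r1; rewrite cmodM cmod_r// ler_piMl ?cmod_ge0. Qed.

Lemma holo_dil r : 0 <= r -> r <= 1 -> holo (dil r).
Proof. by move=> r0 r1; apply: holoB => //; apply: holo_dilate => //; rewrite cmod_r. Qed.

Lemma cderive_dil r z : 0 <= r -> r <= 1 -> cmod z < 1 ->
  cderive (dil r) z = r%:C * cderive F (r%:C * z) - cderive F z.
Proof.
move=> r0 r1 z1; have r1' : cmod r%:C <= 1 by rewrite cmod_r.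
by rewrite cderiveB ?cderive_dilate//; exact: holo_dilate.
Qed.

Lemma cderive_dil_le r z : 0 <= r -> r <= 1 -> cmod z < 1 ->
  cmod (cderive (dil r) z) <= 2 * K * beta (cmod z).
Proof.
move=> r0 r1 z1; rewrite cderive_dil//; apply: le_trans (ler_cmodB _ _) _.
have rz := cmod_rz z r0 r1.
have h1 : cmod (r%:C * cderive F (r%:C * z)) <= K * beta (cmod z).
  rewrite cmodM cmod_r// -[leRHS]mul1r; apply: ler_pM; rewrite ?cmod_ge0//.
  apply: le_trans (dF (le_lt_trans rz z1)) _; apply: ler_wpM2l => //.
  exact: beta_mono (cmod_ge0 _) rz z1.
by rewrite -mulrA mulr_natl mulr2n; apply: lerD => //; exact: dF.
Qed.

Lemma dil_small q e : 0 <= q -> q < 1 -> 0 < e ->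
  exists r, [/\ 0 <= r, r < 1 & forall z, cmod z <= q ->
    cmod (dil r z) <= e /\ cmod (cderive (dil r) z) <= e].
Proof.
move=> q0 q1 e0; have e2 : 0 < e / 2 by rewrite divr_gt0.
have [r1 [r10 r11 H1]] := dilate_uniform holoF q0 q1 e0.
have [r2 [r20 r21 H2]] := dilate_uniform (holo_cderive holoF) q0 q1 e2.
have [B [B0 HB]] := holo_bounded (holo_cderive holoF) q0 q1.
have B1 : 0 < B + 1 by lra.
pose s := e / 2 / (B + 1).
have s0 : 0 < s by rewrite divr_gt0.
pose r := Num.max r1 (Num.max r2 (1 - s)).
have rr1 : r1 <= r by rewrite le_max lexx.
have rr2 : r2 <= r by rewrite !le_max lexx orbT.
have rr3 : 1 - s <= r by rewrite !le_max lexx !orbT.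
have r0 : 0 <= r := le_trans r10 rr1.
have rlt1 : r < 1 by rewrite !gt_max r11 r21/= ltrBlDr ltrDl.
exists r; split => // z zq; have z1 := le_lt_trans zq q1.
split; first exact: H1 rr1 (ltW rlt1) z zq.
rewrite cderive_dil ?(ltW rlt1)//.
have -> : r%:C * cderive F (r%:C * z) - cderive F z =
    r%:C * (cderive F (r%:C * z) - cderive F z) - (1 - r)%:C * cderive F z.
  by rewrite rmorphB rmorph1 mulrBr mulrBl mul1r opprB addrA subrK.
apply: le_trans (ler_cmodB _ _) _; rewrite [leRHS](splitr e); apply: lerD.
  rewrite cmodM cmod_r// -[leRHS]mul1r; apply: ler_pM; rewrite ?cmod_ge0 ?(ltW rlt1)//.
  exact: H2 rr2 (ltW rlt1) z zq.
rewrite cmodM cmod_r ?subr_ge0 ?(ltW rlt1)//.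
have h : (1 - r) * (B + 1) <= e / 2 by rewrite -ler_pdivlMr// -/s; lra.
apply: le_trans h; apply: ler_wpM2l; first by rewrite subr_ge0 ltW.
by rewrite (le_trans (HB z zq))// lerDl.
Qed.

(** The quotient of epow (- l) by its dilation has p-th power modulus equal to the
    square of a function whose mean squares grow like the power 8 (K p l)^2 of
    Lam; for small l this barely affects the exponent p / 2 of the weight. *)
Lemma dil_exp_energy l G M : 0 <= l -> 0 <= M -> holo G ->
  (forall z, cmod z < 1 -> cmod (G z) <= M) ->
  (forall z, cmod z < 1 -> cmod (cderive G z) <= M * beta (cmod z)) ->
  exists A, 0 <= A /\ forall r, 0 <= r -> r <= 1 -> forall j,
    (\int[leb2]_(w in annulus (dyad j) (dyad j.+1))
     ((1 - cmod (@xy_complex R w)) `^ (p - 1) *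
      cmod (cderive (fun z => G z * (cexp (l%:C * dil r z) - 1)) (xy_complex w)) `^ p)%:E <=
   (A * Lam (dyad j.+1) `^ (8 * (K * p * l) ^+ 2 - p / 2))%:E)%E.
Proof.
move=> l0 M0 hG Gb dGb.
have p0 : 0 <= p := le_trans (ler0n R 2) (ltW p2).
pose M1 := 2 * (M * (1 + 2 * K * l)).
have M10 : 0 <= M1.
  by rewrite /M1; apply: mulr_ge0 => //; apply: mulr_ge0 => //; rewrite addr_ge0 ?mulr_ge0.
exists (6 * area1 * 2 `^ (p / 2) * M1 `^ p); split.
  by rewrite !mulr_ge0 ?powR_ge0 ?(ltW area1_gt0).
move=> r r0 r1 j; have hD := holo_dil r0 r1.
pose h z := cexp (l%:C * dil r z).
have hh : holo h by exact/holo_cexp/holoZ.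
have h1 : holo (fun z => h z - 1) by apply: holoB => //; exact: holo_cst.
pose m := l * p / 2.
have m0 : 0 <= m by rewrite /m !mulr_ge0.
pose k z := cexp (m%:C * dil r z).
have hk : holo k by exact/holo_cexp/holoZ.
have [a Ha ka] := hk.
have k0 : k 0 = 1 by rewrite /k /dil mulr0 subrr mulr0 cexp0.
have a0 : a 0%N = 1 by rewrite -pval0 -ka ?cmod0.
have c0 : 0 <= K * p * l by rewrite !mulr_ge0.
have growth w : cmod w < 1 ->
    cmod (pval (pder a) w) <= K * p * l * beta (cmod w) * cmod (pval a w).
  move=> w1; rewrite -(cderive_pval Ha ka w1) -ka// cderive_cexp//; last exact: holoZ.
  rewrite cderiveZ// !cmodM cmod_r//; apply: ler_wpM2r; first exact: cmod_ge0.
  apply: le_trans (ler_wpM2l m0 (cderive_dil_le r0 r1 w1)) _.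
  by rewrite /m; move: (beta _) => b; rewrite le_eqVlt; apply/orP; left; apply/eqP; field.
have msqa x : 0 <= x -> x < 1 -> msq a x <= Lam x `^ (8 * (K * p * l) ^+ 2).
  move=> x0 x1; have := msq_growth Ha c0 growth x0 x1.
  by rewrite msq0 a0 cmod1 expr1n mul1r powR_pos// Lam_gt0.
have hE w : cmod (h w) `^ p = cmod (k w) ^+ 2.
  rewrite /h /k !cmod_cexp !cReZ powR_pos ?expR_gt0// expRK expr2 -expRD; congr expR.
  by rewrite /m; move: (complex.Re _) => D; field.
apply: (annulus_energy_le (gam := 8 * (K * p * l) ^+ 2) j (powR_ge0 M1 p) _ p0 _ Ha msqa).
- by rewrite mulr_ge0 ?sqr_ge0.
- by apply: holo_cmeasurable; apply: holo_cderive; exact: holoM.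
move=> w w1; have b0 := beta_gt0 (cmod_ge0 w) w1.
rewrite cderiveM// cderiveB//; last exact: holo_cst.
rewrite cderive_cst subr0 cderive_cexp//; last exact: holoZ.
rewrite cderiveZ// -/(h w) -ka// -hE.
have step : cmod (cderive G w * (h w - 1) + G w * (l%:C * cderive (dil r) w * h w)) <=
    M * (1 + 2 * K * l) * beta (cmod w) * (1 + cmod (h w)).
  apply: le_trans (ler_cmodD _ _) _; rewrite !cmodM cmod_r//.
  have e1 : cmod (h w - 1) <= 1 + cmod (h w).
    by rewrite (le_trans (ler_cmodB _ _))// addrC cmod1.
  have e2 : cmod (cderive G w) * cmod (h w - 1) <= M * beta (cmod w) * (1 + cmod (h w)).
    by apply: ler_pM; rewrite ?cmod_ge0//; exact: dGb.
  have e3 : cmod (G w) * (l * cmod (cderive (dil r) w) * cmod (h w)) <=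
      M * (l * (2 * K * beta (cmod w)) * (1 + cmod (h w))).
    apply: ler_pM; rewrite ?cmod_ge0 ?mulr_ge0 ?cmod_ge0//; first exact: Gb.
    apply: ler_pM; rewrite ?mulr_ge0 ?cmod_ge0//; last by rewrite lerDr.
    by apply: ler_wpM2l => //; exact: cderive_dil_le.
  apply: le_trans (lerD e2 e3) _.
  by rewrite le_eqVlt; apply/orP; left; apply/eqP; ring.
apply: le_trans (powR_mono p0 (cmod_ge0 _) step) _.
have H0 := cmod_ge0 (h w).
have V0 : 0 <= 1 + 2 * K * l by rewrite addr_ge0 ?mulr_ge0.
have V1 : 0 <= 2 * K * l by rewrite !mulr_ge0.
have W0 : 0 <= M * (1 + 2 * K * l) by apply: mulr_ge0.
rewrite powRM ?mulr_ge0 ?(ltW b0) ?addr_ge0//.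
apply: le_trans (ler_wpM2l (powR_ge0 _ _) (powR_sum_le p0 ler01 H0)) _.
rewrite powR1 /M1 !powRM ?(ltW b0)//.
rewrite le_eqVlt; apply/orP; left; apply/eqP.
by move: (_ `^ _) (_ `^ _) (_ `^ _) (_ `^ _) => A1 A2 A3 A4; ring.
Qed.

Lemma small_powR_factor (A e : R) : 0 <= A -> 0 < e -> exists d : R, [/\ 0 < d, d <= e & A * d `^ p <= e].
Proof.
move=> A0 e0; have p0 : 0 < p := lt_trans (ltr0n R 2) p2.
have A1 : 0 < A + 1 by rewrite ltr_wpDl.
pose d := (e / (A + 1)) `^ p^-1.
have d0 : 0 < d by rewrite powR_gt0 ?divr_gt0.
exists (Num.min d e); split; first by rewrite lt_min d0 e0.
  by rewrite ge_min lexx orbT.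
have m0 : 0 <= Num.min d e by rewrite le_min !ltW.
apply: (@le_trans _ _ ((A + 1) * d `^ p)).
  apply: ler_pM => //; [exact: powR_ge0|by rewrite lerDl|].
  by apply: powR_mono => //; [exact: ltW|rewrite ge_min lexx].
rewrite /d -powRrM mulVf ?gt_eqF// powRr1; last by rewrite divr_ge0 ?ltW.
by rewrite mulrC divfK ?gt_eqF.
Qed.

(** One approximate inversion of the factor epow (- l): dilate it, then replace
    the inverse of the dilation, analytic across the circle, by a Taylor
    polynomial. *)
Lemma approx_factor_inverse l G M e : 0 <= l -> 8 * (K * p * l) ^+ 2 < p / 2 - 1 ->
  0 <= M -> 0 < e -> holo G ->
  (forall z, cmod z < 1 -> cmod (G z) <= M) ->
  (forall z, cmod z < 1 -> cmod (cderive G z) <= M * beta (cmod z)) ->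
  exists P : {poly R[i]},
    (energy p (cderive (fun z => G z * (epow (- l) z * P.[z] - 1))%R) <= e%:E)%E /\
    cmod (G 0 * (epow (- l) 0 * P.[0] - 1)) <= e.
Proof.
move=> l0 gam M0 e0 hG Gb dGb.
have p0 : 0 <= p := le_trans (ler0n R 2) (ltW p2).
have p1 : 1 <= p := le_trans (ler1n R 2) (ltW p2).
have tp : 0 < 2 `^ p :> R by rewrite powR_gt0.
pose e1 := e / (2 `^ p * 2).
have e10 : 0 < e1 by rewrite divr_gt0 ?mulr_gt0.
have [A [A0 HA]] := dil_exp_energy l0 M0 hG Gb dGb.
pose q := p / 2 - 8 * (K * p * l) ^+ 2.
have q1 : 1 < q by rewrite /q ltrBrDr addrC -ltrBrDr.
have [m [del [del0 Hdel]]] := energy_small p1 q1 A0 e10.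
have m0 : 0 <= dyad m :> R := dyad_ge0 m; have m1 : dyad m < 1 :> R := dyad_lt1 m.
pose B := M * beta (dyad m : R).
have B0 : 0 <= B by rewrite mulr_ge0// ltW// beta_gt0.
(* On |z| < dyad m the derivative of G (h - 1) is at most Q eta if dil r and its
   derivative are at most eta; the first bound on eta keeps the exponent
   l (dil r z) below 1/2. *)
pose Q := l * (6 * B + 4 * M).
have Q0 : 0 <= Q by rewrite /Q mulr_ge0// addr_ge0// mulr_ge0.
pose eta := Num.min (2 * (l + 1))^-1 (del / (Q + 1)).
have l1 : 0 < l + 1 by rewrite ltr_wpDl.
have Q1 : 0 < Q + 1 by rewrite ltr_wpDl.
have eta0 : 0 < eta by rewrite lt_min invr_gt0 mulr_gt0//= divr_gt0.
have leta : l * eta <= 2^-1.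
  apply: (@le_trans _ _ ((l + 1) * (2 * (l + 1))^-1)).
    by apply: ler_pM; rewrite ?(ltW eta0) ?lerDl ?ge_min ?lexx.
  by rewrite invfM mulrCA mulfV ?gt_eqF// mulr1.
have Qeta : Q * eta <= del.
  apply: (@le_trans _ _ ((Q + 1) * (del / (Q + 1)))).
    by apply: ler_pM; rewrite ?(ltW eta0) ?lerDl ?ge_min ?lexx ?orbT.
  by rewrite mulrC divfK ?gt_eqF.
have [r [r0 r1 Hr]] := dil_small m0 m1 eta0.
pose h z := cexp (l%:C * dil r z).
have hD := holo_dil r0 (ltW r1).
have hh : holo h by exact/holo_cexp/holoZ.
have hh1 : holo (fun z => h z - 1) by apply: holoB => //; exact: holo_cst.
have E1 : (energy p (cderive (fun z => G z * (h z - 1))%R) <= e1%:E)%E.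
  apply: Hdel; first by apply: holo_cmeasurable; apply: holo_cderive; exact: holoM.
    by move=> j; rewrite opprB; exact: HA r0 (ltW r1) j.
  move=> w wm; have w1 := lt_trans wm m1.
  have [D1 D2] := Hr w (ltW wm).
  rewrite cderiveM// cderiveB//; last exact: holo_cst.
  rewrite cderive_cst subr0 cderive_cexp//; last exact: holoZ.
  rewrite cderiveZ// -/(h w).
  have ld : cmod (l%:C * dil r w) <= l * eta.
    by rewrite cmodM cmod_r//; apply: ler_wpM2l.
  have h6 : cmod (h w - 1) <= 6 * (l * eta).
    have := cexp_taylor1 (le_trans ld leta); set x := cmod _ in ld * => t.
    have x0 : 0 <= x := cmod_ge0 _.
    have -> : h w - 1 = (cexp (l%:C * dil r w) - 1 - l%:C * dil r w) + l%:C * dil r w.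
      by rewrite subrK.
    apply: le_trans (ler_cmodD _ _) _; apply: le_trans (lerD t (lexx _)) _.
    rewrite -/x; have x2 : x ^+ 2 <= 2^-1 * x.
      by rewrite expr2; apply: ler_wpM2r => //; exact: le_trans ld leta.
    by move: ld x2; move: (l * eta) => y ld x2; lra.
  have h4 : cmod (h w) <= 4.
    rewrite -[h w](subrK 1); apply: le_trans (ler_cmodD _ _) _; rewrite cmod1.
    by move: leta h6; move: (l * eta) (cmod _) => y x ? ?; lra.
  apply: le_trans (ler_cmodD _ _) _; rewrite !cmodM cmod_r//.
  have t1 : cmod (cderive G w) * cmod (h w - 1) <= B * (6 * (l * eta)).
    apply: ler_pM; rewrite ?cmod_ge0//; apply: le_trans (dGb _ w1) _.
    by apply: ler_wpM2l => //; exact: beta_mono (cmod_ge0 _) (ltW wm) m1.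
  have t2 : cmod (G w) * (l * cmod (cderive (dil r) w) * cmod (h w)) <= M * (l * eta * 4).
    apply: ler_pM; rewrite ?mulr_ge0 ?cmod_ge0//; first exact: Gb.
    by apply: ler_pM; rewrite ?mulr_ge0 ?cmod_ge0//; exact: ler_wpM2l.
  apply: le_trans (lerD t1 t2) _; apply: le_trans Qeta.
  by rewrite /Q le_eqVlt; apply/orP; left; apply/eqP; ring.
pose psi z := epow l z.
have [E [E0 HE]] := energy_beta p2.
pose M3 := M * (3 + l * K).
have M30 : 0 <= M3 by rewrite /M3 mulr_ge0// addr_ge0 ?mulr_ge0.
have M1 : 0 < M + 1 by rewrite ltr_wpDl.
have e20 : 0 < Num.min e1 (e / (M + 1)) by rewrite lt_min e10 divr_gt0.
have [d [d0 de dp]] := small_powR_factor (mulr_ge0 (powR_ge0 M3 p) E0) e20.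
have [P HP] := dilate_poly_approx (holo_epow l) r0 r1 d0.
have hpsi : holo (fun z => epow l (r%:C * z)).
  by apply: holo_dilate; [rewrite cmod_r// ltW|exact: holo_epow].
have hs := holo_epow (- l).
have hP := @holo_poly R P.
pose g2 z := G z * epow (- l) z * (P.[z] - epow l (r%:C * z)).
have hGs : holo (fun z => G z * epow (- l) z) by exact: holoM.
have hPp : holo (fun z => P.[z] - epow l (r%:C * z)) by exact: holoB.
have hg2 : holo g2 by exact: holoM.
have sle z : cmod z < 1 -> cmod (epow (- l) z) <= 1.
  by move=> z1; apply: cmod_epow_le1; rewrite ?oppr_le0.
have E2 : (energy p (cderive g2) <= e1%:E)%E.
  have := HE (cderive g2) (M3 * d) (mulr_ge0 M30 (ltW d0)).
  rewrite (powRM p M30 (ltW d0)) => /(_ (holo_cmeasurable (holo_cderive hg2))) H.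
  apply: (le_trans (H _)); last first.
    rewrite lee_fin mulrAC; apply: le_trans dp _.
    by rewrite ge_min lexx.
  move=> w w1; have [a1 a2] := HP w w1.
  have b2 := beta_ge_half (cmod_ge0 w) w1.
  have b0 := beta_gt0 (cmod_ge0 w) w1.
  rewrite /g2 cderiveM// cderiveM// cderiveB//.
  have c1 : cmod (cderive G w * epow (- l) w + G w * cderive (epow (- l)) w) <=
      M * (1 + l * K) * beta (cmod w).
    apply: le_trans (ler_cmodD _ _) _; rewrite !cmodM.
    have f1 : cmod (cderive G w) * cmod (epow (- l) w) <= M * beta (cmod w) * 1.
      by apply: ler_pM; rewrite ?cmod_ge0//; [exact: dGb|exact: sle].
    have f2 : cmod (G w) * cmod (cderive (epow (- l)) w) <= M * (l * K * beta (cmod w)).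
      by apply: ler_pM; rewrite ?cmod_ge0//; [exact: Gb|exact: cmod_cderive_epow].
    apply: le_trans (lerD f1 f2) _.
    by rewrite le_eqVlt; apply/orP; left; apply/eqP; ring.
  apply: le_trans (ler_cmodD _ _) _; rewrite ![in leLHS]cmodM.
  have f1 : cmod (cderive G w * epow (- l) w + G w * cderive (epow (- l)) w) *
      cmod (P.[w] - epow l (r%:C * w)) <= M * (1 + l * K) * beta (cmod w) * d.
    by apply: ler_pM; rewrite ?cmod_ge0// cmodB.
  have f2 : cmod (G w) * cmod (epow (- l) w) *
      cmod (cderive (fun z => P.[z]) w - cderive (fun z => epow l (r%:C * z)) w) <=
      M * (2 * beta (cmod w)) * d.
    apply: ler_pM; [exact: mulr_ge0 (cmod_ge0 _) (cmod_ge0 _)|exact: cmod_ge0| |by rewrite cmodB; exact: a2].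
    apply: ler_pM; [exact: cmod_ge0|exact: cmod_ge0|exact: Gb|].
    by apply: le_trans (sle w w1) _; rewrite -ler_pdivrMl// mulr1.
  apply: le_trans (lerD f1 f2) _.
  by rewrite /M3 le_eqVlt; apply/orP; left; apply/eqP; ring.
have split z : G z * (epow (- l) z * P.[z] - 1) = G z * (h z - 1) + g2 z.
  have -> : h z = epow (- l) z * epow l (r%:C * z).
    rewrite /h /epow -cexpD /dil rmorphN; congr cexp; ring.
  by rewrite /g2; ring.
exists P; split.
  have hsum : holo (fun z => G z * (h z - 1) + g2 z) by apply: holoD => //; exact: holoM.
  have hT : holo (fun z => G z * (epow (- l) z * P.[z] - 1)).
    by apply: holo_ext hsum => z _; exact: split.
  have hm1 : holo (fun z => G z * (h z - 1)) by exact: holoM.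
  have := energyD p0 (holo_cmeasurable (holo_cderive hT)) (holo_cmeasurable (holo_cderive hm1))
    (holo_cmeasurable (holo_cderive hg2)) _ E1 E2.
  have -> : 2 `^ p * (e1 + e1) = e.
    by rewrite /e1; field; rewrite gt_eqF.
  apply => w w1; rewrite (cderive_ext (fun z _ => esym (split z)) hsum w1).
  by rewrite cderiveD//; exact: ler_cmodD.
have z1 : cmod (0 : R[i]) < 1 by rewrite cmod0.
rewrite split /h /dil mulr0 subrr mulr0 cexp0 subrr mulr0 add0r /g2 !cmodM.
have [a1 _] := HP 0 z1.
apply: (@le_trans _ _ (M * d)).
  rewrite -[M]mulr1; apply: ler_pM; rewrite ?mulr_ge0 ?cmod_ge0//; last by rewrite cmodB.
  by apply: ler_pM; rewrite ?cmod_ge0//; [exact: Gb|exact: sle].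
have dM : d <= e / (M + 1) by apply: le_trans de _; rewrite ge_min lexx orbT.
apply: (@le_trans _ _ ((M + 1) * (e / (M + 1)))); last by rewrite mulrC divfK ?gt_eqF.
by apply: ler_pM; rewrite ?(ltW d0)// lerDl.
Qed.

(** If P inverts epow (- k l) up to a small error, then G = epow (- k l) P is a
    factor to which approx_factor_inverse applies. *)
Lemma approx_power_inverse l k e : 0 <= l -> 8 * (K * p * l) ^+ 2 < p / 2 - 1 -> 0 < e ->
  exists P : {poly R[i]},
    (energy p (cderive (fun z => epow (- (k%:R * l)) z * P.[z] - 1)%R) <= e%:E)%E /\
    cmod (epow (- (k%:R * l)) 0 * P.[0] - 1) <= e.
Proof.
move=> l0 gam; have p0 : 0 <= p := le_trans (ler0n R 2) (ltW p2).
have tp : 1 <= 2 `^ p :> R.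
  rewrite powR_pos// -[leLHS]expR0 ler_expR mulr_ge0// ltW//.
  by have /andP[] := @ln2_01 R.
have tp0 : 0 < 2 `^ p :> R := lt_le_trans ltr01 tp.
elim: k e => [|k IH] e e0.
  exists 1; rewrite mul0r oppr0.
  have z1 z : epow 0 z * (1 : {poly R[i]}).[z] - 1 = 0 by rewrite epow0 hornerC mul1r subrr.
  rewrite z1 cmod0; split; last exact: ltW.
  have -> : (fun z => epow 0 z * (1 : {poly R[i]}).[z] - 1) = (fun=> 0) by apply/funext.
  have [E [E0 HE]] := energy_beta p2.
  have hz : holo (fun=> 0 : R[i]) := holo_cst 0.
  have := HE _ 0 (lexx 0) (holo_cmeasurable (holo_cderive hz)).
  rewrite powR0 ?mul0r ?gt_eqF//; last exact: lt_trans (ltr0n R 2) p2.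
  move=> H; apply: le_trans (H _) _; last by rewrite lee_fin ltW.
  by move=> w _; rewrite cderive_cst cmod0 mul0r.
pose e1 := e / (2 `^ p * 2).
have e10 : 0 < e1 by rewrite divr_gt0 ?mulr_gt0.
have e1e : e1 + e1 <= e.
  have -> : e1 + e1 = e / 2 `^ p by rewrite /e1; field; rewrite gt_eqF.
  by rewrite ler_pdivrMr// ler_peMr// ltW.
have [P [HP1 HP2]] := IH e1 e10.
have kl0 : 0 <= k%:R * l by rewrite mulr_ge0.
pose G z := epow (- (k%:R * l)) z * P.[z].
have hG : holo G by apply: holoM; [exact: holo_epow|exact: holo_poly].
have [B [B0 HB]] := poly_bounded P; have [B' [B'0 HB']] := poly_bounded P^`().
have sle z : cmod z < 1 -> cmod (epow (- (k%:R * l)) z) <= 1.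
  by move=> z1; apply: cmod_epow_le1; rewrite ?oppr_le0.
pose kl := k%:R * l.
pose M := B + (kl * K * B + 2 * B').
have M20 : 0 <= kl * K * B + 2 * B' by rewrite addr_ge0 ?mulr_ge0.
have M0 : 0 <= M by rewrite addr_ge0.
have Gb z : cmod z < 1 -> cmod (G z) <= M.
  move=> z1; rewrite cmodM; apply: (@le_trans _ _ (1 * B)).
    by apply: ler_pM; rewrite ?cmod_ge0 ?sle ?HB.
  by rewrite mul1r lerDl.
have dGb z : cmod z < 1 -> cmod (cderive G z) <= M * beta (cmod z).
  move=> z1; have b2 := beta_ge_half (cmod_ge0 z) z1.
  have b0 := beta_gt0 (cmod_ge0 z) z1.
  rewrite /G cderiveM//; [|exact: holo_epow|exact: holo_poly].
  apply: le_trans (ler_cmodD _ _) _; rewrite !cmodM cderive_poly//.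
  have f1 : cmod (cderive (epow (- (k%:R * l))) z) * cmod P.[z] <= kl * K * beta (cmod z) * B.
    by apply: ler_pM; rewrite ?cmod_ge0 ?HB//; exact: cmod_cderive_epow.
  have f2 : cmod (epow (- (k%:R * l)) z) * cmod P^`().[z] <= 2 * beta (cmod z) * B'.
    apply: ler_pM; rewrite ?cmod_ge0 ?HB'//; apply: le_trans (sle z z1) _.
    by rewrite -ler_pdivrMl// mulr1.
  apply: le_trans (lerD f1 f2) _.
  rewrite [leLHS](_ : _ = (kl * K * B + 2 * B') * beta (cmod z)); last first.
    by move: (beta _) => b; ring.
  by apply: ler_wpM2r; [exact: ltW|rewrite lerDr].
have [Q [HQ1 HQ2]] := approx_factor_inverse l0 gam M0 e10 hG Gb dGb.
have step z : epow (- (k.+1%:R * l)) z * (P * Q).[z] - 1 =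
    G z * (epow (- l) z * Q.[z] - 1) + (epow (- (k%:R * l)) z * P.[z] - 1).
  have -> : - (k.+1%:R * l) = - (k%:R * l) + (- l) by rewrite -[k.+1%:R]natr1; ring.
  by rewrite -epowD hornerM /G; ring.
have hQ : holo (fun z => G z * (epow (- l) z * Q.[z] - 1)).
  apply: holoM => //; apply: holoB; last exact: holo_cst.
  by apply: holoM; [exact: holo_epow|exact: holo_poly].
have hP1 : holo (fun z => epow (- (k%:R * l)) z * P.[z] - 1) by apply: holoB => //; exact: holo_cst.
have hS := holoD hQ hP1.
have hT : holo (fun z => epow (- (k.+1%:R * l)) z * (P * Q).[z] - 1).
  by apply: holo_ext hS => z _; exact: step.
exists (P * Q); split.
  have := energyD p0 (holo_cmeasurable (holo_cderive hT)) (holo_cmeasurable (holo_cderive hQ))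
    (holo_cmeasurable (holo_cderive hP1)) _ HQ1 HP1.
  have -> : 2 `^ p * (e1 + e1) = e.
    by rewrite /e1; field; rewrite gt_eqF.
  apply => w w1; rewrite (cderive_ext (fun z _ => esym (step z)) hS w1).
  by rewrite cderiveD//; exact: ler_cmodD.
rewrite step; apply: le_trans (ler_cmodD _ _) _.
exact: le_trans (lerD HQ2 HP2) e1e.
Qed.

(** The inner function exp(-F) is an N-th power of factors to which the above
    applies. *)
Lemma approx_inverse e : 0 < e ->
  exists P : {poly R[i]},
    (energy p (cderive (fun z => P.[z] * cexp (- F z) - 1)%R) <= e%:E)%E /\
    cmod (P.[0] * cexp (- F 0) - 1) <= e.
Proof.
move=> e0; have p0 : 0 < p := lt_trans (ltr0n R 2) p2.
have g0 : 0 < p / 2 - 1 by rewrite subr_gt0 ltr_pdivlMr// mul1r.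
pose X := 8 * (K * p) ^+ 2 / (p / 2 - 1).
have X0 : 0 <= X by rewrite divr_ge0 ?(ltW g0)// mulr_ge0 ?sqr_ge0.
pose N := (Num.bound X).+1.
have NX : X < N%:R by rewrite (lt_trans (archi_boundP X0))// ltr_nat.
have N0 : 0 < N%:R :> R by rewrite ltr0n.
have N1 : 1 <= N%:R :> R by rewrite ler1n.
have gam : 8 * (K * p * N%:R^-1) ^+ 2 < p / 2 - 1.
  have -> : 8 * (K * p * N%:R^-1) ^+ 2 = 8 * (K * p) ^+ 2 / N%:R / N%:R.
    by field; rewrite gt_eqF.
  rewrite ltr_pdivrMr//; apply: (@lt_le_trans _ _ (p / 2 - 1)).
    by rewrite ltr_pdivrMr// [ltRHS]mulrC -ltr_pdivrMr.
  by rewrite ler_peMr// ltW.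
have Ni0 : 0 <= N%:R^-1 :> R by rewrite invr_ge0 ltW.
have [P [H1 H2]] := approx_power_inverse N Ni0 gam e0.
have eN z : epow (- (N%:R * N%:R^-1)) z = cexp (- F z).
  by rewrite mulfV ?gt_eqF// /epow rmorphN rmorph1 mulN1r.
exists P; split; last by rewrite mulrC -eN.
have <- : (fun z => epow (- (N%:R * N%:R^-1)) z * P.[z] - 1) = (fun z => P.[z] * cexp (- F z) - 1).
  by apply/funext => z; rewrite eN mulrC.
exact: H1.
Qed.

End Approximation.

(** * Taylor coefficients and energy *)

Section TaylorBlocks.
Local Open Scope complex_scope.
Context {R : realType}.
Local Notation T := (measurableTypeR R).
Local Notation xy := (@xy_complex R).
Implicit Types (p : R) (f : R[i] -> R[i]) (a : nat -> R[i]).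

(** (1 - 1/n)^n increases along the powers of 2, from its value 1/4 at n = 2. *)
Lemma dyad_power_ge j : 4^-1 <= dyad j.+1 ^+ (2 ^ j.+1)%N :> R.
Proof.
elim: j => [|j IH]; first by rewrite /dyad !expr1 expr2; lra.
rewrite [(2 ^ j.+2)%N]expnS exprM; apply: le_trans IH _.
apply: lerXn2r; rewrite ?nnegrE ?sqr_ge0 ?dyad_ge0//.
rewrite /dyad [2^-1 ^+ j.+2]exprS; move: (2^-1 ^+ j.+1) => u.
by have := sqr_ge0 u; rewrite !expr2; lra.
Qed.

(** The contractive inclusion of l^2 in l^p. *)
Lemma sum_powR_le p (x : nat -> R) m n : 2 < p -> (forall i, 0 <= x i) ->
  \sum_(m <= i < n) x i `^ p <= (\sum_(m <= i < n) x i ^+ 2) `^ (p / 2).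
Proof.
move=> p2 x0; set S := \sum_(m <= i < n) x i ^+ 2.
have q1 : 1 < p / 2 by rewrite ltr_pdivlMr// mul1r.
have S0 : 0 <= S by apply: sumr_ge0 => i _; exact: sqr_ge0.
have split y : 0 <= y -> y `^ (p / 2) = y * y `^ (p / 2 - 1).
  rewrite le_eqVlt => /orP[/eqP <-|y0].
    by rewrite mul0r powR0// gt_eqF// (lt_trans ltr01).
  by rewrite !powR_pos// -{2}[y]lnK ?posrE// -expRD; congr expR; ring.
have xE i : x i `^ p = (x i ^+ 2) `^ (p / 2).
  by rewrite -powR_mulrn// -powRrM; congr (_ `^ _); field.
rewrite split// /S mulr_suml; apply: ler_sum_nat => i /andP[mi im].
rewrite xE split ?sqr_ge0//; apply: ler_wpM2l; first exact: sqr_ge0.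
apply: powR_mono; [by rewrite subr_ge0 ltW|exact: sqr_ge0|].
rewrite /S (bigD1_seq i) ?iota_uniq ?mem_index_iota ?mi//= lerDl.
by apply: sumr_ge0 => k _; exact: sqr_ge0.
Qed.

(** The coefficients of index in [2^j, 2^(j+1)[ are seen by the mean square of
    the derivative at distance 2^-(j+1) from the circle. *)
Lemma block_square_sum a j : rad1 a ->
  \sum_(2 ^ j <= i < 2 ^ j.+1) cmod (a i) ^+ 2 <=
  16 * (2^-1 ^+ j) ^+ 2 * msq (pder a) (dyad j.+1 ^+ 2).
Proof.
move=> Ha; set x := dyad j.+1 ^+ 2; set u := 2^-1 ^+ j : R.
have d0 := @dyad_ge0 R j.+1; have d1 := @dyad_lt1 R j.+1.
have x0 : 0 <= x := sqr_ge0 _.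
have x1 : x < 1 by rewrite exprn_ilt1.
apply: (@le_trans _ _ (\sum_(2 ^ j <= i < 2 ^ j.+1) 16 * u ^+ 2 * (cmod (pder a i.-1) ^+ 2 * x ^+ i.-1))).
  apply: ler_sum_nat => i /andP[ji ij].
  have i0 : (0 < i)%N by rewrite (leq_trans _ ji)// expn_gt0.
  rewrite /pder prednK// cmodM cmod_nat exprMn.
  have h1 : 16^-1 <= x ^+ i.-1.
    have h : 16^-1 <= x ^+ (2 ^ j.+1)%N.
      rewrite /x -exprM mulnC exprM (_ : 16^-1 = 4^-1 ^+ 2); last by rewrite expr2; lra.
      by apply: lerXn2r; rewrite ?nnegrE ?exprn_ge0 ?invr_ge0// dyad_power_ge.
    apply: le_trans h _; apply: ler_wiXn2l => //; first exact: ltW.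
    by rewrite (leq_trans (leq_pred i))// ltnW.
  have h2 : 1 <= u * i%:R.
    have : (2 ^ j)%:R <= i%:R :> R by rewrite ler_nat.
    by rewrite natrX => h; rewrite /u exprVn mulrC ler_pdivlMr ?exprn_gt0// mul1r.
  have h3 : 1 <= (u * i%:R) ^+ 2 by rewrite exprn_ege1.
  have -> : 16 * u ^+ 2 * (i%:R ^+ 2 * cmod (a i) ^+ 2 * x ^+ i.-1) =
      cmod (a i) ^+ 2 * ((u * i%:R) ^+ 2 * (16 * x ^+ i.-1)).
    by rewrite exprMn; set X := x ^+ i.-1; ring.
  apply: ler_peMr; first exact: sqr_ge0.
  rewrite -[leLHS]mulr1; apply: ler_pM => //.
  by rewrite [leRHS]mulrC -ler_pdivrMr// mul1r.
rewrite -mulr_sumr; apply: ler_wpM2l; first by rewrite mulr_ge0 ?sqr_ge0.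
apply: le_trans (psum_le_msq (2 ^ j.+1) (rad1_pder Ha) x0 x1).
rewrite -(big_mkord xpredT (fun n => cmod (pder a n) ^+ 2 * x ^+ n)).
have [m e] : exists m, (2 ^ j)%N = m.+1 by exists (2 ^ j).-1; rewrite prednK ?expn_gt0.
rewrite e big_add1 /=.
have F0 n : 0 <= cmod (pder a n) ^+ 2 * x ^+ n by rewrite mulr_ge0 ?sqr_ge0 ?exprn_ge0.
have mn : (m <= (2 ^ j.+1).-1)%N.
  by rewrite expnS e mul2n -addnn addSn /= leq_addr.
rewrite [leRHS](@big_cat_nat _ _ _ m 0%N)//=; last by rewrite (leq_trans mn) ?leq_pred.
rewrite [X in _ + X](@big_cat_nat _ _ _ (2 ^ j.+1).-1)//= ?leq_pred//.
rewrite addrCA lerDl addr_ge0//; apply: sumr_ge0 => i _; exact: F0.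
Qed.

(** The factor 2^9 collects 16 from block_square_sum, 2 from annulus_mean_lower
    and 4^2 from the width of the annulus of index j + 1. *)
Definition cblock p : R := (2 ^+ 9) `^ (p / 2) / area1.

Lemma cblock_gt0 p : 0 < cblock p.
Proof. by apply: divr_gt0; [apply: powR_gt0; exact: exprn_gt0|exact: area1_gt0]. Qed.

(** In the annulus of index j + 1 the mean square of the derivative that controls
    the block becomes a p-th mean. *)
Lemma block_le_annulus a p j : 2 < p -> rad1 a ->
  ((\sum_(2 ^ j <= i < 2 ^ j.+1) cmod (a i) `^ p / cblock p)%:E <=
   \int[leb2]_(w in annulus (dyad j.+1) (dyad j.+2))
     ((1 - cmod (xy w)) `^ (p - 1) * cmod (pval (pder a) (xy w)) `^ p)%:E)%E.
Proof.
move=> p2 Ha; set b := dyad j.+1 : R; set c := dyad j.+2 : R.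
have p0 : 0 <= p := le_trans (ler0n R 2) (ltW p2).
have p1 : 0 <= p - 1 by rewrite subr_ge0 (le_trans _ (ltW p2))// ler1n.
have q1 : 1 < p / 2 by rewrite ltr_pdivlMr// mul1r.
have q0 : 0 <= p / 2 by rewrite divr_ge0.
have Hb := rad1_pder Ha; have ar0 := @area1_gt0 R.
have b0 : 0 <= b := dyad_ge0 _; have bc : b < c := dyad_ltS _.
have c1 : c < 1 := dyad_lt1 _.
pose v := 2^-1 ^+ j.+2 : R.
have v0 : 0 < v by rewrite exprn_gt0.
have cv : 1 - c = v := dyad_gap _.
have mp : measurable_fun (annulus b c) (fun w => cmod (pval (pder a) (xy w)) : T).
  exact: measurable_cmod_annulus (ltW c1) (measurable_pval Hb).
have mpp : measurable_fun (annulus b c) (fun w => cmod (pval (pder a) (xy w)) `^ p : T).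
  exact: (measurableT_comp (measurable_powR _)).
set m := msq (pder a) (b ^+ 2).
have m0 : 0 <= m.
  apply: msq_ge0 => //; first exact: sqr_ge0.
  by rewrite exprn_ilt1// (lt_trans bc).
apply: (@le_trans _ _ ((v `^ (p - 1))%:E *
    \int[leb2]_(w in annulus b c) (cmod (pval (pder a) (xy w)) `^ p)%:E)%E); last first.
  rewrite -ge0_integralZl//; last 4 first.
  - exact: measurable_annulus.
  - exact/measurable_EFinP.
  - by move=> w _; rewrite lee_fin powR_ge0.
  - by rewrite lee_fin powR_ge0.
  apply: ge0_le_integral.
  - exact: measurable_annulus.
  - by move=> w _; rewrite -EFinM lee_fin mulr_ge0 ?powR_ge0.
  - by apply: measurable_funeM; exact/measurable_EFinP.
  - apply/measurable_EFinP; apply: measurable_funS (measurable_energy p (measurable_pval Hb)).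
      exact: measurable_odisc.
    exact: annulus_odisc (ltW c1).
  move=> w /andP[_ wc]; rewrite -EFinM lee_fin; apply: ler_wpM2r; first exact: powR_ge0.
  apply: powR_mono => //; first exact: ltW.
  by rewrite -cv lerD2l lerN2 ltW.
have := annulus_mean_lower Hb b0 bc c1 q1; rewrite -/m (_ : 2 * (p / 2) = p) => [low|]; last by field.
apply: le_trans (lee_wpmul2l _ low); last by rewrite lee_fin powR_ge0.
rewrite -EFinM lee_fin -mulr_suml ler_pdivrMr ?cblock_gt0//.
apply: le_trans (sum_powR_le _ _ p2 (fun i => cmod_ge0 _)) _.
have S0 : 0 <= \sum_(2 ^ j <= i < 2 ^ j.+1) cmod (a i) ^+ 2.
  by apply: sumr_ge0 => i _; exact: sqr_ge0.
apply: le_trans (powR_mono q0 S0 (block_square_sum j Ha)) _; rewrite -/b -/m.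
have area : v * area1 <= (c ^+ 2 - b ^+ 2) * area1.
  apply: ler_wpM2r; first exact: ltW.
  have b2 : 1 - b = 2 * v by rewrite dyad_gap /v [in RHS]exprS mulrA mulfV// mul1r.
  have bh : 2^-1 <= b.
    have := @dyad_homo R 1 j.+1 isT; rewrite -/b /dyad expr1; lra.
  have -> : c ^+ 2 - b ^+ 2 = v * (b + c).
    rewrite subr_sqr (_ : c - b = v); last by rewrite -[c](subKr 1) cv; lra.
    by rewrite (addrC b).
  by apply: ler_peMr; [exact: ltW|lra].
apply: (@le_trans _ _ (v `^ (p - 1) * ((m / 2) `^ (p / 2) * (v * area1)) * cblock p)); last first.
  apply: ler_wpM2r; first by rewrite ltW// cblock_gt0.
  apply: ler_wpM2l; first exact: powR_ge0.
  by apply: ler_wpM2l => //; exact: powR_ge0.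
have u4 : 2^-1 ^+ j = 4 * v by rewrite /v !exprS; move: (_ ^+ _) => X; field.
have -> : 16 * (2^-1 ^+ j) ^+ 2 * m = 2 ^+ 9 * (v ^+ 2 * (m / 2)) by rewrite u4; field.
have m2 : 0 <= m / 2 by rewrite divr_ge0.
have c9 : 0 <= 2 ^+ 9 :> R by exact: exprn_ge0.
have v2 := sqr_ge0 v.
rewrite (powRM _ c9 (mulr_ge0 v2 m2)) (powRM _ v2 m2).
have -> : (v ^+ 2) `^ (p / 2) = v `^ (p - 1) * v.
  rewrite -powR_mulrn ?(ltW v0)// -powRrM !powR_pos//.
  transitivity (expR ((p - 1) * ln v) * expR (ln v)); last by rewrite lnK.
  by rewrite -expRD; congr expR; field.
rewrite le_eqVlt; apply/orP; left; apply/eqP; rewrite /cblock.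
by move: (_ `^ _) (_ `^ _) (_ `^ _) => A1 A2 A3; field; rewrite gt_eqF.
Qed.

Lemma coef_sum_le_energy f a p (E : R) n : 2 < p -> rad1 a ->
  (forall z, cmod z < 1 -> f z = pval a z) -> (energy p (cderive f) <= E%:E)%E ->
  \sum_(1 <= i < 2 ^ n) cmod (a i) `^ p <= cblock p * E.
Proof.
move=> p2 Ha fa HE; have C0 := cblock_gt0 p.
have hf : holo (cderive f) by apply: holo_cderive; exists a.
pose I j := (\int[leb2]_(w in annulus (dyad j) (dyad j.+1))
  ((1 - cmod (xy w)) `^ (p - 1) * cmod (cderive f (xy w)) `^ p)%:E)%E.
have I0 j : (0 <= I j)%E.
  by apply: integral_ge0 => w _; rewrite lee_fin mulr_ge0 ?powR_ge0.
have IE j : I j.+1 = (\int[leb2]_(w in annulus (dyad j.+1) (dyad j.+2))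
     ((1 - cmod (xy w)) `^ (p - 1) * cmod (pval (pder a) (xy w)) `^ p)%:E)%E.
  apply: eq_integral => w; rewrite inE => /andP[_ wc].
  by rewrite (cderive_pval Ha fa)// (lt_trans wc (dyad_lt1 _)).
have step : ((\sum_(1 <= i < 2 ^ n) cmod (a i) `^ p / cblock p)%:E <= \sum_(0 <= j < n.+1) I j)%E.
  elim: n => [|n IH].
    by rewrite expn0 big_geq// big_nat1.
  rewrite (@big_cat_nat _ _ _ (2 ^ n)) ?expn_gt0 ?leq_exp2l//= EFinD big_nat_recr//=.
  apply: leeD => //; rewrite IE; exact: block_le_annulus.
have := le_trans step (le_trans (nneseries_lim_ge n.+1 (fun j _ _ => I0 j)) _).
rewrite -energy_dyadic; last exact: holo_cmeasurable.
by move=> /(_ _ HE); rewrite lee_fin -mulr_suml ler_pdivrMr// mulrC.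
Qed.

End TaylorBlocks.

(** * Cyclicity *)

Section Norms.
Local Open Scope complex_scope.
Context {R : realType}.
Local Notation xy := (@xy_complex R).
Implicit Types (p : R) (f : R[i] -> R[i]).

Lemma le_poweR (x : \bar R) (y r : R) : 0 <= r -> (0 <= x)%E -> (x <= y%:E)%E ->
  (x `^ r <= (y `^ r)%:E)%E.
Proof.
move=> r0 x0 xy; rewrite -poweR_EFin; apply: gt0_ler_poweR => //.
  by rewrite in_itv/= x0 leey.
by rewrite in_itv/= (le_trans x0 xy) leey.
Qed.

Lemma D_normE p f : D_norm p f = ((cmod (f 0))%:E + energy p (cderive f) `^ p^-1)%E.
Proof. by rewrite /D_norm odiscE. Qed.

Lemma energy_ge0 p f : (0 <= energy p f)%E.
Proof. by apply: integral_ge0 => w _; rewrite lee_fin mulr_ge0 ?powR_ge0. Qed.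

Lemma D_norm_le p f (E : R) : 0 <= p -> (energy p (cderive f) <= E%:E)%E ->
  (D_norm p f <= (cmod (f 0) + E `^ p^-1)%:E)%E.
Proof.
move=> p0 HE; rewrite D_normE EFinD; apply: leeD => //.
by apply: le_poweR => //; [rewrite invr_ge0|exact: energy_ge0].
Qed.

Lemma D_norm_ge0 p f : (0 <= D_norm p f)%E.
Proof. by rewrite D_normE adde_ge0 ?lee_fin ?cmod_ge0 ?poweR_ge0. Qed.

Lemma lA_norm_ge0 p f : (0 <= lA_norm p f)%E.
Proof. exact: poweR_ge0. Qed.

Lemma lA_norm_le p f (E : R) : 2 < p -> holo f -> (energy p (cderive f) <= E%:E)%E ->
  (lA_norm p f <= ((cmod (f 0) `^ p + cblock p * E) `^ p^-1)%:E)%E.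
Proof.
move=> p2 [a Ha fa] HE; have p0 : 0 <= p := le_trans (ler0n R 2) (ltW p2).
have t0 k : (0 <= (cmod (taylor_coef f k) `^ p)%:E)%E by rewrite lee_fin powR_ge0.
apply: le_poweR; [by rewrite invr_ge0|exact: nneseries_ge0|].
apply: lime_le; first exact: is_cvg_nneseries.
apply: nearW => n; rewrite sumEFin lee_fin.
have -> : f 0 = a 0%N by rewrite fa ?cmod0// pval0.
apply: (@le_trans _ _ (\sum_(0 <= k < 2 ^ n) cmod (a k) `^ p)).
  rewrite [leRHS](@big_cat_nat _ _ _ n)//=; last by rewrite ltnW// ltn_expl.
  rewrite (eq_bigr (fun k => cmod (a k) `^ p)) ?lerDl.
    by apply: sumr_ge0 => k _; exact: powR_ge0.
  by move=> k _; rewrite (taylor_coef_pval k Ha fa).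
rewrite big_ltn ?expn_gt0// lerD2l.
exact: coef_sum_le_energy p2 Ha fa HE.
Qed.

Lemma cyclic_of_approx (nrm : (R[i] -> R[i]) -> \bar R) f :
  (forall g, (0 <= nrm g)%E) -> in_space nrm f ->
  (forall e : R, 0 < e -> exists P : {poly R[i]},
     (nrm (fun z => P.[z] * f z - 1)%R <= e%:E)%E) ->
  cyclic_in nrm f.
Proof.
move=> n0 Hf H; split => //.
have h n : exists P : {poly R[i]}, (nrm (fun z => P.[z] * f z - 1)%R <= (n.+1%:R^-1)%:E)%E.
  by apply: H; rewrite invr_gt0.
have [P HP] := choice h; exists P.
apply: (@squeeze_cvge _ _ _ _ (fun=> 0%E) _ (fun n => (n.+1%:R^-1)%:E)).
- by apply: nearW => n; rewrite n0 HP.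
- exact: cvg_cst.
by apply: cvg_EFin; [exact: nearW|exact: cvg_harmonic].
Qed.

Lemma holo_analytic f : holo f -> analytic_on_disc f.
Proof.
move=> hf z; rewrite /unit_disc /= normc_cmod ltcR => z1.
exact: cdiff_derivable (holo_cdiff hf z1).
Qed.

End Norms.

Section Cyclicity.
Local Open Scope complex_scope.
Context {R : realType}.
Context (S F : R[i] -> R[i]) (K p : R).
Context (holoF : holo F) (K0 : 0 <= K) (p2 : 2 < p).
Context (ReF : forall z, cmod z < 1 -> 0 <= complex.Re (F z)).
Context (dF : forall z, cmod z < 1 -> cmod (cderive F z) <= K * beta (cmod z)).
Context (SF : forall z, cmod z < 1 -> S z = cexp (- F z)).

Let p0 : 0 < p := lt_trans (ltr0n R 2) p2.

Let SE z : cmod z < 1 -> S z = epow F (- 1) z.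
Proof. by move=> z1; rewrite SF// /epow rmorphN rmorph1 mulN1r. Qed.

Lemma holo_S : holo S.
Proof. by apply: holo_ext SE _; exact: holo_epow. Qed.

Let hT (P : {poly R[i]}) : holo (fun z => P.[z] * S z - 1).
Proof.
by apply: holoB; [apply: holoM; [exact: holo_poly|exact: holo_S]|exact: holo_cst].
Qed.

Let energy_ext g1 g2 : (forall w, cmod w < 1 -> g1 w = g2 w) -> energy p g1 = energy p g2.
Proof. by move=> e; apply: eq_integral => w; rewrite inE => w1; rewrite e. Qed.

Let z1 : cmod (0 : R[i]) < 1. Proof. by rewrite cmod0. Qed.

Lemma approx_inverse_S e : 0 < e -> exists P : {poly R[i]},
  (energy p (cderive (fun z => P.[z] * S z - 1)%R) <= e%:E)%E /\
  cmod (P.[0] * S 0 - 1) <= e.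
Proof.
move=> e0; have [P [H1 H2]] := approx_inverse holoF K0 p2 ReF dF e0.
exists P; split; last by rewrite SF.
apply: le_trans H1; rewrite le_eqVlt; apply/orP; left; apply/eqP.
apply: energy_ext => w w1; apply: cderive_ext w1; last first.
  by apply: holo_ext (hT P) => z zz; rewrite SF.
by move=> z zz; rewrite SF.
Qed.

Lemma energy_S : exists E : R, (energy p (cderive S) <= E%:E)%E.
Proof.
have [E [E0 HE]] := energy_beta p2; exists (K `^ p * E).
apply: (HE _ K K0 (holo_cmeasurable (holo_cderive holo_S))).
move=> w w1; rewrite (cderive_ext (fun z zz => esym (SE zz)) (holo_epow holoF _) w1).
by have := cmod_cderive_epow holoF ReF dF ler01 w1; rewrite mul1r.
Qed.

Lemma cyclic_D : cyclic_in (D_norm p) S.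
Proof.
have [E HE] := energy_S.
apply: cyclic_of_approx; first by move=> g; exact: D_norm_ge0.
  split; first exact: holo_analytic holo_S.
  by apply: le_lt_trans (D_norm_le (ltW p0) HE) _; rewrite ltry.
move=> e e0; have e2 : 0 < e / 2 by rewrite divr_gt0.
pose d := Num.min (e / 2) ((e / 2) `^ p).
have d0 : 0 < d by rewrite lt_min e2 powR_gt0.
have [P [H1 H2]] := approx_inverse_S d0; exists P.
apply: le_trans (D_norm_le (ltW p0) H1) _; rewrite lee_fin [leRHS](splitr e).
apply: lerD; first by apply: le_trans H2 _; rewrite ge_min lexx.
apply: (@le_trans _ _ (((e / 2) `^ p) `^ p^-1)).
  by apply: powR_mono; [rewrite invr_ge0 ltW|exact: ltW|rewrite ge_min lexx orbT].
by rewrite -powRrM mulfV ?gt_eqF// powRr1// ltW.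
Qed.

Lemma cyclic_lA : cyclic_in (lA_norm p) S.
Proof.
have [E HE] := energy_S.
apply: cyclic_of_approx; first by move=> g; exact: lA_norm_ge0.
  split; first exact: holo_analytic holo_S.
  by apply: le_lt_trans (lA_norm_le p2 holo_S HE) _; rewrite ltry.
move=> e e0; have c0 := cblock_gt0 (R := R) p.
have ep : 0 < e `^ p / (1 + cblock p) by rewrite divr_gt0 ?powR_gt0 ?addr_gt0.
pose d := Num.min 1 (e `^ p / (1 + cblock p)).
have d0 : 0 < d by rewrite lt_min ltr01.
have [P [H1 H2]] := approx_inverse_S d0; exists P.
apply: le_trans (lA_norm_le p2 (hT P) H1) _; rewrite lee_fin.
apply: (@le_trans _ _ ((e `^ p) `^ p^-1)); last first.
  by rewrite -powRrM mulfV ?gt_eqF// powRr1// ltW.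
have cd0 : 0 <= cblock p * d by rewrite mulr_ge0// ltW.
apply: powR_mono; [by rewrite invr_ge0 ltW|by rewrite addr_ge0 ?powR_ge0|].
apply: (@le_trans _ _ ((1 + cblock p) * d)).
  rewrite mulrDl mul1r lerD2r; apply: le_trans (powR_mono (ltW p0) (cmod_ge0 _) H2) _.
  rewrite powR_pos// -[leRHS]lnK ?posrE// ler_expR.
  apply: ler_neMl; first by rewrite ln_le0// ge_min lexx.
  exact: le_trans (ler1n R 2) (ltW p2).
have c1 : 0 < 1 + cblock p :> R by rewrite addr_gt0.
by rewrite mulrC -ler_pdivlMr// ge_min lexx orbT.
Qed.

End Cyclicity.

Theorem theorem1p1 (R : realType)
    (mu : {finite_measure set (measurableTypeR R) -> \bar R})
    (mu_circle : on_circle mu)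
    (mu_singular : circle_singular mu)
    (C : R) (C_gt0 : 0 < C)
    (mu_smooth : forall t : R, 0 < t -> t < 1 ->
      (modulus_of_smoothness mu t <=
         (C * (t / Num.sqrt (ln (expR 1 / t))))%:E)%E) :
  forall p : R, 2 < p ->
    cyclic_in (D_norm p) (singular_inner mu) /\
    cyclic_in (lA_norm p) (singular_inner mu).
Proof.
move=> p p2; have [K [K0 HK]] := herglotz_derivative_bound C_gt0 mu_smooth.
have hF : holo (pval (Fcoef mu)) := holo_pval (rad1_Fcoef mu).
have dF z : cmod z < 1 -> cmod (cderive (pval (Fcoef mu)) z) <= K * beta (cmod z).
  by move=> z1; rewrite (cderive_pval (rad1_Fcoef mu) (fun _ _ => erefl) z1); exact: HK.
have SF z (z1 : cmod z < 1) := singular_inner_pval mu z1.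
split.
  exact: cyclic_D hF K0 p2 (@Re_Fcoef_ge0 R mu) dF SF.
exact: cyclic_lA hF K0 p2 (@Re_Fcoef_ge0 R mu) dF SF.
Qed.
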